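(* Let $\mathbf{k}$ be an algebraically closed field of characteristic $p>2$. For $1<i<p-1$, the maximal ideal $\mathcal{J}^{(i)}<\mathbf{k}S_\infty$ is generated (as a two-sided ideal) by the skew symmetriser in $\mathbf{k}S_{i+1}$ and the symmetriser in $\mathbf{k}S_{p+1-i}$.
   Context: $S_\infty=\bigcup_nS_n$. The symmetriser in $\mathbf{k}S_m\subset\mathbf{k}S_\infty$ is $\sum_{\sigma\in S_m}\sigma$ and the skew symmetriser is $\sum_{\sigma\in S_m}\mathrm{sgn}(\sigma)\sigma$. $\mathrm{Rep}\,S_n$ is the category of finite-dimensional $\mathbf{k}S_n$-modules. A pseudo-abelian subcategory is a full subcategory closed under finite direct sums and direct summands. An inductive system $\mathbf{A}$ is an assignment of a pseudo-abelian subcategory $\mathbf{A}^n\subset\mathrm{Rep}\,S_n$ for each $n\in\mathbb{Z}_{>0}$ such that $\mathbf{A}^{n-1}$ is the minimal pseudo-abelian subcategory of $\mathrm{Rep}\,S_{n-1}$ containing the restrictions of all objects of $\mathbf{A}^n$. It is semisimple if every $\mathbf{A}^n$ consists of semisimple representations. To an inductive system $\mathbf{A}$ one associates the two-sided ideal $\mathcal{J}(\mathbf{A})<\mathbf{k}S_\infty$ determined by $\mathcal{J}(\mathbf{A})\cap\mathbf{k}S_n=\bigcap_{M\in\mathbf{A}^n}\mathrm{Ann}_{\mathbf{k}S_n}M$ for all $n$. By a theorem of Kleshchev there are exactly $p-1$ minimal (non-zero) semisimple inductive systems $\mathbf{CS}(s)$, $1\le s\le p-1$, labelled so that $\mathbf{CS}^n(1)$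 consists of the trivial $S_n$-representations (direct sums of $\mathbf 1$) and, for $s>1$, $\mathbf{CS}^n(s)$ contains the trivial representation if and only if $n+s\le p$ (this determines the labelling). Put $\mathcal{J}^{(i)}:=\mathcal{J}(\mathbf{CS}(i))$. By a theorem of Baranov and Kleshchev, for $p>2$ the ideals $\mathcal{J}^{(i)}$, $1\le i<p$, are precisely the maximal ideals of $\mathbf{k}S_\infty$. *)

(* Defs.v *)
From HB Require Import structures.
From mathcomp Require Import all_boot all_order all_algebra all_fingroup.
From mathcomp Require Import mxrepresentation character.
From mathcomp Require Import boolp classical_sets.
From mathcomp Require Import finmap monalg.

Set Implicit Arguments.
Unset Strict Implicit.
Unset Printing Implicit Defensive.

Import GRing.Theory.
Local Open Scope classical_set_scope.
Local Open Scope ring_scope.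

(* [monalg] only multiplies elements of {malg R[K]} for monoids K without
   nontrivial units, so the convolution product is rebuilt here for groups. *)
Definition groupalg (R : comNzRingType) (G : groupType) : Type := {malg R[G]}.

Section GroupAlgebra.
Variables (R : comNzRingType) (G : groupType).
Implicit Types (x y z : groupalg R G) (a b : R) (g h : G).

HB.instance Definition _ := GRing.Lmodule.copy (groupalg R G) {malg R[G]}.

Fact ga_mul_key : unit. Proof. exact: tt. Qed.

Definition ga_mul : groupalg R G -> groupalg R G -> groupalg R G :=
  locked_with ga_mul_key (fun x y =>
    \sum_(g <- msupp x) \sum_(h <- msupp y) << x@_g * y@_h *g (g * h)%g >>).

Canonical ga_mul_unlockable := [unlockable of ga_mul].

Definition ga_one : groupalg R G := << 1%g >>.

Lemma ga_mulw (A B : {fset G}) x y : (msupp x `<=` A)%fset -> (msupp y `<=` B)%fset ->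
  ga_mul x y = \sum_(g <- A) \sum_(h <- B) << x@_g * y@_h *g (g * h)%g >>.
Proof.
move=> xA yB; rewrite unlock (big_fset_incl _ xA) /=.
  apply: eq_bigr => g _; apply: big_fset_incl => // h _ /mcoeff_outdom ->.
  by rewrite mulr0 monalgU0.
move=> g _ /mcoeff_outdom xg.
by rewrite big1 // => h _; rewrite xg mul0r monalgU0.
Qed.

Lemma ga_mulDl : left_distributive ga_mul +%R.
Proof.
move=> x y z; pose A := (msupp x `|` msupp y)%fset.
rewrite (@ga_mulw A (msupp z)) ?msuppD_le //.
rewrite (@ga_mulw A (msupp z) x) ?fsubsetUl //.
rewrite (@ga_mulw A (msupp z) y) ?fsubsetUr //.
rewrite -big_split; apply: eq_bigr => g _.
rewrite -big_split; apply: eq_bigr => h _.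
by rewrite mcoeffD mulrDl monalgUD.
Qed.

Lemma ga_mulDr : right_distributive ga_mul +%R.
Proof.
move=> z x y; pose A := (msupp x `|` msupp y)%fset.
rewrite (@ga_mulw (msupp z) A) ?msuppD_le //.
rewrite (@ga_mulw (msupp z) A z x) ?fsubsetUl //.
rewrite (@ga_mulw (msupp z) A z y) ?fsubsetUr //.
rewrite -big_split; apply: eq_bigr => g _.
rewrite -big_split; apply: eq_bigr => h _.
by rewrite mcoeffD mulrDr monalgUD.
Qed.

Lemma ga_mul0r : left_zero 0 ga_mul.
Proof. by move=> x; rewrite unlock msupp0 big_seq_fset0. Qed.

Lemma ga_mulr0 : right_zero 0 ga_mul.
Proof.
by move=> x; rewrite unlock big1 // => g _; rewrite msupp0 big_seq_fset0.
Qed.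

Lemma ga_mulUU a b g h :
  ga_mul << a *g g >> << b *g h >> = << a * b *g (g * h)%g >>.
Proof.
by rewrite (ga_mulw msuppU_le msuppU_le) !big_seq_fset1 !mcoeffUU.
Qed.

Lemma ga_ind (P : groupalg R G -> Prop) :
  P 0 -> (forall x y, P x -> P y -> P (x + y)) ->
  (forall a g, P << a *g g >>) -> forall x, P x.
Proof.
by move=> P0 PD PU x; rewrite (monalgE x); apply: (big_ind P) => // g _.
Qed.

Lemma ga_mulA : associative ga_mul.
Proof.
move=> x y z; elim/ga_ind: x => [|x x' IHx IHx'|a g].
- by rewrite !ga_mul0r.
- by rewrite !ga_mulDl IHx IHx'.
elim/ga_ind: y => [|y y' IHy IHy'|b h].
- by rewrite ga_mulr0 !ga_mul0r ga_mulr0.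
- by rewrite ga_mulDr !ga_mulDl ga_mulDr IHy IHy'.
elim/ga_ind: z => [|z z' IHz IHz'|c l].
- by rewrite !ga_mulr0.
- by rewrite !ga_mulDr IHz IHz'.
by rewrite !ga_mulUU mulrA mulgA.
Qed.

Lemma ga_mul1r : left_id ga_one ga_mul.
Proof.
move=> x; elim/ga_ind: x => [|x y IHx IHy|a g]; first exact: ga_mulr0.
  by rewrite ga_mulDr IHx IHy.
by rewrite ga_mulUU mul1r mul1g.
Qed.

Lemma ga_mulr1 : right_id ga_one ga_mul.
Proof.
move=> x; elim/ga_ind: x => [|x y IHx IHy|a g]; first exact: ga_mul0r.
  by rewrite ga_mulDl IHx IHy.
by rewrite ga_mulUU mulr1 mulg1.
Qed.

Lemma ga_one_neq0 : ga_one != 0.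
Proof. by rewrite monalgU_eq0 oner_eq0. Qed.

HB.instance Definition _ := GRing.Zmodule_isNzRing.Build (groupalg R G)
  ga_mulA ga_mul1r ga_mulr1 ga_mulDl ga_mulDr ga_one_neq0.

Lemma ga_mulU a b g h :
  (<< a *g g >> : groupalg R G) * (<< b *g h >> : groupalg R G)
    = << a * b *g (g * h)%g >>.
Proof. exact: ga_mulUU. Qed.

Lemma ga_scaleU a b g : a *: (<< b *g g >> : groupalg R G) = << a * b *g g >>.
Proof. by apply/malgP => h; rewrite mcoeffZ !mcoeffU mulrnAr. Qed.

Lemma ga_scaleAl a x y : a *: (x * y) = a *: x * y.
Proof.
elim/ga_ind: x => [|x x' IHx IHx'|b g]; first by rewrite scaler0 !mul0r scaler0.
  by rewrite scalerDr !mulrDl scalerDr IHx IHx'.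
elim/ga_ind: y => [|y y' IHy IHy'|c h]; first by rewrite !mulr0 scaler0.
  by rewrite !mulrDr scalerDr IHy IHy'.
by rewrite ga_scaleU !ga_mulU ga_scaleU mulrA.
Qed.

HB.instance Definition _ :=
  GRing.Lmodule_isLalgebra.Build R (groupalg R G) ga_scaleAl.

Lemma ga_scaleAr a x y : a *: (x * y) = x * (a *: y).
Proof.
elim/ga_ind: x => [|x x' IHx IHx'|b g]; first by rewrite !mul0r scaler0.
  by rewrite !mulrDl scalerDr IHx IHx'.
elim/ga_ind: y => [|y y' IHy IHy'|c h]; first by rewrite scaler0 !mulr0 scaler0.
  by rewrite scalerDr !mulrDr scalerDr IHy IHy'.
by rewrite ga_scaleU !ga_mulU ga_scaleU mulrCA.
Qed.

HB.instance Definition _ :=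
  GRing.Lalgebra_isAlgebra.Build R (groupalg R G) ga_scaleAr.

End GroupAlgebra.

Definition two_sided_ideal (R : nzRingType) (I : set R) : Prop :=
  [/\ I 0, (forall x y, I x -> I y -> I (x - y))
    & (forall a x b, I x -> I (a * x * b))].

Definition ideal_generated (R : nzRingType) (X : set R) : set R :=
  smallest (@two_sided_ideal R) X.

Definition finitary (f : nat -> nat) : Prop :=
  bijective f /\ exists n, forall m, (n <= m)%N -> f m = m.

Definition Sinf : Type := {f : nat -> nat | `[< finitary f >]}.

HB.instance Definition _ := Choice.on Sinf.

Section SInfinity.
Implicit Types s t : Sinf.

Lemma Sinf_eqP s t : val s =1 val t -> s = t.
Proof. by move=> e; apply: val_inj; apply/funext. Qed.

Lemma SinfP s : finitary (val s).
Proof. exact/asboolP/(valP s). Qed.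

Lemma finitary_id : finitary id.
Proof. by split; [exists id | exists 0%N]. Qed.

Lemma finitary_comp f g : finitary f -> finitary g -> finitary (g \o f).
Proof.
case=> bf [n fn] [bg [m gm]]; split; first exact: bij_comp.
by exists (maxn n m) => i; rewrite geq_max => /andP[ni mi] /=; rewrite fn ?gm.
Qed.

Lemma Sinf_inv_ex s : {g : nat -> nat | cancel (val s) g & finitary g}.
Proof.
apply/cid2; have [[g sK gK] [n sn]] := SinfP s; exists g => //.
split; first by exists (val s).
by exists n => m nm; rewrite -{1}(sn m nm) sK.
Qed.

Definition Sinf_one : Sinf := exist _ id (asboolT finitary_id).

(* As for [perm]: (s * t) i = t (s i). *)
Definition Sinf_mul s t : Sinf :=
  exist _ (val t \o val s) (asboolT (finitary_comp (SinfP s) (SinfP t))).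

Definition Sinf_inv s : Sinf :=
  let: exist2 g _ fg := Sinf_inv_ex s in exist _ g (asboolT fg).

Lemma Sinf_mulA : associative Sinf_mul.
Proof. by move=> s t u; apply: Sinf_eqP. Qed.

Lemma Sinf_mul1 : left_id Sinf_one Sinf_mul.
Proof. by move=> s; apply: Sinf_eqP. Qed.

Lemma Sinf_1mul : right_id Sinf_one Sinf_mul.
Proof. by move=> s; apply: Sinf_eqP. Qed.

Lemma Sinf_mulV : right_inverse Sinf_one Sinf_inv Sinf_mul.
Proof.
by move=> s; apply: Sinf_eqP => i; rewrite /Sinf_inv; case: Sinf_inv_ex => g /=.
Qed.

Lemma Sinf_mulV' : left_inverse Sinf_one Sinf_inv Sinf_mul.
Proof.
move=> s; apply: Sinf_eqP => i; rewrite /Sinf_inv; case: Sinf_inv_ex => g /= sK.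
by have [bs _] := SinfP s; move: sK => /(bij_can_sym bs) gK _; apply: gK.
Qed.

HB.instance Definition _ := isGroup.Build Sinf
  Sinf_mulA Sinf_mul1 Sinf_1mul Sinf_mulV' Sinf_mulV.

End SInfinity.

Section Inclusion.
Variable n : nat.
Implicit Types s t : 'S_n.

Definition ext_perm s (m : nat) : nat :=
  if insub m is Some i then val (s i) else m.

Lemma ext_permE s (i : 'I_n) : ext_perm s i = s i.
Proof. by rewrite /ext_perm valK. Qed.

Lemma ext_perm_out s m : (n <= m)%N -> ext_perm s m = m.
Proof. by move=> nm; rewrite /ext_perm insubN // -leqNgt. Qed.

Lemma ext_permM s t : ext_perm (s * t)%g =1 ext_perm t \o ext_perm s.
Proof.
move=> m /=; have [mn|nm] := ltnP m n; last by rewrite !ext_perm_out.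
by rewrite -[m]/(val (Ordinal mn)) !ext_permE permM.
Qed.

Lemma ext_perm1 : ext_perm 1%g =1 id.
Proof.
move=> m; have [mn|nm] := ltnP m n; last by rewrite ext_perm_out.
by rewrite -[m]/(val (Ordinal mn)) ext_permE perm1.
Qed.

Lemma finitary_ext_perm s : finitary (ext_perm s).
Proof.
split; last by exists n => m; apply: ext_perm_out.
exists (ext_perm s^-1%g) => m.
  by rewrite -[LHS](ext_permM s s^-1%g) mulgV ext_perm1.
by rewrite -[LHS](ext_permM s^-1%g s) mulVg ext_perm1.
Qed.

Definition Sn_incl s : Sinf := exist _ (ext_perm s) (asboolT (finitary_ext_perm s)).

Lemma Sn_inclM s t : Sn_incl (s * t)%g = (Sn_incl s * Sn_incl t)%g.
Proof. by apply: Sinf_eqP; apply: ext_permM. Qed.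

Lemma Sn_incl_inj : injective Sn_incl.
Proof.
move=> s t /(congr1 val) /= e; apply/permP => i; apply: val_inj.
by rewrite /= -!ext_permE e.
Qed.

End Inclusion.

Lemma Sn_incl_lift n (s : 'S_n) :
  Sn_incl (lift_perm ord_max ord_max s) = Sn_incl s.
Proof.
apply: Sinf_eqP => m /=; have [mn|nm] := ltnP m n.
  have em : m = lift ord_max (Ordinal mn) by rewrite lift_max.
  rewrite [in LHS]em ext_permE lift_perm_lift lift_max.
  by rewrite -[m]/(val (Ordinal mn)) ext_permE.
rewrite (ext_perm_out s nm); have [->|mn] := eqVneq m n.
  by rewrite -[n]/(val (@ord_max n)) ext_permE lift_perm_id.
by rewrite ext_perm_out // ltn_neqAle eq_sym mn.
Qed.

Lemma Sinf_bigcup : [set: Sinf] = \bigcup_n range (@Sn_incl n).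
Proof.
apply/esym/seteqP; split=> // s _; have [bs [n sn]] := SinfP s; exists n => //.
have s_lt (i : 'I_n) : (val s i < n)%N.
  rewrite ltnNge; apply/negP => ns; have /bij_inj si := bs.
  by have := ltn_ord i; rewrite -{1}(si _ _ (sn _ ns)) ltnNge ns.
have inj_s : injective (fun i : 'I_n => Ordinal (s_lt i)).
  by move=> i j [] /(bij_inj bs) /val_inj.
exists (perm inj_s) => //; apply: Sinf_eqP => m /=.
have [mn|nm] := ltnP m n; last by rewrite ext_perm_out ?sn.
by rewrite -[m]/(val (Ordinal mn)) ext_permE permE.
Qed.

Section Main.
Variable k : closedFieldType.

Local Notation kS n := (groupalg k 'S_n).
Local Notation kSinf := (groupalg k Sinf).
Local Notation RepS n := (representation k [set: 'S_n]%G).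

Definition kSn_incl n (x : kS n) : kSinf :=
  \sum_(s : 'S_n) << x@_s *g Sn_incl s >>.

Definition symmetriser m : kSinf := kSn_incl (\sum_(s : 'S_m) << s >> : kS m).

Definition skew_symmetriser m : kSinf :=
  kSn_incl (\sum_(s : 'S_m) << (-1) ^+ s *g s >> : kS m).

(* Permutations compose left to right and matrices act on row vectors from the
   right, so these are the usual left modules over the usual kS_n. *)
Definition kS_act n (M : RepS n) (x : kS n) : 'M[k]_(rdegree M) :=
  \sum_(s : 'S_n) x@_s *: M s.

Definition Ann n (M : RepS n) : set (kS n) := [set x | kS_act M x = 0].

(* lift_perm ord_max ord_max s is s extended by fixing the last point. *)
Lemma res_mx_repr n (M : RepS n.+1) :
  mx_repr [set: 'S_n]%G (fun s => M (lift_perm ord_max ord_max s)).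
Proof.
split=> [|s t _ _]; first by rewrite lift_perm1 repr_mx1.
by rewrite -(lift_permM _ ord_max) repr_mxM ?inE.
Qed.

Definition Res n (M : RepS n.+1) : RepS n :=
  Representation (MxRepresentation (res_mx_repr M)).

Lemma triv_mx_repr n : mx_repr [set: 'S_n]%G (fun _ => 1%:M : 'M[k]_1).
Proof. by split=> // s t _ _; rewrite mulmx1. Qed.

Definition triv n : RepS n := Representation (MxRepresentation (triv_mx_repr n)).

Definition direct_summand n (M N : RepS n) : Prop :=
  exists M' : RepS n, mx_rsim (dadd_grepr M M') N.

(* A full subcategory is given by its class of objects. *)
Definition pseudo_abelian n (C : set (RepS n)) : Prop :=
  [/\ C grepr0, (forall M N, C M -> C N -> C (dadd_grepr M N))
    & (forall M N, direct_summand M N -> C N -> C M)].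

Definition semisimple n (M : RepS n) : Prop := inhabited (mxsemisimple M 1%:M).

(* Only the values A n with n > 0 are meaningful. *)
Definition Rep_family := forall n, set (RepS n).
Implicit Types A B : Rep_family.

Definition inductive_system A : Prop := forall n, (0 < n)%N ->
  pseudo_abelian (A n) /\ A n = smallest (@pseudo_abelian n) (@Res n @` A n.+1).

Definition nonzero_family A : Prop :=
  exists n (M : RepS n), [/\ (0 < n)%N, A n M & (0 < rdegree M)%N].

Definition semisimple_system A : Prop :=
  inductive_system A /\
  forall n (M : RepS n), (0 < n)%N -> A n M -> semisimple M.

Definition sub_family A B : Prop := forall n, (0 < n)%N -> A n `<=` B n.

Definition minimal_semisimple_system A : Prop :=
  [/\ semisimple_system A, nonzero_family A
    & forall B, semisimple_system B -> nonzero_family B ->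
        sub_family B A -> sub_family A B].

(* A is the minimal semisimple inductive system with label s: the labels
   distinguish these systems, up to the irrelevant value of A at n = 0. *)
Definition is_CS (p s : nat) A : Prop :=
  [/\ (0 < s < p)%N, minimal_semisimple_system A
    & if s == 1%N then
        forall n, (0 < n)%N ->
          A n = [set M : RepS n | exists d, mx_rsim M (muln_grepr (triv n) d)]
      else forall n, (0 < n)%N -> (A n (triv n) <-> (n + s <= p)%N)].

Definition ideal_of A : set kSinf :=
  \bigcup_(n in [set n | (0 < n)%N])
    (@kSn_incl n @` \bigcap_(M in A n) Ann M).

Lemma kSn_incl0 n : kSn_incl (0 : kS n) = 0.
Proof. by rewrite /kSn_incl big1 // => s _; rewrite mcoeff0 monalgU0. Qed.

Lemma kSn_inclD n (x y : kS n) : kSn_incl (x + y) = kSn_incl x + kSn_incl y.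
Proof.
by rewrite /kSn_incl -big_split; apply: eq_bigr => s _; rewrite mcoeffD monalgUD.
Qed.

Lemma kSn_inclN n (x : kS n) : kSn_incl (- x) = - kSn_incl x.
Proof.
by apply/eqP; rewrite -addr_eq0 -kSn_inclD addNr kSn_incl0.
Qed.

Lemma kSn_inclU n a (s : 'S_n) :
  kSn_incl (<< a *g s >> : kS n) = << a *g Sn_incl s >>.
Proof.
rewrite /kSn_incl (bigD1 s) //= mcoeffUU big1 ?addr0 // => t ts.
by rewrite mcoeffU eq_sym (negbTE ts) monalgU0.
Qed.

Lemma kSn_inclM n (x y : kS n) : kSn_incl (x * y) = kSn_incl x * kSn_incl y.
Proof.
elim/ga_ind: x => [|x x' IHx IHx'|a s].
- by rewrite [X in kSn_incl X]mul0r kSn_incl0 [RHS]mul0r.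
- rewrite [X in kSn_incl X]mulrDl (kSn_inclD (x * y)) (kSn_inclD x) [RHS]mulrDl.
  by rewrite IHx IHx'.
elim/ga_ind: y => [|y y' IHy IHy'|b t].
- by rewrite [X in kSn_incl X]mulr0 kSn_incl0 [RHS]mulr0.
- rewrite [X in kSn_incl X]mulrDr (kSn_inclD (_ * y)) (kSn_inclD y) [RHS]mulrDr.
  by rewrite IHy IHy'.
by rewrite [X in kSn_incl X]ga_mulU !kSn_inclU [RHS]ga_mulU Sn_inclM.
Qed.

Lemma kSn_incl_coeff n (x : kS n) s : (kSn_incl x)@_(Sn_incl s) = x@_s.
Proof.
rewrite /kSn_incl raddf_sum (bigD1 s) //= mcoeffUU big1 ?addr0 // => t ts.
by rewrite mcoeffU (inj_eq (@Sn_incl_inj n)) (negbTE ts).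
Qed.

Lemma kSn_incl_inj n : injective (@kSn_incl n).
Proof. by move=> x y e; apply/malgP => s; rewrite -!kSn_incl_coeff e. Qed.

Lemma kS_act0 n (M : RepS n) : kS_act M 0 = 0.
Proof. by rewrite /kS_act big1 // => s _; rewrite mcoeff0 scale0r. Qed.

Lemma kS_actD n (M : RepS n) x y : kS_act M (x + y) = kS_act M x + kS_act M y.
Proof.
by rewrite /kS_act -big_split; apply: eq_bigr => s _; rewrite mcoeffD scalerDl.
Qed.

Lemma kS_actN n (M : RepS n) x : kS_act M (- x) = - kS_act M x.
Proof. by apply/eqP; rewrite -addr_eq0 -kS_actD addNr kS_act0. Qed.

Lemma kS_actU n (M : RepS n) a s : kS_act M << a *g s >> = a *: M s.
Proof.
rewrite /kS_act (bigD1 s) //= mcoeffUU big1 ?addr0 // => t ts.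
by rewrite mcoeffU eq_sym (negbTE ts) scale0r.
Qed.

Lemma kS_actM n (M : RepS n) (x y : kS n) :
  kS_act M (x * y) = kS_act M x *m kS_act M y.
Proof.
elim/ga_ind: x => [|x x' IHx IHx'|a s].
- by rewrite mul0r kS_act0 mul0mx.
- by rewrite mulrDl !kS_actD mulmxDl IHx IHx'.
elim/ga_ind: y => [|y y' IHy IHy'|b t].
- by rewrite mulr0 kS_act0 mulmx0.
- by rewrite mulrDr !kS_actD mulmxDr IHy IHy'.
rewrite ga_mulU !kS_actU repr_mxM ?inE //.
by rewrite -scalemxAl -scalemxAr scalerA.
Qed.

Lemma kS_act_dadd n (M N : RepS n) x :
  kS_act (dadd_grepr M N) x = block_mx (kS_act M x) 0 0 (kS_act N x).
Proof.
elim/ga_ind: x => [|x y IHx IHy|a s]; first by rewrite !kS_act0 block_mx0.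
  by rewrite !kS_actD IHx IHy add_block_mx !addr0.
by rewrite !kS_actU scale_block_mx !scaler0.
Qed.

Lemma kS_act_hom n (M N : RepS n) (f : 'M_(rdegree M, rdegree N)) x :
  (forall s, M s *m f = f *m N s) -> kS_act M x *m f = f *m kS_act N x.
Proof.
move=> fM; rewrite /kS_act mulmx_suml mulmx_sumr; apply: eq_bigr => s _.
by rewrite -scalemxAl fM scalemxAr.
Qed.

Lemma pseudo_abelian_killed n (x : kS n) :
  pseudo_abelian [set M : RepS n | Ann M x].
Proof.
split=> [|M N Mx Nx|M N [M' [f eq_d f_free fM]] Nx]; rewrite /Ann /=.
- exact: flatmx0.
- by rewrite kS_act_dadd Mx Nx block_mx0.
have /row_freeP[g fg] := f_free.
have := @kS_act_hom _ (dadd_grepr M M') N f x (fun s => fM s (finset.in_setT s)).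
rewrite [kS_act N x]Nx mulmx0 => /(congr1 (mulmx^~ g)).
rewrite -mulmxA fg mulmx1 mul0mx kS_act_dadd -[0 in RHS]block_mx0.
by case/eq_block_mx.
Qed.

Definition kS_widen n (x : kS n) : kS n.+1 :=
  \sum_(s : 'S_n) << x@_s *g lift_perm ord_max ord_max s >>.

Lemma kSn_incl_widen n (x : kS n) : kSn_incl (kS_widen x) = kSn_incl x.
Proof.
rewrite /kS_widen (big_morph _ (@kSn_inclD n.+1) (kSn_incl0 _)).
by apply: eq_bigr => s _; rewrite kSn_inclU Sn_incl_lift.
Qed.

Lemma kS_act_widen n (M : RepS n.+1) x : kS_act M (kS_widen x) = kS_act (Res M) x.
Proof.
rewrite /kS_widen (big_morph _ (@kS_actD _ M) (kS_act0 M)).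
by apply: eq_bigr => s _; rewrite kS_actU.
Qed.

Lemma Ann_widen A n (x : kS n) : inductive_system A -> (0 < n)%N ->
  (\bigcap_(M in A n.+1) Ann M) (kS_widen x) <-> (\bigcap_(M in A n) Ann M) x.
Proof.
move=> indA n0; have [_ eqA] := indA n n0; split=> [Ax M|Ax M AM].
  rewrite eqA => /(_ [set M | Ann M x]); apply; split.
    exact: pseudo_abelian_killed.
  by move=> _ [N AN <-]; rewrite /Ann /= -kS_act_widen; apply: Ax.
rewrite /Ann /= kS_act_widen; apply: (Ax (Res M)); rewrite /= eqA.
by apply: sub_gen_smallest; exists M.
Qed.

Lemma Ann_widen_leq A n m (x : kS n) : inductive_system A ->
    (0 < n <= m)%N ->
  exists y : kS m, kSn_incl y = kSn_incl x /\
    ((\bigcap_(M in A m) Ann M) y <-> (\bigcap_(M in A n) Ann M) x).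
Proof.
move=> indA /andP[n0]; elim: m => [|m IHm].
  by rewrite leqn0 => /eqP n_eq0; rewrite n_eq0 in n0.
rewrite leq_eqVlt => /orP[/eqP <-|nm]; first by exists x.
have [y [yx Ay]] := IHm nm; exists (kS_widen y); rewrite kSn_incl_widen.
by split=> //; rewrite (Ann_widen y indA (leq_trans n0 nm)).
Qed.

(* The characterisation of ideal_of A by its intersections with each kS n. *)
Lemma ideal_ofP A n (x : kS n) : inductive_system A -> (0 < n)%N ->
  ideal_of A (kSn_incl x) <-> (\bigcap_(M in A n) Ann M) x.
Proof.
move=> indA n0; split=> [[m /= m0 [y Ay yx]]|Ax]; last by exists n => //; exists x.
pose N := maxn m n.
have [|y' [y'y Ay']] := @Ann_widen_leq A m N y indA; first by rewrite m0 leq_maxl.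
have [|x' [x'x Ax']] := @Ann_widen_leq A n N x indA; first by rewrite n0 leq_maxr.
apply/Ax'; suff -> : x' = y' by apply/Ay'.
by apply: kSn_incl_inj; rewrite x'x y'y yx.
Qed.

Lemma kSinf_exhaust (x : kSinf) :
  exists n, (0 < n)%N /\ forall m, (n <= m)%N -> exists y : kS m, kSn_incl y = x.
Proof.
elim/ga_ind: x => [|x y [n [n0 xn]] [m [m0 ym]]|a s].
- by exists 1%N; split=> // m _; exists 0; rewrite kSn_incl0.
- exists (maxn n m); split=> [|l]; first by rewrite leq_max n0.
  rewrite geq_max => /andP[/xn[x' <-] /ym[y' <-]].
  by exists (x' + y'); rewrite kSn_inclD.
have : [set: Sinf] s by [].
rewrite Sinf_bigcup => -[n _ [t _ <-]].
have incl_leq m : (n <= m)%N -> exists u : 'S_m, Sn_incl u = Sn_incl t.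
  elim: m => [|m IHm].
    by rewrite leqn0 => /eqP n_eq0; move: t; rewrite n_eq0 => t; exists t.
  rewrite leq_eqVlt => /orP[/eqP <-|/IHm[u <-]]; first by exists t.
  by exists (lift_perm ord_max ord_max u); rewrite Sn_incl_lift.
exists n.+1; split=> // m /ltnW /incl_leq[u <-].
by exists << a *g u >>; rewrite kSn_inclU.
Qed.

Lemma ideal_of_two_sided A : inductive_system A -> two_sided_ideal (ideal_of A).
Proof.
move=> indA; split=> [|x y|a x b].
- by exists 1%N => //; exists 0; [move=> M _; apply: kS_act0 | apply: kSn_incl0].
- have [n [n0 xn]] := kSinf_exhaust x; have [m [m0 ym]] := kSinf_exhaust y.
  have N0 : (0 < maxn n m)%N by rewrite leq_max n0.
  have [x' <-] := xn _ (leq_maxl n m); have [y' <-] := ym _ (leq_maxr n m).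
  rewrite -kSn_inclN -kSn_inclD => /(ideal_ofP _ indA N0) Ax.
  move=> /(ideal_ofP _ indA N0) Ay; apply/(ideal_ofP _ indA N0) => M AM.
  by rewrite /Ann /= kS_actD kS_actN Ax // Ay // subrr.
have [n [n0 xn]] := kSinf_exhaust x; have [m [m0 am]] := kSinf_exhaust a.
have [l [l0 bl]] := kSinf_exhaust b; pose N := maxn n (maxn m l).
have N0 : (0 < N)%N by rewrite leq_max n0.
have [x' <-] := xn N (leq_maxl _ _).
have [a' <-] := am N (leq_trans (leq_maxl _ _) (leq_maxr _ _)).
have [b' <-] := bl N (leq_trans (leq_maxr _ _) (leq_maxr _ _)).
rewrite -!kSn_inclM => /(ideal_ofP _ indA N0) Ax.
apply/(ideal_ofP _ indA N0) => M AM.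
by rewrite /Ann /= !kS_actM (Ax M AM) mulmx0 mul0mx.
Qed.

End Main.

(* Main.v *)
From HB Require Import structures.
Require Import Defs.
From mathcomp Require Import all_boot all_order all_algebra all_fingroup.
From mathcomp Require Import mxrepresentation character.
From mathcomp Require Import ring_quotient generic_quotient.
From mathcomp Require Import boolp classical_sets.
From mathcomp Require Import finmap monalg.
From mathcomp Require Import zify ring.

Set Implicit Arguments.
Unset Strict Implicit.
Unset Printing Implicit Defensive.

Import GRing.Theory.
Local Open Scope classical_set_scope.
Local Open Scope ring_scope.

(* Write J for the ideal generated by the two symmetrisers and I for the ideal of
   the system A.

   J is contained in I. An invariant vector in a semisimple module splits off a
   trivial summand, so the label of A gives the symmetriser. For the skew
   symmetriser, put m = p - i: the S_m-invariants in the restrictions of the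
   members of A form a non-zero semisimple inductive subsystem, which is all of A
   by minimality. Hence a vector of sign type for S_(i+1) in a member of A gives a
   vector of type (trivial of S_m) x (sign of S_(i+1)) in a member of A at level
   p + 1. It generates a quotient of a hook module, on which the class sum of
   transpositions of S_p is nilpotent and non-zero, contradicting semisimplicity
   at level p.

   I is contained in J, because kS_oo / J is simple. In this quotient every
   Jucys-Murphy element x satisfies x^p = x, so the joint spectral idempotents of
   x_1, .., x_n are indexed by words in F_p. The occurring words are the histories
   of i particles hopping on the cycle Z/p (the fusion rules of GL_i at level p - i
   for the vector representation). Corner rings at these idempotents are at most
   one-dimensional, isomorphic corners are exchanged by intertwiners, and every
   history extends to one containing any other as a prefix, so a non-zero ideal
   contains all the idempotents. *)

(** * Particle hops on a cycle *)

(** The hopping picture comes from Young diagrams with at most i rows: row r, counted from 0, is a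
    particle at its length minus r, and a box added to it moves the particle one step forward from
    the content of the box. Exclusion on the line keeps the rows weakly decreasing; exclusion modulo
    p adds that the first row exceeds the last by at most p - i.

    The obstacle is that kS_n is not semisimple for n >= p, so it is not known beforehand that the
    Jucys-Murphy elements are diagonalisable in the quotient or have eigenvalues in F_p. This and
    the list of occurring words are obtained together by induction: valid words of length n exclude
    Jordan blocks of the next Jucys-Murphy element, and its diagonalisability restricts the words of
    length n + 1.

    The bounds on i make (i + 1)! and (p + 1 - i)! invertible in k. A symmetriser acts on a vector
    of its own type by this factorial, so in the quotient such vectors vanish. That p is odd enters
    through divisions by 2. *)

Section Hops.
Variables (p i : nat).
Hypotheses (p_pr : prime p) (i_bnd : (1 < i < p - 1)%N).
Local Notation F := 'F_p.
Implicit Types (al be ga de : seq F) (a b c d r th : F).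

Lemma Fnat_eq j l : (j < p)%N -> (l < p)%N -> (j%:R == l%:R :> F) = (j == l).
Proof.
move=> jp lp; apply/eqP/eqP => [|-> //] /(congr1 val).
by rewrite /= !val_Fp_nat // !modn_small.
Qed.

Lemma Fnat_ex c : exists2 j, (j < p)%N & c = j%:R.
Proof.
exists (c : nat); last by rewrite natr_Zp.
by rewrite -[ltnRHS](Fp_cast p_pr).
Qed.

Lemma Fnat_p : p%:R = 0 :> F.
Proof. by apply: val_inj; rewrite /= val_Fp_nat // modnn. Qed.

Definition base c : bool := [exists j : 'I_i, c == - (j : nat)%:R].

(** In F_p the position -l is p - l. With the representatives 1, .., p the occupied positions form
    an interval; with 0, .., p - 1 they would not. *)
Lemma base_nat j : (0 < j <= p)%N -> base j%:R = (p - i < j)%N.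
Proof.
move=> /andP[j0 jp]; apply/existsP/idP => [[l /eqP]|].
  have lt_l := ltn_ord l; rewrite -[- _]add0r -Fnat_p.
  rewrite -natrB; last by lia.
  have [->|jp'] := eqVneq j p; first by lia.
  have [->|l0] := eqVneq (l : nat) 0%N.
    by rewrite subn0 Fnat_p => /eqP; rewrite -[0]/(0%:R) Fnat_eq; lia.
  by move/eqP; rewrite Fnat_eq => [/eqP| |]; lia.
move=> ji; have l_lt : (p - j < i)%N by lia.
by exists (Ordinal l_lt) => /=; rewrite natrB // opprB Fnat_p subr0.
Qed.

Lemma base_opp j : (j < p)%N -> base (- j%:R) = (j < i)%N.
Proof.
move=> jp; rewrite -[- _]add0r -Fnat_p -natrB; last by lia.
by rewrite base_nat; lia.
Qed.

(* Particles sit on the cycle Z/p, initially at 0, -1, .., -(i-1); a letter c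
   moves the particle at c to c + 1, and [state al c] is the number of
   particles at c after the moves al. *)
Definition state al c : int :=
  (base c)%:Z + (count_mem (c - 1) al)%:Z - (count_mem c al)%:Z.

Definition hop al c := (state al c == 1) && (state al (c + 1) == 0).

Definition valid al := forall be c ga, al = rcons be c ++ ga -> hop be c.

Lemma validE al c : valid (rcons al c) <-> valid al /\ hop al c.
Proof.
split=> [v|[v h] be d ga].
  split=> [be d ga e|]; last by apply: (v _ _ [::]); rewrite cats0.
  by apply: (v be d (rcons ga c)); rewrite e rcons_cat.
elim/last_ind: ga => [|ga c' _].
  by rewrite cats0 => /rcons_inj[<- <-].
by rewrite -rcons_cat => /rcons_inj[/v].
Qed.

Lemma valid_nil : valid [::].
Proof. by move=> be c ga; case: be. Qed.

Lemma valid_catl al be : valid (al ++ be) -> valid al.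
Proof. by move=> v ga c de e; apply: (v ga c (de ++ be)); rewrite catA e. Qed.

Lemma state_rcons al a c :
  state (rcons al a) c = state al c + (c == a + 1)%:Z - (c == a)%:Z.
Proof.
rewrite /state -!cats1 !count_cat /= !addn0 (eq_sym a (c - 1)) subr_eq.
by rewrite (eq_sym a c) !PoszD; ring.
Qed.

Lemma state_perm al be : perm_eq al be -> state al =1 state be.
Proof. by move=> /seq.permP e c; rewrite /state !e. Qed.

Lemma hop_perm al be c : perm_eq al be -> hop al c = hop be c.
Proof. by move=> e; rewrite /hop !(state_perm e). Qed.

Lemma Fone_neq0 : 1 != 0 :> F. Proof. exact: oner_neq0. Qed.

Lemma Ftwo_neq0 : 2%:R != 0 :> F.
Proof. by rewrite (@Fnat_eq 2 0); lia. Qed.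

Lemma addr1_neq c : (c + 1 == c) = false.
Proof. by rewrite -subr_eq0 [c + 1]addrC addrK (negbTE Fone_neq0). Qed.

Lemma neq_addr1 c : (c == c + 1) = false.
Proof. by rewrite eq_sym addr1_neq. Qed.

Lemma hop_last al a : hop al a ->
  (state (rcons al a) a = 0) * (state (rcons al a) (a + 1) = 1).
Proof.
case/andP=> /eqP h1 /eqP h0; rewrite !state_rcons !eqxx addr1_neq.
by rewrite eq_sym addr1_neq h0 h1.
Qed.

(** A hop at d changes only d and d + 1, while a hop at c looks only at c and c + 1; the hypotheses
    make these pairs disjoint. *)
Lemma hop_far al c d : c != d -> c != d + 1 -> d != c + 1 ->
  hop (rcons al d) c = hop al c.
Proof.
move=> cd cd1 dc1; rewrite /hop !state_rcons (negbTE cd) (negbTE cd1).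
rewrite (eq_sym _ d) (negbTE dc1) (inj_eq (addIr _)) (negbTE cd).
by rewrite !addrK.
Qed.

Lemma hop_neighbour al c : hop al c -> hop al (c + 1) = false.
Proof. by case/andP=> _ /eqP h; rewrite /hop h. Qed.

(** Occupation numbers are never negative, so c + 1 occurs at most once more than c. If c occurred
    fewer than m times, every letter would occur at most m + p times, which bounds the length. *)
Lemma valid_count al c m : valid al -> (p * (m + p) < size al)%N ->
  (m <= count_mem c al)%N.
Proof.
have st_ge0 de : valid de -> forall c', state de c' >= 0.
  elim/last_ind: de => [|de a IH] v c'; first by rewrite /state /=; lia.
  case/validE: v => /IH {}IH /andP[/eqP h1 /eqP h0].
  rewrite state_rcons; have := IH c'; case: (eqVneq c' a) => [->|_]; last by lia.
  by rewrite h1; lia.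
move=> v; apply: contraTT; rewrite -!ltnNge => lt_m.
have cnt j : (count_mem (c + j%:R)%R al <= m + j)%N.
  elim: j => [|j IH]; first by rewrite addr0 addn0 ltnW.
  have := st_ge0 _ v (c + j.+1%:R); rewrite /state -[j.+1]addn1 natrD.
  rewrite addrA addrK; have := leq_b1 (base (c + j%:R + 1)); move: IH.
  by set x := count_mem _ _; set y := count_mem _ _; set z := nat_of_bool _; lia.
have -> : size al = (\sum_(d : F) count_mem d al)%N.
  rewrite -sum1_size big_mkcond /=.
  under [RHS]eq_bigr => d _ do rewrite -sum1_count big_mkcond /=.
  rewrite exchange_big /=; apply: eq_bigr => d _.
  by rewrite -big_mkcond sum1_count (@eq_count _ _ (pred1 d)) ?count_uniq_mem
     ?mem_index_enum ?index_enum_uniq // => x /=; rewrite eq_sym.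
rewrite ltnS; apply: (@leq_trans (\sum_(d : F) (m + p))).
  apply: leq_sum => d _; have [j jp e] := Fnat_ex (d - c).
  have -> : d = c + j%:R by rewrite -e addrC subrK.
  rewrite (leq_trans (cnt j)) // leq_add2l; exact: ltnW.
by rewrite sum_nat_const card_ord Fp_cast.
Qed.

(** * Sets of words closed under exchanging distant letters *)

Section Closed.
Variable W : seq F -> Prop.
Hypothesis W_swap : forall ga c d de, d != c -> c != d + 1 -> d != c + 1 ->
  W (ga ++ d :: c :: de) -> W (ga ++ c :: d :: de).

Section Prefix.
Hypothesis W_valid : forall al, W al -> valid al.

(** A letter d standing before c is possible in the same state as c, and two possible hops are never
    at neighbouring positions. So d is distant from c: the hop at c stays possible after d, c is
    brought next to d by induction, and the two are exchanged. *)
Lemma W_front ga de c : W (ga ++ de) -> hop ga c -> c \in de ->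
  exists de', W (ga ++ c :: de') /\ perm_eq de (c :: de').
Proof.
elim: de ga => // d de IH ga Wgd h; rewrite inE.
case: eqVneq => [e _|cd /= cde]; first by exists de; rewrite e in Wgd *.
have hd : hop ga d by have /W_valid := Wgd; rewrite -cat_rcons => /valid_catl/validE[].
have cd1 : c != d + 1.
  by apply/eqP => e; move: (hop_neighbour hd); rewrite -e h.
have dc1 : d != c + 1.
  by apply/eqP => e; move: (hop_neighbour h); rewrite -e hd.
have [||de' []] := IH (rcons ga d) _ _ cde.
- by rewrite cat_rcons.
- by rewrite hop_far.
rewrite cat_rcons => Wde' pde; exists (d :: de'); split.
  by apply: W_swap => //; rewrite eq_sym.
rewrite (perm_trans (_ : perm_eq _ (d :: c :: de'))) ?perm_cons //.
by apply/seq.permP => f /=; lia.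
Qed.

(** The letters of [be] are brought forward one at a time; the hypothesis on multiplicities ensures
    that the next one still occurs in the remainder. *)
Lemma W_prefix al be : W al -> valid be ->
  (forall c, count_mem c be <= count_mem c al)%N -> exists de, W (be ++ de).
Proof.
move=> Wal vbe cnt.
suff H ga de : be = ga ++ de -> exists eta, W (ga ++ eta) /\ perm_eq al (ga ++ eta).
  by have [|eta [Weta _]] := H be [::]; [rewrite cats0 | exists eta].
elim/last_ind: ga de => [|ga c IH] de e; first by exists al.
have [|eta [Weta pe]] := IH (c :: de); first by rewrite -cat_rcons.
have h : hop ga c by move: vbe; rewrite e => /valid_catl/validE[].
have c_eta : c \in eta.
  have := cnt c; rewrite (seq.permP pe) e -cats1 !count_cat /= eqxx.
  by rewrite -has_pred1 has_count -addnA leq_add2l addn0 add1n; apply: leq_trans.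
have [eta' [We' pe']] := W_front Weta h c_eta.
exists eta'; rewrite cat_rcons; split=> //.
by rewrite (perm_trans pe) // perm_cat2l.
Qed.

End Prefix.

Definition run th r t := [seq r + th *+ j | j <- iota 0 t].

Lemma runS th r t : run th r t.+1 = rcons (run th r t) (r + th *+ t).
Proof. by rewrite /run -[t.+1]addn1 iotaD map_cat cats1. Qed.

Lemma run_cons th r t : run th r t.+1 = r :: run th (r + th) t.
Proof.
rewrite /run /= mulr0n addr0 (iotaDl 1 0) -map_comp; congr (_ :: _).
by apply: eq_map => j /=; rewrite mulrS addrA.
Qed.

Lemma run_cat th r l m : run th r (l + m) = run th r l ++ run th (r + th *+ l) m.
Proof.
rewrite /run iotaD map_cat add0n; congr (_ ++ _).
rewrite -[X in iota X]addn0 iotaDl -map_comp.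
by apply: eq_map => j /=; rewrite mulrnDr addrA.
Qed.

(** What the algebra will provide about words of length n + 1 once those of length at most n are
    valid. Runs of slope 1 and -1 carry the trivial and the sign type, a repeated letter contradicts
    diagonalisability, and the pattern c, c + th, c contradicts the braid relation. *)
Variable n : nat.
Hypotheses
  (W_catl : forall al be, W (al ++ be) -> W al)
  (W_valid : forall al, W al -> (size al <= n)%N -> valid al)
  (W_size : forall al, W al -> (size al <= n.+1)%N)
  (W_0 : forall c, W [:: c] -> c = 0)
  (W_rep : forall ga c de, ~ W (ga ++ c :: c :: de))
  (W_braid : forall th ga c de, th \in [:: 1; -1] ->
     ~ W (ga ++ c :: c + th :: c :: de))
  (W_plus : forall ga r, ~ W (ga ++ run 1 r (p - i).+1))
  (W_minus : forall ga r, ~ W (ga ++ run (-1) r i.+1)).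

Lemma unit_mulrn_eq th j l : th \in [:: 1; -1] -> (j < p)%N -> (l < p)%N ->
  (th *+ j == th *+ l) = (j == l).
Proof.
rewrite !inE => /orP[] /eqP-> jp lp; rewrite ?mulNrn ?(inj_eq oppr_inj).
  exact: Fnat_eq.
exact: Fnat_eq.
Qed.

Lemma unit_mulrn_ex th c : th \in [:: 1; -1] -> exists2 j, (j < p)%N & c = th *+ j.
Proof.
have [j jp e] := Fnat_ex (th * c) => th1; exists j => //.
rewrite -mulr_natr -e mulrA; move: th1; rewrite !inE => /orP[] /eqP->.
  by rewrite !mul1r.
by rewrite mulrNN !mul1r.
Qed.

(** Every letter passed is at distance at least 2: on the side of the run because l < m, and around
    the cycle because m + 1 < p. *)
Lemma W_move th ga r m l de : th \in [:: 1; -1] -> (l < m)%N -> (m.+1 < p)%N ->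
  W (ga ++ r + th *+ m :: run th r l ++ de) ->
  W (ga ++ run th r l ++ r + th *+ m :: de).
Proof.
move=> th1; elim: l de => // l IH de lm mp; rewrite runS !cat_rcons => Wd.
rewrite catA; apply: W_swap; last by rewrite -catA; apply: IH Wd; lia.
- by rewrite (inj_eq (addrI _)) unit_mulrn_eq //; lia.
- move: th1; rewrite !inE => /orP[] /eqP th1.
    rewrite -addrA (inj_eq (addrI _)) th1 -mulrSr -[1]/(1%:R).
    by rewrite Fnat_eq; lia.
  rewrite -(inj_eq (addIr (-1))) addrK -addrA (inj_eq (addrI _)) th1.
  by rewrite -mulrSr unit_mulrn_eq ?inE ?eqxx ?orbT //; lia.
- move: th1; rewrite !inE => /orP[] /eqP th1.
    rewrite -addrA (inj_eq (addrI _)) th1 -mulrSr -[1]/(1%:R).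
    by rewrite Fnat_eq; lia.
  rewrite -(inj_eq (addIr (-1))) addrK -addrA (inj_eq (addrI _)) th1.
  by rewrite -mulrSr unit_mulrn_eq ?inE ?eqxx ?orbT //; lia.
Qed.

Lemma size_run th r t : size (run th r t) = t.
Proof. by rewrite size_map size_iota. Qed.

Lemma count_run th r t m : th \in [:: 1; -1] -> (t <= m < p)%N ->
  count_mem (r + th *+ m) (run th r t) = 0%N.
Proof.
move=> th1 /andP[tm mp]; apply/count_memPn/mapP => -[j].
rewrite mem_iota /= add0n => jt /eqP; rewrite (inj_eq (addrI _)).
by rewrite unit_mulrn_eq //; lia.
Qed.

Lemma run_bound th ga r t : th \in [:: 1; -1] -> W (ga ++ run th r t) ->
  (t <= if th == 1%R then p - i else i)%N.
Proof.
have n11 : -1 != 1 :> F.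
  by rewrite eq_sym -subr_eq0 opprK -[1]/(1%:R) -natrD Ftwo_neq0.
have drop_run j : (j <= t)%N -> run th r t = run th r j ++ run th (r + th *+ j) (t - j).
  by move=> jt; rewrite -run_cat subnKC.
rewrite !inE => /orP[] /eqP e Wr; rewrite leqNgt; apply/negP => lt_t.
  move: Wr lt_t; rewrite e eqxx => Wr lt_t; subst th.
  apply: (W_plus (ga := ga) (r := r)).
  apply: (W_catl (be := run 1 (r + 1 *+ (p - i).+1) (t - (p - i).+1))).
  by rewrite -catA -drop_run.
move: Wr lt_t; rewrite e (negbTE n11) => Wr lt_t; subst th.
apply: (W_minus (ga := ga) (r := r)).
apply: (W_catl (be := run (-1) (r + -1 *+ i.+1) (t - i.+1))).
by rewrite -catA -drop_run.
Qed.

(* Move the letter preceding the run to the right: it produces a forbidden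
   triple c, c +- 1, c, or extends the run, or can be moved past enough of the
   run for the induction hypothesis on the length to decide. *)
Lemma hop_run th ta r t : th \in [:: 1; -1] -> (0 < t)%N ->
  size (ta ++ run th r t.+1) = n.+1 ->
  W (ta ++ run th r t.+1) -> hop (ta ++ run th r t) (r + th *+ t).
Proof.
move=> th1 t0 sz Wt.
have szS ta' r' t' : size (ta' ++ run th r' t'.+1) = n.+1 ->
    (size (ta' ++ run th r' t') <= n)%N.
  by rewrite !size_cat !size_run addnS => -[->].
elim/last_ind: ta r t t0 sz Wt => [|ta d IH] r t t0 sz Wt.
all: have t_bnd := run_bound th1 Wt.
all: have [t' et] : exists t', t = t'.+1 by exists t.-1; lia.
all: have Wp := Wt; rewrite runS -[rcons (run _ _ _) _]cats1 catA in Wp.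
all: have {}Wp := W_catl Wp.
all: have vp := W_valid Wp (szS _ _ _ sz).
all: have := vp; rewrite [in X in valid X]et runS -rcons_cat => /validE[_ /hop_last].
all: rewrite rcons_cat -runS -et => -[hl0 hl1].
(* With an empty prefix the run starts at 0. The preceding hop settles one of the two positions
   involved in the last hop; the bound on the run settles the other through the initial
   configuration. *)
- have r0 : r = 0.
    apply: W_0; apply: (W_catl (be := run th (r + th) t)).
    by rewrite cat1s -run_cons.
  rewrite cat0s r0 in hl0 hl1 *.
  move: th1 t_bnd hl0 hl1 {Wt Wp vp}; rewrite !inE => /orP[] /eqP -> t_bnd hl0 hl1.
    rewrite eqxx in t_bnd; apply/andP; split.
      by rewrite et mulrSr addrA -et hl1.
    rewrite /state addrK -[0 + _ + 1]addrA -mulrSr.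
    rewrite !count_run ?inE ?eqxx //; try lia.
    by rewrite add0r base_nat; lia.
  have n11 : -1 != 1 :> F.
    by rewrite eq_sym -subr_eq0 opprK -[1]/(1%:R) -natrD Ftwo_neq0.
  rewrite (negbTE n11) in t_bnd; apply/andP; split; last first.
    by rewrite et mulrSr addrA subrK -et hl0.
  rewrite /state -[0 + _ - 1]addrA -mulrSr.
  rewrite !count_run ?inE ?eqxx ?orbT //; try lia.
  by rewrite add0r mulNrn base_opp; lia.
have t_bnd' : (t.+1 < p.-1)%N.
  by move: t_bnd; case: ifP => _; lia.
(* The position of d relative to the run is measured by m < p: p - 1 extends the run, 0 repeats r, 1
   to t gives a forbidden triple, and larger values let d move right. *)
have [m mp em] := unit_mulrn_ex (d - r) th1.
have {em} em : d = r + th *+ m by rewrite -em addrC subrK.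
rewrite !cat_rcons em in Wt Wp vp hl0 hl1 *.
have [e|m_ne] := eqVneq m p.-1.
  have er : r = d + th.
    by rewrite em e -addrA -mulrSr prednK ?prime_gt0 // -mulr_natr Fnat_p mulr0 addr0.
  have ed u : run th d u.+1 = d :: run th r u by rewrite run_cons -er.
  have -> : r + th *+ t = d + th *+ t.+1 by rewrite er mulrS addrA.
  rewrite -em -ed; apply: IH => //; first by rewrite ed -cat_rcons.
  by rewrite ed em.
have [e|m0] := posnP m.
  case: (W_rep (ga := ta) (c := r) (de := run th (r + th) t)).
  by move: Wt; rewrite e mulr0n addr0 run_cons.
have [m_le|m_gt] := leqP m t.
  have [m' e] : exists m', m = m'.+1 by exists m.-1; lia.
  have drop_run : run th r t.+1 =
      run th r m' ++ r + th *+ m' :: r + th *+ m :: run th (r + th *+ m.+1) (t - m).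
    have -> : t.+1 = (m' + (t - m).+2)%N by lia.
    rewrite run_cat !run_cons; congr (_ ++ _ :: _ :: _).
      by rewrite e mulrSr addrA.
    by rewrite e !mulrSr !addrA.
  have th1' : - th \in [:: 1; -1].
    by move: th1; rewrite !inE => /orP[] /eqP->; rewrite ?opprK eqxx ?orbT.
  case: (W_braid (ga := ta ++ run th r m') (c := r + th *+ m)
           (de := run th (r + th *+ m.+1) (t - m)) th1').
  have -> : r + th *+ m - th = r + th *+ m'.
    by rewrite e mulrSr addrA addrK.
  by rewrite -catA; apply: W_move => //; [lia | lia | rewrite -drop_run].
(* Here d is the neighbour of the last letter on the far side of the run. It can pass the first t
   letters, and the word then ending in d is short enough to be valid. The hop at d and the last hop
   of the shortened run give the two occupation numbers. *)
have [e|m_ne1] := eqVneq m t.+1.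
  have := Wt; rewrite runS -cats1 => /W_move.
  rewrite e => /(_ th1 (ltnSn _)) W1.
  have {}W1 : W (ta ++ run th r t ++ [:: r + th *+ t.+1; r + th *+ t]).
    by apply: W1; lia.
  have W2 : W (rcons (ta ++ run th r t) (r + th *+ t.+1)).
    by apply: (W_catl (be := [:: r + th *+ t])); rewrite cat_rcons -catA.
  have /validE[_ /andP[/eqP h1 /eqP h0]] : valid (rcons (ta ++ run th r t) (r + th *+ t.+1)).
    by apply: W_valid => //; rewrite size_rcons; move: sz;
rewrite !(size_cat, size_rcons, size_run) ?(addSn, addnS) => -[<-].
  have pe : perm_eq (ta ++ r + th *+ t.+1 :: run th r t)
                    (rcons (ta ++ run th r t) (r + th *+ t.+1)).
    by rewrite rcons_cat perm_cat2l perm_sym perm_rcons.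
  rewrite e in hl0 hl1 *.
  move: th1 hl0 hl1 h0 h1 pe; rewrite !inE => /orP[] /eqP-> hl0 hl1 h0 h1 pe.
    apply/andP; split; first by rewrite [in X in state _ X]et [_ *+ t'.+1]mulrSr addrA hl1.
    rewrite (state_perm pe) -addrA -mulrSr state_rcons h1 eqxx.
    by rewrite neq_addr1.
  apply/andP; split; last by rewrite [in X in state _ X]et [_ *+ t'.+1]mulrSr addrA subrK hl0.
  have es : r + -1 *+ t = r + -1 *+ t.+1 + 1 by rewrite mulrSr addrA subrK.
  by rewrite es (state_perm pe) state_rcons h0 eqxx addr1_neq.
(* Now d passes the whole run. Validity of the word without d gives the hop, and d is too far from
   the last letter to affect it. *)
have W1 : W (ta ++ run th r t.+1 ++ [:: r + th *+ m]).
  by apply: W_move => //; [lia | lia | rewrite cats0].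
have /W_valid vt : W (ta ++ run th r t.+1) by apply: W_catl; rewrite -catA; exact: W1.
have {vt} : valid (rcons (ta ++ run th r t) (r + th *+ t)).
  by rewrite rcons_cat -runS; apply: vt; move: sz;
     rewrite !(size_cat, size_rcons, size_run) ?(addSn, addnS) => -[<-].
case/validE => _ hb.
rewrite (@hop_perm _ (rcons (ta ++ run th r t) (r + th *+ m))); last first.
  by rewrite rcons_cat perm_cat2l perm_sym perm_rcons.
rewrite hop_far //.
- by rewrite (inj_eq (addrI _)) unit_mulrn_eq //; lia.
- move: th1; rewrite !inE => /orP[] /eqP ->.
    rewrite -addrA (inj_eq (addrI _)) -mulrSr -[1]/(1%:R).
    by rewrite Fnat_eq; lia.
  rewrite -(inj_eq (addIr (-1))) addrK -addrA (inj_eq (addrI _)).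
  by rewrite -mulrSr unit_mulrn_eq ?inE ?eqxx ?orbT //; lia.
- move: th1; rewrite !inE => /orP[] /eqP ->.
    rewrite -addrA (inj_eq (addrI _)) -mulrSr -[1]/(1%:R).
    by rewrite Fnat_eq; lia.
  rewrite -(inj_eq (addIr (-1))) addrK -addrA (inj_eq (addrI _)).
  by rewrite -mulrSr unit_mulrn_eq ?inE ?eqxx ?orbT //; lia.
Qed.

(** Only the last hop of a word of length n + 1 is in question. If the last two letters are distant,
    their exchange puts the last one at the end of a word of length n; if they are neighbours, they
    form a run of length 2 for [hop_run]. *)
Lemma W_validS al : W al -> valid al.
Proof.
move=> Wal; case/lastP: al Wal => [|al b] Wal; first exact: valid_nil.
have := W_size Wal; rewrite size_rcons ltnS => sz_le.
have Wp : W al by apply: (W_catl (be := [:: b])); rewrite cats1.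
have val := W_valid Wp sz_le; apply/validE; split=> //.
move: sz_le; rewrite leq_eqVlt => /orP[/eqP sz|lt_sz]; last first.
  by have /validE[] : valid (rcons al b) by apply: W_valid; rewrite ?size_rcons.
case/lastP: al => [|al a] in Wal Wp val sz *.
  rewrite (W_0 Wal) /hop /state /= add0r.
  have -> : base 0 = true by rewrite -oppr0 (base_opp (j := 0)); lia.
  by rewrite (base_nat (j := 1)); lia.
have [e|ab] := eqVneq b a.
  by case: (W_rep (ga := al) (c := a) (de := [::])); move: Wal;
     rewrite e -cats1 cat_rcons.
have hr th : th \in [:: 1; -1] -> b = a + th -> hop (rcons al a) b.
  move=> th1 e; have := @hop_run th al a 1%N th1 isT.
  rewrite /run /= mulr0n addr0 mulr1n -e cats1; apply.
    by rewrite size_cat addn2; move: sz; rewrite size_rcons => ->.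
  by move: Wal; rewrite -cats1 cat_rcons.
have [e|b_ne] := eqVneq b (a + 1); first by apply: hr e; rewrite inE eqxx.
have [e|a_ne] := eqVneq a (b + 1).
  by apply: (hr (-1)); rewrite ?inE ?eqxx ?orbT // e addrK.
rewrite hop_far //.
have /W_swap W1 : W (al ++ [:: a; b]) by rewrite -cat_rcons cats1.
have {}W1 : W (rcons al b).
  by apply: (W_catl (be := [:: a])); rewrite cat_rcons; apply: W1 => //; rewrite eq_sym.
have /validE[] // : valid (rcons al b).
by apply: W_valid => //; move: sz; rewrite !size_rcons => ->.
Qed.

End Closed.
End Hops.

(** * Residues and Jucys-Murphy elements *)

Section Intertwiner.
Variables (R : pzRingType) (s x y : R).
Hypotheses (ss : s * s = 1) (sx : s * x = y * s - 1) (xs : x * s = s * y - 1)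
  (xy : x * y = y * x).

(** The standard intertwiner for two consecutive Jucys-Murphy elements: it exchanges their
    eigenvalues, and by [phi_sqr] it is invertible where these do not differ by 1 or -1. *)
Definition phi := s * (x - y) + 1.

Lemma phi_l : x * phi = phi * y.
Proof.
rewrite /phi mulrDr mulr1 mulrDl mul1r mulrA xs mulrBl mul1r -!mulrA.
by rewrite !mulrBl !mulrBr xy opprB addrA subrK.
Qed.

Lemma phi_r : y * phi = phi * x.
Proof.
have ys : y * s = s * x + 1 by rewrite sx subrK.
rewrite /phi mulrDr mulr1 [in RHS]mulrDl mul1r mulrA ys mulrDl mul1r -addrA subrK.
by rewrite -!mulrA !mulrBl !mulrBr xy.
Qed.

Lemma phi_sqr : phi * phi = 1 - (x - y) ^+ 2.
Proof.
have phi_s : phi * s = (y - x) - s.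
  rewrite /phi mulrDl mul1r mulrBr mulrBl -!mulrA xs.
  have -> : y * s = s * x + 1 by rewrite sx subrK.
  rewrite mulrBr mulrDr !mulrA ss !mul1r mulr1.
  by rewrite opprD addrA subrK addrAC.
rewrite {2}/phi mulrDr mulr1 mulrA phi_s mulrBl expr2 /phi addrA subrK.
by rewrite -opprB mulNr addrC.
Qed.

End Intertwiner.

Section Residue.
Variables (k : fieldType) (p : nat).
Hypotheses (p_pr : prime p) (pk : p \in [pchar k]).
Local Notation F := 'F_p.

Lemma natr_mod n : (n %% p)%:R = n%:R :> k.
Proof. by rewrite [in RHS](divn_eq n p) natrD natrM (pcharf0 pk) mulr0 add0r. Qed.

Definition io (c : F) : k := (c : nat)%:R.

Lemma io_nat n : io n%:R = n%:R.
Proof. by rewrite /io /= val_Fp_nat // natr_mod. Qed.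

Lemma ioD c d : io (c + d) = io c + io d.
Proof. by rewrite -{1}(natr_Zp c) -{1}(natr_Zp d) -natrD io_nat natrD. Qed.

Lemma io0 : io 0 = 0. Proof. exact: (io_nat 0). Qed.
Lemma io1 : io 1 = 1. Proof. exact: (io_nat 1). Qed.

Lemma ioN c : io (- c) = - io c.
Proof. by apply/eqP; rewrite -addr_eq0 -ioD addNr io0. Qed.

Lemma ioB c d : io (c - d) = io c - io d.
Proof. by rewrite ioD ioN. Qed.

Lemma io_eq0 c : (io c == 0) = (c == 0).
Proof.
apply/eqP/eqP => [|->]; last exact: io0.
rewrite /io => /eqP; rewrite -(dvdn_pcharf pk) => pc; apply: val_inj => /=.
apply/eqP; apply: contraLR pc; rewrite -lt0n => c0.
by rewrite gtnNdvd // -[ltnRHS](Fp_cast p_pr).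
Qed.

Lemma io_inj : injective io.
Proof. by move=> c d /eqP; rewrite -subr_eq0 -ioB io_eq0 subr_eq0 => /eqP. Qed.

Lemma ioX c : io c ^+ p = io c.
Proof.
rewrite /io -natrX -natr_mod -[RHS]natr_mod.
by rewrite fermat_little.
Qed.

Lemma io_sqr_neq (c d : F) : c != d + 1 -> d != c + 1 -> 1 - (io c - io d) ^+ 2 != 0.
Proof.
move=> cd dc; rewrite subr_eq0 eq_sym sqrf_eq1 negb_or -io1 -ioB -ioN.
rewrite !(inj_eq io_inj) subr_eq addrC cd /=.
by apply: contraNneq dc => e; rewrite -[d](subrK c) -opprB e opprK addrC.
Qed.

(** By Fermat this is the Lagrange interpolation polynomial of the point c among the p points of
    F_p. *)
Definition lagr c : {poly k} := 1 - ('X - (io c)%:P) ^+ p.-1.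

Lemma lagr_eval c d : (lagr c).[io d] = (c == d)%:R.
Proof.
rewrite /lagr !hornerE /=; case: eqVneq => [->|cd].
  by rewrite subrr expr0n; have := prime_gt1 p_pr; case: (p) => [|[|m]] //= _; rewrite subr0.
have nz : io d - io c != 0 by rewrite -ioB io_eq0 subr_eq0 eq_sym.
apply/eqP; rewrite subr_eq0 eq_sym; apply/eqP/(mulfI nz).
by rewrite mulr1 -exprS prednK ?prime_gt0 // -ioB ioX.
Qed.

(** The difference of the two sides has degree less than p and vanishes at all p points of F_p. *)
Lemma sum_lagr : \sum_c lagr c = 1.
Proof.
apply/eqP; rewrite -subr_eq0; apply/negPn/negP => nz.
have szp : (size (\sum_c lagr c - 1)%R <= p)%N.
  rewrite (leq_trans (size_polyD _ _)) // geq_max size_polyN size_poly1 prime_gt0 // andbT.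
  apply: (leq_trans (size_sum _ _ _)); apply/bigmax_leqP => c _.
  rewrite (leq_trans (size_polyD _ _)) // geq_max size_polyN size_poly1 prime_gt0 //=.
  by rewrite (leq_trans (size_poly_exp_leq _ _)) // size_XsubC mul1n prednK ?prime_gt0.
have roots : all (root (\sum_c lagr c - 1)) [seq io c | c <- enum F]; last first.
  have := max_poly_roots nz roots; rewrite map_inj_uniq ?enum_uniq; last exact: io_inj.
  by move=> /(_ isT); rewrite size_map -cardE card_Fp // ltnNge szp.
apply/allP => _ /mapP[d _ ->]; apply/rootP.
rewrite hornerD hornerN hornerC horner_sum (bigD1 d) //= lagr_eval eqxx big1 ?addr0 ?subrr //.
by move=> c cd; rewrite lagr_eval (negbTE cd).
Qed.

Lemma polyXp : p \in [pchar {poly k}].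
Proof. by rewrite pchar_lalg. Qed.

Lemma XsubC_pX c : ('X - (io c)%:P) ^+ p = 'X^p - (io c)%:P.
Proof.
rewrite exprDn_pchar; last by rewrite (eq_pnat _ (pcharf_eq polyXp)) pnat_id.
by congr (_ + _); rewrite -polyCN -polyC_exp -ioN ioX.
Qed.

(** Evaluated at an x with x^p = x, this puts the value of [lagr c] into the eigenspace of c. *)
Lemma XsubC_lagr c : ('X - (io c)%:P) * lagr c = 'X - 'X^p.
Proof.
rewrite /lagr mulrBr mulr1 -exprS prednK ?prime_gt0 // XsubC_pX opprB addrA.
by rewrite subrK.
Qed.

End Residue.

Lemma horner_alg_eigen (k : comNzRingType) (A : algType k) (x u : A) a (f : {poly k}) :
  x * u = a *: u -> horner_alg x f * u = f.[a] *: u.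
Proof.
move=> e; elim/poly_ind: f => [|f c IH]; first by rewrite rmorph0 mul0r horner0 scale0r.
rewrite rmorphD rmorphM /= horner_algX horner_algC mulrDl -mulrA e.
by rewrite -scalerAr IH scalerA hornerMXaddC mulr_algl -scalerDl [a * _]mulrC.
Qed.

Lemma horner_alg_comm (k : comNzRingType) (A : algType k) (x z : A) (f : {poly k}) :
  x * z = z * x -> horner_alg x f * z = z * horner_alg x f.
Proof.
move=> e; elim/poly_ind: f => [|f c IH]; first by rewrite rmorph0 mul0r mulr0.
rewrite rmorphD rmorphM /= horner_algX horner_algC mulrDl mulrDr -mulrA e.
by rewrite mulrA IH -mulrA mulr_algl mulr_algr.
Qed.

Section JucysMurphy.
Variables (k : fieldType) (Q : algType k) (s : nat -> Q).
Hypotheses (ss : forall j, s j * s j = 1)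
  (s_braid : forall j, s j * s j.+1 * s j = s j.+1 * s j * s j.+1)
  (s_comm : forall j l, (j.+1 < l)%N -> s j * s l = s l * s j).

(** Numbered from 0, so [jm 0] is the first Jucys-Murphy element. The recursion replaces the sum of
    transpositions because it involves only the Coxeter generators. *)
Fixpoint jm j : Q := if j is j'.+1 then s j' * jm j' * s j' + s j' else 0.

Lemma s_jm j : s j * jm j = jm j.+1 * s j - 1.
Proof. by rewrite /= mulrDl -mulrA ss mulr1 addrK. Qed.

Lemma jm_s j : jm j * s j = s j * jm j.+1 - 1.
Proof. by rewrite /= mulrDr !mulrA ss mul1r addrK. Qed.

Lemma s_jm_gt l j : (j < l)%N -> s l * jm j = jm j * s l.
Proof.
elim: j => [|j IH] jl; first by rewrite mulr0 mul0r.
rewrite /= mulrDr mulrDl !mulrA -(s_comm jl); congr (_ + _).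
rewrite -!mulrA (s_comm jl); congr (_ * _).
by rewrite !mulrA IH // ltnW.
Qed.

(** The recursion reduces this to j = l + 2. With a, b the generators l and l + 1 and X = [jm l],
    the element is b a X a b + b a b + b; conjugation by a fixes the first term and exchanges the
    other two. *)
Lemma s_jm_lt l j : (l.+1 < j)%N -> s l * jm j = jm j * s l.
Proof.
elim: j => // j IH; rewrite ltnS leq_eqVlt => /orP[/eqP<-{j IH}|lj]; last first.
  rewrite /= mulrDr mulrDl !mulrA (s_comm lj); congr (_ + _).
  rewrite -!mulrA -(s_comm lj); congr (_ * _).
  by rewrite !mulrA IH.
rewrite /=; have aba := s_braid l; have bX := s_jm_gt (ltnSn l).
set a := s l in aba *; set b := s l.+1 in aba bX *; set X := jm l in bX *.
have aa : a * a = 1 by exact: ss.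
have bb : b * b = 1 by exact: ss.
have e1 : a * b * (a * X * a) * b = b * (a * X * a) * b * a.
  have bab : b * (a * b) = a * (b * a) by rewrite !mulrA aba.
  by rewrite !mulrA aba -(mulrA (b * a)) bX -!mulrA bab !mulrA.
have e2 : a * b * a * b = b * a by rewrite aba -mulrA bb mulr1.
have e3 : b * a * b * a = a * b by rewrite -aba -mulrA aa mulr1.
by rewrite !(mulrDr, mulrDl) !mulrA e2 e3 in e1 *; rewrite e1 addrAC.
Qed.

Lemma jm_comm j l : jm j * jm l = jm l * jm j.
Proof.
wlog jl : j l / (j < l)%N.
  by move=> H; case: (ltngtP j l) => [/H|/H|->].
elim: j jl => [|j IH] jl; first by rewrite mulr0 mul0r.
have IH' := IH (ltnW jl); rewrite /= mulrDr mulrDl !mulrA -(s_jm_lt jl).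
congr (_ + _); rewrite -!mulrA (s_jm_lt jl); congr (_ * _).
by rewrite !mulrA IH'.
Qed.

End JucysMurphy.

(** * Weights *)

Section Weights.
Variables (k : fieldType) (p i : nat).
Hypotheses (p_pr : prime p) (pk : p \in [pchar k]) (i_bnd : (1 < i < p - 1)%N).
Variables (Q : algType k) (s : nat -> Q).
Hypotheses (ss : forall j, s j * s j = 1)
  (s_braid : forall j, s j * s j.+1 * s j = s j.+1 * s j * s j.+1)
  (s_comm : forall j l, (j.+1 < l)%N -> s j * s l = s l * s j).
Local Notation F := 'F_p.
Local Notation io := (@io k p).
Local Notation jm := (jm s).
Local Notation valid := (valid i).
Local Notation hop := (hop i).
Implicit Types (al be ga de ep : seq F) (a b c d th : F) (u w q z : Q).

Let ioD := ioD p_pr pk.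
Let ioN := ioN p_pr pk.
Let ioB := ioB p_pr pk.
Let io1 := io1 p_pr pk.
Let s_jm := s_jm ss.
Let jm_s := jm_s ss.
Let s_jm_gt := s_jm_gt s_comm.
Let s_jm_lt := s_jm_lt ss s_braid s_comm.
Let jm_comm := jm_comm ss s_braid s_comm.

Lemma two_neq0 : 2%:R != 0 :> k.
Proof.
by rewrite -(dvdn_pcharf pk); apply/negP => /dvdn_leq; lia.
Qed.

Lemma double0 u : u *+ 2 = 0 -> u = 0.
Proof.
move=> /eqP; rewrite -scaler_nat scaler_eq0 (negbTE two_neq0) /=; exact: eqP.
Qed.

(** Q is its own left module here, so that the spectral idempotents are themselves weight
    vectors. *)
Definition wt al u := forall j, (j < size al)%N -> jm j * u = io (nth 0 al j) *: u.

Lemma wt_catl al be u : wt (al ++ be) u -> wt al u.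
Proof.
move=> h j jl; have := h j; rewrite size_cat nth_cat jl; apply.
exact: ltn_addr.
Qed.

Lemma wt_rcons al c u : wt (rcons al c) u <-> wt al u /\ jm (size al) * u = io c *: u.
Proof.
split=> [h|[h e] j].
  split; first by apply: (wt_catl (be := [:: c])); rewrite cats1.
  by have := h (size al); rewrite size_rcons ltnSn nth_rcons ltnn eqxx; apply.
by rewrite size_rcons ltnS nth_rcons leq_eqVlt; case: eqP => [->|_ /= jl];
  rewrite ?ltnn // jl; apply: h.
Qed.

Lemma wt_cat_cons ga c de u : wt (ga ++ c :: de) u -> jm (size ga) * u = io c *: u.
Proof. by rewrite -cat_rcons => /wt_catl/wt_rcons[]. Qed.

Lemma wt_mul al u w : (forall j, (j < size al)%N -> jm j * w = w * jm j) ->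
  wt al u -> wt al (w * u).
Proof. by move=> c h j jl; rewrite mulrA c // -mulrA h // scalerAr. Qed.

(** The new vector is [phi] applied to u, with x and y replaced by their eigenvalues d and c. *)
Lemma wt_swap ga c d de u : wt (ga ++ d :: c :: de) u ->
  wt (ga ++ c :: d :: de) ((io d - io c) *: (s (size ga) * u) + u).
Proof.
set j := size ga => h.
have hd : jm j * u = io d *: u by exact: wt_cat_cons h.
have hc : jm j.+1 * u = io c *: u.
  by rewrite -[j.+1](size_rcons ga d); apply: wt_cat_cons; rewrite cat_rcons; exact: h.
move=> l l_lt; have [->|lj] := eqVneq l j.
  rewrite nth_cat ltnn subnn /= mulrDr -scalerAr mulrA jm_s.
  rewrite mulrBl mul1r -mulrA hc hd -scalerAr scalerBr scalerDr !scalerA.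
  by rewrite [io c * _]mulrC -addrA [in X in _ + X]scalerBl opprB subrK.
have [->|lj1] := eqVneq l j.+1.
  rewrite nth_cat -addn1 ltnNge leq_addr addKn /= addn1 mulrDr -scalerAr mulrA.
  have -> : jm j.+1 * s j = s j * jm j + 1 by rewrite s_jm subrK.
  rewrite mulrDl mul1r -mulrA hc hd -scalerAr !scalerDr !scalerA.
  by rewrite [io d * _]mulrC -addrA [in X in _ + X]scalerBl subrK.
have el : nth 0 (ga ++ c :: d :: de) l = nth 0 (ga ++ d :: c :: de) l.
  rewrite !nth_cat -/j; case: ltnP => // jl; have : (l - j > 1)%N by lia.
  by case: (l - j)%N => [|[|m]].
rewrite el mulrDr -scalerAr mulrA.
have -> : jm l * s j = s j * jm l.
  by case: (ltnP l j) => jl; [rewrite s_jm_gt | rewrite s_jm_lt //; lia].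
have ll : (l < size (ga ++ d :: c :: de))%N by move: l_lt; rewrite !size_cat.
by rewrite -mulrA h // -scalerAr scalerDr !scalerA mulrC.
Qed.

Lemma swap_back x u j : x *: (s j * (x *: (s j * u) + u)) =
  x ^+ 2 *: u + x *: (s j * u).
Proof. by rewrite mulrDr -scalerAr mulrA ss mul1r scalerDr scalerA -expr2. Qed.

Lemma wt_swap_inv (x : k) u j : let w := x *: (s j * u) + u in
  w - x *: (s j * w) = (1 - x ^+ 2) *: u.
Proof.
rewrite /= swap_back scalerBl scale1r [x *: _ + u]addrC [_ *: u + _]addrC.
exact: addrKA.
Qed.

(* The equation x^p = x says that x is diagonalisable with spectrum in F_p. *)
Definition split_upto n := forall j, (j < n)%N -> jm j ^+ p = jm j.
Definition valid_upto n :=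
  forall al u, (size al <= n)%N -> wt al u -> u != 0 -> valid al.

(** * Spectral idempotents of the Jucys-Murphy elements *)

Section Eigen.
Variable n : nat.
Hypothesis split_n : split_upto n.

Definition pr c j := horner_alg (jm j) (lagr k c).

Lemma pr_commL c j z : jm j * z = z * jm j -> pr c j * z = z * pr c j.
Proof. exact: horner_alg_comm. Qed.

Lemma pr_jm c j l : pr c j * jm l = jm l * pr c j.
Proof. by apply: pr_commL; apply: jm_comm. Qed.

Lemma jm_pr c j : (j < n)%N -> jm j * pr c j = io c *: pr c j.
Proof.
move=> jn; apply/eqP; rewrite -subr_eq0 -mulr_algl -mulrBl; apply/eqP.
have := congr1 (horner_alg (jm j)) (XsubC_lagr p_pr pk c).
rewrite rmorphM [X in X * _]rmorphB [in RHS]rmorphB rmorphXn /= horner_algX horner_algC => ->.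
by rewrite split_n // subrr.
Qed.

Lemma sum_pr j : \sum_c pr c j = 1.
Proof. by rewrite -rmorph_sum sum_lagr ?rmorph1. Qed.

Lemma pr_eigen c d j u : jm j * u = io d *: u -> pr c j * u = (c == d)%:R *: u.
Proof. by move=> /horner_alg_eigen->; rewrite lagr_eval. Qed.

(** The recursion removes the last letter of the word, whose position is the number of letters
    before it; hence the reversal. *)
Fixpoint ide_rev al : Q := if al is c :: al' then ide_rev al' * pr c (size al') else 1.
Definition ide al := ide_rev (rev al).

Lemma ide_nil : ide [::] = 1. Proof. by []. Qed.

Lemma ide_rcons al c : ide (rcons al c) = ide al * pr c (size al).
Proof. by rewrite /ide rev_rcons /= size_rev. Qed.

Lemma ide_commL al z : (forall j, (j < size al)%N -> jm j * z = z * jm j) ->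
  ide al * z = z * ide al.
Proof.
elim/last_ind: al => [|al c IH] h; first by rewrite mul1r mulr1.
rewrite ide_rcons -mulrA pr_commL ?mulrA ?IH // => [j jl|]; apply: h.
  by rewrite size_rcons ltnW.
by rewrite size_rcons.
Qed.

Lemma ide_jm al j : ide al * jm j = jm j * ide al.
Proof. by apply: ide_commL => l _; apply: jm_comm. Qed.

Lemma wt_ide al : (size al <= n)%N -> wt al (ide al).
Proof.
elim/last_ind: al => [|al c IH] //; rewrite size_rcons => sz.
rewrite ide_rcons; apply/wt_rcons; split.
  move=> j jl; rewrite -pr_commL; last by rewrite -ide_jm.
  by apply: wt_mul jl => [l _|]; [rewrite pr_jm | apply: IH; exact: ltnW].
by rewrite mulrA -ide_jm -mulrA jm_pr // scalerAr.
Qed.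

Lemma ide_wt al u : wt al u -> ide al * u = u.
Proof.
elim/last_ind: al => [|al c IH]; first by rewrite mul1r.
case/wt_rcons => h e; rewrite ide_rcons -mulrA (pr_eigen _ e) eqxx scale1r.
exact: IH.
Qed.

Lemma ide_wt_neq al be u : size al = size be -> al != be -> wt be u -> ide al * u = 0.
Proof.
elim/last_ind: al be => [|al c IH] be; first by case: be.
case/lastP: be => [|be d]; rewrite ?size_rcons // => -[sz].
rewrite eqseq_rcons => ne /wt_rcons[h e]; rewrite ide_rcons -mulrA sz (pr_eigen _ e).
have [cd|_] := eqVneq c d; last by rewrite scale0r mulr0.
by rewrite scale1r (IH be) //; move: ne; rewrite cd eqxx andbT.
Qed.

(** The idempotents of the words of length m add up to 1, so an additive property of z may be
    checked weight by weight. *)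
Lemma ide_span m (K : Q -> Prop) z : K 0 -> (forall u w, K u -> K w -> K (u + w)) ->
  (forall al, size al = m -> K (ide al * z)) -> K z.
Proof.
move=> K0 KD; elim: m => [|m IH] h; first by rewrite -[z]mul1r; apply: (h [::]).
apply: IH => al sz; rewrite -[ide al]mulr1 -(sum_pr m) mulr_sumr mulr_suml.
apply: (big_ind K) => // c _; rewrite -sz -ide_rcons.
by apply: h; rewrite size_rcons sz.
Qed.

End Eigen.

(** * The induction step for diagonalisability and validity *)

Section Step.
Variable n : nat.
Hypotheses (split_n : split_upto n) (valid_n : valid_upto n).

(** Both words would be valid, with last hops at neighbouring positions of the same state, and
    exclusion forbids this. *)
Lemma wt_conflict ep a b th u w : (size ep < n)%N -> th \in [:: 1; -1] ->
  b = a + th -> wt (rcons ep a) u -> u != 0 -> wt (rcons ep b) w -> w = 0.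
Proof.
move=> sz th1 e hu u0 hw; apply/eqP; apply: contraPT isT => w0 _.
have szr c : (size (rcons ep c) <= n)%N by rewrite size_rcons.
have /validE[_ ha] := valid_n (szr a) hu u0.
have /validE[_ hb] := valid_n (szr b) hw w0.
move: th1; rewrite !inE => /orP[] /eqP eth.
  by have := hop_neighbour ha; rewrite -eth -e hb.
by have := hop_neighbour hb; rewrite e eth subrK ha.
Qed.

(** The exchanged vector has a weight beginning with ga, c + th, which conflicts with ga, c. So it
    vanishes, and this equation determines s on u. *)
Lemma s_sign ga c th de u : th \in [:: 1; -1] -> (size ga < n)%N ->
  wt (ga ++ c :: c + th :: de) u -> s (size ga) * u = io th *: u.
Proof.
move=> th1 sz h; have [->|u0] := eqVneq u 0; first by rewrite mulr0 scaler0.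
have hw := wt_swap h.
have w0 : (io c - io (c + th)) *: (s (size ga) * u) + u = 0.
  apply: (wt_conflict (ep := ga) (a := c) sz th1 erefl _ u0).
    by rewrite -cats1; apply: (wt_catl (be := c + th :: de)); rewrite -catA.
  by rewrite -cats1; apply: (wt_catl (be := c :: de)); rewrite -catA.
move: w0; rewrite ioD opprD addrA subrr add0r scaleNr addrC => /eqP.
rewrite subr_eq0 => /eqP e; rewrite [in RHS]e scalerA.
suff -> : io th * io th = 1 by rewrite scale1r.
by move: th1; rewrite !inE => /orP[] /eqP->; rewrite ?ioN io1 ?mulrNN mulr1.
Qed.

(** The two generators act on u by th and -th, so the braid relation would give 2 th^3 = 0. *)
Lemma wt_braid ga c th de u : th \in [:: 1; -1] -> ((size ga).+1 < n)%N ->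
  wt (ga ++ c :: c + th :: c :: de) u -> u = 0.
Proof.
move=> th1 sz h.
have e1 : s (size ga) * u = io th *: u by apply: s_sign h => //; exact: ltnW.
have e2 : s (size ga).+1 * u = - io th *: u.
  rewrite -ioN -(size_rcons ga c); apply: (@s_sign _ (c + th) _ de).
  - by move: th1; rewrite !inE => /orP[] /eqP->; rewrite ?opprK eqxx ?orbT.
  - by rewrite size_rcons.
  - by rewrite cat_rcons addrK.
have := congr1 (fun z => z * u) (s_braid (size ga)).
rewrite /= -!mulrA e1 e2 -!scalerAr e1 e2 -!scalerAr e1 e2 !scalerA.
move=> /eqP; rewrite -subr_eq0 -scalerBl scaler_eq0 => /orP[|/eqP //].
have E t : t * - t * t - - t * t * - t = - (2%:R * t * t * t) :> k by ring.
by move: th1; rewrite E !inE => /orP[] /eqP->;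
  rewrite ?ioN io1 !oppr_eq0 !mulf_eq0 ?oppr_eq0 (negbTE two_neq0) oner_eq0.
Qed.

(* The intertwiner kills the block, since the word rcons ep b does not occur, so
   s acts on it by th + nilpotent, and s^2 = 1 excludes this for p > 2. *)
Lemma jm_no_block ep a b th q : (size ep).+1 = n -> th \in [:: 1; -1] -> b = a + th ->
  wt (rcons ep a) q -> let w := jm n * q - io b *: q in
  jm n * w = io b *: w -> w = 0.
Proof.
move=> sz th1 e hq w hw.
have [q0|q0] := eqVneq q 0; first by rewrite /w q0 mulr0 scaler0 subr0.
set x := jm (size ep); set y := jm n; set t := s (size ep).
have xy : x * y = y * x by exact: jm_comm.
have yE : y = jm (size ep).+1 by rewrite sz.
have tx : t * x = y * t - 1 by rewrite yE; exact: s_jm.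
have xt : x * t = t * y - 1 by rewrite yE; exact: jm_s.
set f := phi t x y.
have xf : x * f = f * y by apply: phi_l.
have fE v : f * v = t * (x * v - y * v) + v.
  by rewrite /f /phi mulrDl mul1r -mulrA mulrBl.
have f_comm j : (j < size ep)%N -> jm j * f = f * jm j.
  move=> jl; rewrite /f /phi mulrDr mulrDl mulr1 mul1r mulrA -s_jm_gt //.
  by rewrite -!mulrA mulrBr mulrBl jm_comm [jm j * y]jm_comm.
have [hq' xq] : wt ep q /\ x * q = io a *: q by apply/wt_rcons.
have yq : y * q = io b *: q + w by rewrite /w addrC subrK.
have xw : x * w = io a *: w.
  by rewrite /w mulrBr mulrA xy -mulrA xq -!scalerAr xq scalerBr !scalerA mulrC.
have hw' : wt ep w.
  move=> j jl; rewrite /w mulrBr mulrA jm_comm -mulrA (hq' _ jl) -!scalerAr (hq' _ jl).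
  by rewrite scalerBr !scalerA mulrC.
clearbody w; have fw0 : f * w = 0.
  apply: (wt_conflict (ep := ep) (a := a) (b := b) _ th1 e hq q0); first by rewrite -sz.
  apply/wt_rcons; split; first by apply: wt_mul.
  by rewrite mulrA xf -mulrA hw scalerAr.
have fq0 : f * q = 0.
  apply: (wt_conflict (ep := ep) (a := a) (b := b) _ th1 e hq q0); first by rewrite -sz.
  apply/wt_rcons; split; first by apply: wt_mul.
  by rewrite mulrA xf -mulrA yq mulrDr fw0 addr0 scalerAr.
have thth : io th * io th = 1.
  by move: th1; rewrite !inE => /orP[] /eqP->; rewrite ?ioN io1 ?mulrNN mulr1.
have tw : t * w = io th *: w.
  move: fw0; rewrite fE xw hw e ioD -scalerBl opprD addrA subrr add0r.
  rewrite scaleNr mulrN -scalerAr addrC => /eqP; rewrite subr_eq0 => /eqP ew.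
  by rewrite [in RHS]ew scalerA thth scale1r.
have tq : t * q = io th *: q - w.
  move: fq0; rewrite fE xq yq e ioD opprD addrA -scalerBl opprD addrA subrr add0r.
  rewrite mulrBr scaleNr mulrN -scalerAr tw => /eqP.
  rewrite addrC addrA subr_eq0 => /eqP eq1.
  have : io th *: (q - io th *: (t * q)) = io th *: (io th *: w) by rewrite eq1.
  rewrite scalerBr !scalerA thth !scale1r => /eqP.
  by rewrite subr_eq addrC -subr_eq => /eqP.
have : t * (t * q) = q by rewrite mulrA ss mul1r.
rewrite tq mulrBr -scalerAr tq tw scalerBr scalerA thth scale1r -addrA -opprD.
by move/eqP; rewrite addrC -subr_eq0 addrK oppr_eq0 -mulr2n => /eqP/double0;
   move/eqP; rewrite scaler_eq0 => /orP[|/eqP //];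
   move: thth => /eqP; move=> + /eqP t0; rewrite t0 mul0r eq_sym oner_eq0.
Qed.

(** Let x, y be the last two Jucys-Murphy elements, G = X^p - X and u of weight ep, a. The
    intertwiner f takes G(y) u to G(x) f u = 0, so its square 1 - (x - y)^2 kills G(y) u. Only the
    eigenvalues a + 1 and a - 1 of y survive, and [jm_no_block] excludes a block at each. *)
Lemma split_step : jm n ^+ p = jm n.
Proof.
case: (posnP n) => [->|n0]; first by rewrite /= expr0n; case: (p) p_pr.
suff : (jm n ^+ p - jm n) * 1 = 0 by rewrite mulr1 => /eqP; rewrite subr_eq0 => /eqP.
apply: (ide_span (m := n) (K := fun z => (jm n ^+ p - jm n) * z = 0)).
- by rewrite mulr0.
- by move=> u w hu hw; rewrite mulrDr hu hw addr0.
move=> al sz; rewrite mulr1; have := wt_ide split_n (eq_leq sz).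
move: (ide al) => u hu.
case/lastP: al sz hu => [|ep a]; first by move=> e; rewrite -e in n0.
rewrite size_rcons => sz hu.
set x := jm (size ep); set y := jm n; set t := s (size ep).
have xy : x * y = y * x by exact: jm_comm.
have yE : y = jm (size ep).+1 by rewrite sz.
have tx : t * x = y * t - 1 by rewrite yE; exact: s_jm.
have xt : x * t = t * y - 1 by rewrite yE; exact: jm_s.
set f := phi t x y.
have xf : x * f = f * y by apply: phi_l.
have xu : x * u = io a *: u by case/wt_rcons: hu.
pose T (g : {poly k}) := horner_alg y g * u.
have TM g h : T (g * h) = horner_alg y g * T h by rewrite /T rmorphM /= mulrA.
have TX g : T ('X * g) = y * T g by rewrite TM horner_algX.
have TXC (c : k) g : T (('X - c%:P) * g) = y * T g - c *: T g.
  by rewrite TM rmorphB /= horner_algX horner_algC mulrBl mulr_algl.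
have hT g : wt (rcons ep a) (T g).
  by apply: wt_mul hu => j _; rewrite horner_alg_comm // jm_comm.
have xT g : x * T g = io a *: T g by case/wt_rcons: (hT g).
pose G : {poly k} := 'X^p - 'X.
have TG : T G = (y ^+ p - y) * u by rewrite /T /G rmorphB rmorphXn /= horner_algX.
rewrite -TG.
have fG : f * T G = 0.
  have fX m : f * y ^+ m = x ^+ m * f.
    by elim: m => [|m IH]; rewrite ?mulr1 ?mul1r // exprS mulrA -xf -mulrA IH mulrA -exprS.
  have -> : f * T G = (x ^+ p - x) * (f * u).
    by rewrite TG mulrA mulrBr fX -xf -mulrBl -mulrA.
  by rewrite split_n ?subrr ?mul0r // -sz.
have sq : (1 - (x - y) ^+ 2) * T G = 0.
  by rewrite -(phi_sqr (ss _) tx xt) -mulrA fG mulr0.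
(* The factor X - (a - th) removes one of the two eigenvalues. What remains is w = (y - b) q with b
   = a + th, and (y - b) w = ((y - a)^2 - 1) G(y) u = 0, as [jm_no_block] requires. *)
have key th : th \in [:: 1; -1] -> T (('X - (io (a - th))%:P) * G) = 0.
  move=> th1; pose b := a + th.
  pose H : {poly k} := ('X - (io b)%:P) ^+ p.-1 - 1.
  have GE : G = ('X - (io b)%:P) * H.
    rewrite /H mulrBr mulr1 -exprS prednK ?prime_gt0 // XsubC_pX //.
    by rewrite opprB addrA subrK.
  pose q := T (('X - (io (a - th))%:P) * H).
  have wE : T (('X - (io (a - th))%:P) * G) = y * q - io b *: q.
    by rewrite GE mulrCA TXC.
  rewrite wE; apply: (jm_no_block sz th1 (erefl b)) => //; first exact: hT.
  rewrite -/y -wE; apply/eqP; rewrite -subr_eq0 -TXC; apply/eqP.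
  have -> : ('X - (io b)%:P) * (('X - (io (a - th))%:P) * G) =
      (('X - (io a)%:P) ^+ 2 - 1) * G.
    rewrite mulrA; congr (_ * _); rewrite /b ioD ioB polyCD polyCB.
    have : (io th)%:P ^+ 2 = 1 :> {poly k}.
      rewrite -polyC_exp expr2; suff -> : io th * io th = 1 by [].
      by move: th1; rewrite !inE => /orP[] /eqP->; rewrite ?ioN io1 ?mulrNN mulr1.
    by move=> <-; ring.
  have E g : (x - y) * T g = - T (('X - (io a)%:P) * g) by rewrite mulrBl xT TXC opprB.
  have TB g h : T (g - h) = T g - T h by rewrite /T rmorphB mulrBl.
  move: sq; rewrite mulrBl mul1r expr2 -mulrA E mulrN E opprK => eq0.
  by rewrite mulrBl mul1r expr2 -mulrA TB -opprB eq0 oppr0.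
(* The difference of the two instances is 2 G(y) u. *)
have := key 1; have := key (-1); rewrite !inE !eqxx orbT opprK !TXC.
move=> /(_ isT)/eqP; rewrite subr_eq0 => /eqP e1 /(_ isT)/eqP.
rewrite subr_eq0 e1 -subr_eq0 -scalerBl.
have -> : io (a + 1) - io (a - 1) = 2%:R by rewrite ioD ioB io1; ring.
by rewrite scaler_eq0 (negbTE two_neq0) => /eqP.
Qed.

Lemma run_sign ga th r t u : th \in [:: 1; -1] -> (size (ga ++ run th r t.+1) <= n.+1)%N ->
  wt (ga ++ run th r t.+1) u ->
  forall j, (size ga <= j < size ga + t)%N -> s j * u = io th *: u.
Proof.
move=> th1 sz h j /andP[/subnKC <-]; set l := (j - size ga)%N; rewrite ltn_add2l => lt.
have e : run th r t.+1 = run th r l ++ [:: r + th *+ l, r + th *+ l + th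
    & run th (r + th *+ l + th + th) (t - l.+1)].
  have {1}-> : t.+1 = (l + (t - l.+1).+2)%N by lia.
  by rewrite run_cat !run_cons.
rewrite -{1}(size_run th r l) -size_cat.
apply: (@s_sign _ (r + th *+ l) _ (run th (r + th *+ l + th + th) (t - l.+1)) _ th1);
  last first.
  by rewrite -catA -e.
by move: sz; rewrite !size_cat !size_run; lia.
Qed.

Hypotheses
  (sym_vanish : forall l u,
     (forall j, (l <= j < l + (p - i))%N -> s j * u = u) -> u = 0)
  (alt_vanish : forall l u,
     (forall j, (l <= j < l + i)%N -> s j * u = - u) -> u = 0).

Lemma valid_step : valid_upto n.+1.
Proof.
have split_n1 : split_upto n.+1.
  by move=> j; rewrite ltnS leq_eqVlt => /orP[/eqP->|/split_n //]; exact: split_step.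
pose W al := (size al <= n.+1)%N /\ exists2 u, wt al u & u != 0.
have WE al u : (size al <= n.+1)%N -> wt al u -> ~ W al -> u = 0.
  by move=> sz h nW; apply/eqP; apply: contra_notT nW => u0; split=> //; exists u.
move=> al u sz hu u0.
apply: (@W_validS _ _ p_pr i_bnd W _ n); last by split=> //; exists u.
- move=> ga c d de dc cd1 dc1 [sz' [v hv v0]]; split; first by rewrite !size_cat in sz' *.
  exists ((io d - io c) *: (s (size ga) * v) + v); first exact: wt_swap.
  apply: contra_neq v0 => w0; have := wt_swap_inv (io d - io c) v (size ga).
  rewrite /= w0 mulr0 scaler0 subr0 => /esym/eqP.
  by rewrite scaler_eq0 (negbTE (io_sqr_neq p_pr pk dc1 cd1)) => /eqP.
- move=> be ga [sz' [v hv v0]]; split.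
    by apply: leq_trans sz'; rewrite size_cat leq_addr.
  by exists v => //; apply: wt_catl hv.
- by move=> be [_ [v hv v0]] sz'; apply: valid_n sz' hv v0.
- by move=> be [].
- move=> c [_ [v hv v0]]; have := hv 0%N isT; rewrite /= mul0r => /esym/eqP.
  by rewrite scaler_eq0 (negbTE v0) orbF io_eq0 // => /eqP.
(* A repeated residue makes s v a generalised eigenvector of x = [jm j]: x s v = c s v - v. In x^p s
   v the correction p c^(p-1) v vanishes, so x^p = x would force v = 0. *)
- move=> ga c de [sz' [v hv v0]]; set j := size ga.
  have jn : (j.+1 <= n)%N by move: sz'; rewrite size_cat /= -/j; lia.
  have hc : jm j * v = io c *: v by exact: wt_cat_cons hv.
  have hc' : jm j.+1 * v = io c *: v.
    by rewrite -[j.+1](size_rcons ga c); apply: wt_cat_cons; rewrite cat_rcons; exact: hv.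
  have e1 : jm j * (s j * v) = io c *: (s j * v) - v.
    by rewrite mulrA jm_s mulrBl mul1r -mulrA hc' -scalerAr.
  have e2 m : jm j ^+ m.+1 * (s j * v) =
      io c ^+ m.+1 *: (s j * v) - (m.+1%:R * io c ^+ m) *: v.
    elim: m => [|m IH]; first by rewrite !expr1 e1 mul1r scale1r.
    rewrite exprS -mulrA IH mulrBr -!scalerAr e1 hc scalerBr !scalerA -exprSr.
    rewrite -addrA -opprD -scalerDl; congr (_ - _ *: _).
    by rewrite !exprS -natr1; ring.
  have := e2 p.-1; rewrite prednK ?prime_gt0 // split_n1; last exact: leq_trans jn _.
  rewrite e1 ioX // (pcharf0 pk) mul0r scale0r subr0 => /eqP.
  rewrite -subr_eq0 addrAC subrr add0r oppr_eq0; exact/negP.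
- move=> th ga c de th1 [sz' [v hv v0]]; case/eqP: v0.
  by apply: wt_braid hv => //; move: sz'; rewrite size_cat /=; lia.
- move=> ga r [sz' [v hv v0]]; case/eqP: v0; apply: (@sym_vanish (size ga)) => j jb.
  by rewrite (run_sign _ sz' hv jb) ?io1 ?scale1r // inE eqxx.
- move=> ga r [sz' [v hv v0]]; case/eqP: v0; apply: (@alt_vanish (size ga)) => j jb.
  by rewrite (run_sign _ sz' hv jb) ?ioN ?io1 ?scaleN1r // !inE eqxx orbT.
Qed.

End Step.

Hypotheses
  (sym_vanish : forall l u,
     (forall j, (l <= j < l + (p - i))%N -> s j * u = u) -> u = 0)
  (alt_vanish : forall l u,
     (forall j, (l <= j < l + i)%N -> s j * u = - u) -> u = 0).

Lemma split_valid n : split_upto n /\ valid_upto n.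
Proof.
elim: n => [|n [sn vn]].
  by split=> // -[] // u _ _ _; exact: valid_nil.
split; last exact: valid_step.
by move=> j; rewrite ltnS leq_eqVlt => /orP[/eqP->|/sn //]; exact: split_step.
Qed.

Lemma jmX j : jm j ^+ p = jm j.
Proof. by have [sn _] := split_valid j.+1; apply: sn. Qed.

Lemma wt_valid al u : wt al u -> u != 0 -> valid al.
Proof. by have [_ vn] := split_valid (size al); exact: vn. Qed.

Lemma split_all n : split_upto n. Proof. by move=> j _; exact: jmX. Qed.

Lemma ide_id al : wt al (ide al).
Proof. exact: (wt_ide (@split_all (size al)) (leqnn _)). Qed.

Lemma ide_idem al : ide al * ide al = ide al.
Proof. by apply: ide_wt; exact: ide_id. Qed.

Lemma ide_orth al be : size al = size be -> al != be -> ide al * ide be = 0.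
Proof. by move=> e ne; apply: (ide_wt_neq e ne); exact: ide_id. Qed.

Lemma ide_valid al : ide al != 0 -> valid al.
Proof. by apply: wt_valid; exact: ide_id. Qed.

(* The span of the group elements of S_(n+1), through the double cosets
   S_(n+1) = S_n + S_n s S_n with s the last generator. *)
Fixpoint gen n (z : Q) : Prop := if n is n'.+1 then
  forall K : Q -> Prop, K 0 -> (forall u w, K u -> K w -> K (u + w)) ->
    (forall y, gen n' y -> K y) ->
    (forall y y', gen n' y -> gen n' y' -> K (y * s n' * y')) -> K z
  else exists c : k, z = c%:A.

Lemma genS_ind n (K : Q -> Prop) : K 0 -> (forall u w, K u -> K w -> K (u + w)) ->
    (forall y, gen n y -> K y) ->
    (forall y y', gen n y -> gen n y' -> K (y * s n * y')) ->
  forall z, gen n.+1 z -> K z.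
Proof. by move=> K0 KD K1 K2 z; apply. Qed.

Lemma gen_mono n z : gen n z -> gen n.+1 z.
Proof. by move=> gz K K0 KD K1 K2; exact: K1. Qed.

Lemma gen_mid n y y' : gen n y -> gen n y' -> gen n.+1 (y * s n * y').
Proof. by move=> gy gy' K K0 KD K1 K2; exact: K2. Qed.

Lemma gen0 n : gen n 0.
Proof. by case: n => [|n]; [exists 0; rewrite scale0r | move=> K K0]. Qed.

Lemma genD n z z' : gen n z -> gen n z' -> gen n (z + z').
Proof.
case: n => [[c ->] [d ->]|n gz gz']; first by exists (c + d); rewrite scalerDl.
by move=> K K0 KD K1 K2; apply: (KD); [exact: (gz K K0 KD K1 K2) | exact: (gz' K K0 KD K1 K2)].
Qed.

Lemma gen_scalar n (c : k) : gen n c%:A.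
Proof. by elim: n => [|n IH]; [exists c | exact: gen_mono]. Qed.

Lemma gen1 n : gen n 1.
Proof. by rewrite -[1]scale1r; exact: gen_scalar. Qed.

Lemma gen_s n : gen n.+1 (s n).
Proof. by rewrite -[s n]mulr1 -[s n]mul1r; apply: gen_mid; exact: gen1. Qed.

Lemma gen_comm m l z : gen m z -> (m < l)%N -> s l * z = z * s l.
Proof.
elim: m z => [|m IH] z gz ml.
  by case: gz => c ->; rewrite mulr_algr mulr_algl.
move: z gz; apply: genS_ind; first by rewrite mulr0 mul0r.
- by move=> u w hu hw; rewrite mulrDr mulrDl hu hw.
- by move=> y gy; apply: IH gy (ltnW ml).
move=> y y' gy gy'; rewrite !mulrA (IH _ gy (ltnW ml)) -!mulrA; congr (_ * _).
by rewrite mulrA -s_comm // -!mulrA; congr (_ * _); apply: IH gy' (ltnW ml).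
Qed.

(** The one product not already in double coset form is s v s with v one level down. Decomposing v
    in turn, either s commutes past it and s^2 = 1 applies, or the braid relation restores the
    form. *)
Lemma genM n z z' : gen n z -> gen n z' -> gen n (z * z').
Proof.
elim: n z z' => [|n IH] z z' gz gz'.
  case: gz => c ->; case: gz' => d ->; exists (c * d).
  by rewrite mulr_algl scalerA.
have gl y w : gen n y -> gen n.+1 w -> gen n.+1 (y * w).
  move=> gy; move: w; apply: genS_ind; first by rewrite mulr0; exact: gen0.
  - by move=> u w hu hw; rewrite mulrDr; exact: genD.
  - by move=> v gv; apply: gen_mono; exact: IH.
  by move=> v v' gv gv'; rewrite !mulrA; apply: gen_mid => //; exact: IH.
have gs w : gen n.+1 w -> gen n.+1 (s n * w).
  move: w; apply: genS_ind; first by rewrite mulr0; exact: gen0.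
  - by move=> u w hu hw; rewrite mulrDr; exact: genD.
  - by move=> v gv; rewrite -[s n]mul1r; apply: gen_mid => //; exact: gen1.
  move=> v v' gv gv'; rewrite 2!mulrA.
  case: n IH gl gv gv' {gz gz'} => [|n] IH gl gv gv'.
    case: gv => c ->; rewrite mulr_algr -!scalerAl ss mul1r -[c *: _]mulr_algl.
    by apply: gl; [exact: gen_scalar | exact: gen_mono].
  move: v gv; apply: genS_ind; first by rewrite mulr0 !mul0r; exact: gen0.
  - by move=> u w hu hw; rewrite mulrDr !mulrDl; exact: genD.
  - move=> u gu; rewrite (gen_comm gu) // -(mulrA u) ss mulr1.
    by apply: gen_mono; apply: IH => //; exact: gen_mono.
  move=> u u' gu gu'.
  have -> : s n.+1 * (u * s n * u') * s n.+1 * v' =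
      (u * s n) * s n.+1 * (s n * u' * v').
    rewrite !mulrA (gen_comm gu) // -!mulrA; congr (_ * _).
    rewrite !mulrA -(mulrA _ u') -(gen_comm gu') // !mulrA.
    by rewrite -s_braid.
  apply: gen_mid.
    by apply: (IH); [exact: gen_mono | exact: gen_s].
  rewrite -mulrA; apply: (IH); first exact: gen_s.
  by apply: (IH) => //; exact: gen_mono.
move: z gz; apply: genS_ind; first by rewrite mul0r; exact: gen0.
- by move=> u w hu hw; rewrite mulrDl; exact: genD.
- by move=> y gy; exact: gl.
by move=> y y' gy gy'; rewrite -!mulrA; apply: (gl) => //; apply: gs; exact: gl.
Qed.

Lemma gen_leq m n z : (m <= n)%N -> gen m z -> gen n z.
Proof.
elim: n => [|n IH]; first by case: m.
by rewrite leq_eqVlt => /orP[/eqP<- //|/IH h /h /gen_mono].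
Qed.

Lemma gen_jm n j : (j <= n)%N -> gen n (jm j).
Proof.
move=> jn; apply: gen_leq jn _; elim: j => [|j IH]; first exact: gen0.
have gs := @gen_s j; apply: (genD _ gs); apply: (genM _ gs).
by apply: (genM gs); exact: gen_mono.
Qed.

Lemma gen_horner n z (f : {poly k}) : gen n z -> gen n (horner_alg z f).
Proof.
move=> gz; elim/poly_ind: f => [|f c IH]; first by rewrite rmorph0; exact: gen0.
rewrite rmorphD rmorphM /= horner_algX horner_algC.
by apply: genD; [exact: genM | exact: gen_scalar].
Qed.

Lemma gen_ide n al : (size al <= n.+1)%N -> gen n (ide al).
Proof.
elim/last_ind: al => [|al c IH]; first by rewrite ide_nil => _; exact: gen1.
rewrite size_rcons => sz; rewrite ide_rcons; apply: genM; first by apply: IH; exact: ltnW.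
by apply/gen_horner/gen_jm.
Qed.

Lemma gen_jm_comm n z l : gen n z -> (n < l)%N -> jm l * z = z * jm l.
Proof.
elim: n z => [|n IH] z gz nl.
  by case: gz => c ->; rewrite mulr_algr mulr_algl.
move: z gz; apply: genS_ind; first by rewrite mulr0 mul0r.
- by move=> u w hu hw; rewrite mulrDr mulrDl hu hw.
- by move=> y gy; apply: IH gy (ltnW nl).
move=> y y' gy gy'; rewrite !mulrA (IH _ gy (ltnW nl)) -!mulrA; congr (_ * _).
by rewrite mulrA -s_jm_lt // -!mulrA; congr (_ * _); apply: IH gy' (ltnW nl).
Qed.

(** * Equivalence of idempotents and their corner rings *)

Definition eqv n al be := exists w w', [/\ gen n w, gen n w',
  ide al * w = w * ide be, ide be * w' = w' * ide al
  & w' * w * ide be = ide be /\ w * w' * ide al = ide al].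

Lemma eqv_refl n al : eqv n al al.
Proof. by exists 1, 1; rewrite !mulr1 !mul1r; split=> //; exact: gen1. Qed.

Lemma eqv_trans n al be ga : eqv n al be -> eqv n be ga -> eqv n al ga.
Proof.
move=> [w1 [w1' [g1 g1' a1 b1 [c1 d1]]]] [w2 [w2' [g2 g2' a2 b2 [c2 d2]]]].
exists (w1 * w2), (w2' * w1'); split; try exact: genM.
- by rewrite mulrA a1 -mulrA a2 mulrA.
- by rewrite mulrA b2 -mulrA b1 mulrA.
split.
  have -> : w2' * w1' * (w1 * w2) * ide ga = w2' * (w1' * w1 * (w2 * ide ga)).
    by rewrite !mulrA.
  by rewrite -a2 (mulrA _ (ide be)) c1 a2 mulrA.
have -> : w1 * w2 * (w2' * w1') * ide al = w1 * (w2 * w2' * (w1' * ide al)).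
  by rewrite !mulrA.
by rewrite -b1 (mulrA _ (ide be)) d2 b1 mulrA.
Qed.

Lemma pr_eigen_r c d l z : z * jm l = io d *: z -> z * pr c l = (c == d)%:R *: z.
Proof.
move=> e; rewrite -(lagr_eval p_pr pk) /pr; elim/poly_ind: (lagr k c) => [|f b IH].
  by rewrite rmorph0 mulr0 horner0 scale0r.
rewrite rmorphD rmorphM /= horner_algX horner_algC mulrDr.
rewrite horner_alg_comm // mulrA e -scalerAl IH scalerA hornerMXaddC mulr_algr.
by rewrite -scalerDl [io d * _]mulrC.
Qed.

Lemma jm_pr_all c j : jm j * pr c j = io c *: pr c j.
Proof. exact: (jm_pr (@split_all j.+1) c (ltnSn j)). Qed.

Lemma pr_mul c d j : pr c j * pr d j = (c == d)%:R *: pr d j.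
Proof. by apply: pr_eigen; exact: jm_pr_all. Qed.

Lemma eqv_rcons n al be c : size al = n.+1 -> size be = n.+1 ->
  eqv n al be -> eqv n.+1 (rcons al c) (rcons be c).
Proof.
move=> sa sb [w [w' [gw gw' aw bw [cw dw]]]].
have prw z : gen n z -> pr c n.+1 * z = z * pr c n.+1.
  by move=> gz; apply: pr_commL; rewrite (gen_jm_comm gz).
exists w, w'; rewrite !ide_rcons sa sb; split; try exact: gen_mono.
- by rewrite -mulrA prw // !mulrA aw.
- by rewrite -mulrA prw // !mulrA bw.
by rewrite !mulrA cw dw.
Qed.

(** The intertwiner exchanges the two idempotents, and its square acts on each as 1 - (c - d)^2,
    which is non-zero because c and d are not neighbours. *)
Lemma eqv_swap ep c d : c != d + 1 -> d != c + 1 ->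
  eqv (size ep).+1 (rcons (rcons ep c) d) (rcons (rcons ep d) c).
Proof.
move=> cd dc; set n := size ep.
set x := jm n; set y := jm n.+1; set t := s n.
have xy : x * y = y * x by exact: jm_comm.
have tx : t * x = y * t - 1 by exact: s_jm.
have xt : x * t = t * y - 1 by exact: jm_s.
set f := phi t x y.
have xf : x * f = f * y by apply: phi_l.
have yf : y * f = f * x by exact: phi_r.
have gx : gen n.+1 x by apply: gen_jm.
have gy : gen n.+1 y by apply: gen_jm.
have gf : gen n.+1 f.
  have gt := @gen_s n; apply: (genD _ (@gen1 _)); apply: (genM gt); apply: (genD gx).
  by rewrite -scaleN1r -mulr_algl; apply: (genM _ gy); exact: gen_scalar.
have f_jm j : (j < n)%N -> jm j * f = f * jm j.
  move=> jn; rewrite /f /phi mulrDr mulrDl mulr1 mul1r mulrA -s_jm_gt //.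
  by rewrite -!mulrA mulrBr mulrBl jm_comm [jm j * y]jm_comm.
have ff : f * f = 1 - (x - y) ^+ 2 by exact: (phi_sqr (ss n) tx xt).
clearbody f; have hx g : horner_alg x g * f = f * horner_alg y g.
  elim/poly_ind: g => [|g e IH]; first by rewrite !rmorph0 mul0r mulr0.
  rewrite !(rmorphD, rmorphM) /= !horner_algX !horner_algC mulrDl mulrDr -mulrA xf.
  by rewrite !mulrA IH mulr_algl mulr_algr.
have hy g : horner_alg y g * f = f * horner_alg x g.
  elim/poly_ind: g => [|g e IH]; first by rewrite !rmorph0 mul0r mulr0.
  rewrite !(rmorphD, rmorphM) /= !horner_algX !horner_algC mulrDl [in RHS]mulrDr -mulrA yf.
  by rewrite !mulrA IH mulr_algl mulr_algr.
have ideE a b : ide (rcons (rcons ep a) b) * f = f * ide (rcons (rcons ep b) a).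
  have fe : ide ep * f = f * ide ep by apply: ide_commL => j jn; rewrite f_jm.
  rewrite !ide_rcons !size_rcons -/n /pr -/x -/y.
  set gax := horner_alg x (lagr k a); set gby := horner_alg y (lagr k b).
  set gay := horner_alg y (lagr k a); set gbx := horner_alg x (lagr k b).
  have ce : gay * gbx = gbx * gay by apply: horner_alg_comm; rewrite -horner_alg_comm.
  rewrite -(mulrA _ gby) hy (mulrA _ f) -(mulrA _ gax) hx (mulrA _ f) fe -/gay -/gbx.
  by rewrite -!mulrA ce.
have ffE a b : f * f * ide (rcons (rcons ep a) b) =
    (1 - (io a - io b) ^+ 2) *: ide (rcons (rcons ep a) b).
  have /wt_rcons[/wt_rcons[_ xe] ye] := @ide_id (rcons (rcons ep a) b).
  rewrite size_rcons -/n -/x -/y in xe ye.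
  have xye : (x - y) * ide (rcons (rcons ep a) b) =
     (io a - io b) *: ide (rcons (rcons ep a) b) by rewrite mulrBl xe ye scalerBl.
  rewrite ff mulrBl mul1r expr2 -mulrA xye -scalerAr xye scalerA -expr2.
  by rewrite scalerBl scale1r.
have nz : 1 - (io c - io d) ^+ 2 != 0 by exact: io_sqr_neq.
have nz' : 1 - (io d - io c) ^+ 2 = 1 - (io c - io d) ^+ 2 by rewrite -sqrrN opprB.
exists f, ((1 - (io c - io d) ^+ 2)^-1 *: f); split=> //.
- by rewrite -mulr_algl; apply: (genM _ gf); exact: gen_scalar.
- by rewrite -scalerAr -scalerAl ideE.
split; last by rewrite -scalerAr -scalerAl ffE scalerA mulVf ?scale1r.
by rewrite -!scalerAl ffE nz' scalerA mulVf ?scale1r.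
Qed.

(** Schur's lemma for the algebra [gen n], stated for a single element so that it can be proved by
    induction on how z is generated. *)
Definition corner n (z : Q) := forall al be, size al = n.+1 -> size be = n.+1 ->
  (exists c : k, ide al * z * ide al = c *: ide al) /\
  (ide al * z * ide be != 0 -> eqv n al be).

Lemma corner0 n : corner n 0.
Proof.
move=> al be _ _; rewrite mulr0 !mul0r eqxx; split=> //.
by exists 0; rewrite scale0r.
Qed.

Lemma cornerD n u w : corner n u -> corner n w -> corner n (u + w).
Proof.
move=> hu hw al be sa sb; have [[c ec] cu] := hu _ _ sa sb.
have [[d ed] cw] := hw _ _ sa sb; rewrite mulrDr !mulrDl ec ed; split.
  by exists (c + d); rewrite scalerDl.
have [->|/cu //] := eqVneq (ide al * u * ide be) 0.
by rewrite add0r => /cw.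
Qed.

Lemma corner_scale n (c : k) u : corner n u -> corner n (c *: u).
Proof.
move=> hu al be sa sb; have [[d ed] cu] := hu _ _ sa sb.
rewrite -!scalerAr -!scalerAl ed; split; first by exists (c * d); rewrite scalerA.
by rewrite scaler_eq0 negb_or => /andP[_ /cu].
Qed.

Lemma gen_pr n c z : gen n z -> pr c n.+1 * z = z * pr c n.+1.
Proof. by move=> gz; apply: pr_commL; rewrite (gen_jm_comm gz). Qed.

Lemma corner_mono n z : gen n z -> corner n z -> corner n.+1 z.
Proof.
move=> gz hz al be; case/lastP: al => [|al a] //; case/lastP: be => [|be b] //.
rewrite !size_rcons => -[sa] [sb]; have [[c ec] cz] := hz _ _ sa sb.
have E al' a' b' be' : size al' = n.+1 -> size be' = n.+1 ->
    ide (rcons al' a') * z * ide (rcons be' b') =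
    (a' == b')%:R *: (ide al' * z * ide (rcons be' b')).
  move=> sa' sb'; rewrite !ide_rcons sa' sb'.
  have gb : gen n (ide be') by apply: gen_ide; rewrite sb'.
  rewrite -!mulrA (mulrA (pr a' _) z) (gen_pr _ gz) -!mulrA (mulrA (pr a' _) (ide be')).
  by rewrite (gen_pr _ gb) -!mulrA pr_mul -!scalerAr.
rewrite !E //; split.
  by exists c; rewrite eqxx scale1r ide_rcons sa mulrA ec -scalerAl.
have [<-|_] := eqVneq a b; last by rewrite scale0r eqxx.
rewrite scale1r ide_rcons mulrA => nz; apply: eqv_rcons => //; apply: cz.
by apply: contraNneq nz => ->; rewrite mul0r.
Qed.

(** Let A be the middle factor and y = [jm n.+1]. As s commutes with the idempotent of the first n
    letters, A = 0 unless [ga] and [de] share them. If their last letters g, d differ, A is an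
    eigenvector of y on both sides and connects the same words as [eqv_swap]. If they agree, y A = g
    A + [ide ga], which on each eigenspace of y replaces A by a multiple of [ide ga], an element of
    [gen n]. *)
Lemma corner_mid n z1 z2 ga de : gen n z1 -> gen n z2 -> (forall z, gen n z -> corner n z) ->
  size ga = n.+1 -> size de = n.+1 ->
  corner n.+1 (z1 * (ide ga * s n * ide de) * z2).
Proof.
move=> g1 g2 IH; case/lastP: ga => [|ep g] //; case/lastP: de => [|ep' d] //.
rewrite !size_rcons => -[sg] [sd].
set ga := rcons ep g; set de := rcons ep' d.
have sga : size ga = n.+1 by rewrite size_rcons sg.
have sde : size de = n.+1 by rewrite size_rcons sd.
have gga : gen n (ide ga) by apply: gen_ide; rewrite sga.
have gde : gen n (ide de) by apply: gen_ide; rewrite sde.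
set A := ide ga * s n * ide de.
have sep : s n * ide ep = ide ep * s n.
  by rewrite ide_commL // => j; rewrite sg => jn; rewrite s_jm_gt.
have [eep|nep] := eqVneq ep ep'; last first.
  have -> : A = 0.
    have e : ide ep * pr g n = pr g n * ide ep by apply: ide_commL => j _; rewrite pr_jm.
    rewrite /A /ga /de !ide_rcons sg sd e -!mulrA (mulrA (ide ep)) -sep -!mulrA.
    by rewrite (mulrA (ide ep)) ide_orth ?sg ?sd // !(mul0r, mulr0).
  by rewrite mulr0 mul0r; exact: corner0.
have xga : ide ga * jm n = io g *: ide ga.
  have /wt_rcons[_] := @ide_id ga; rewrite sg => <-; exact: ide_jm.
have xde : jm n * ide de = io d *: ide de.
  by have /wt_rcons[_] := @ide_id de; rewrite sd.
have yA : jm n.+1 * A = io d *: A + ide ga * ide de.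
  rewrite /A !mulrA (gen_jm_comm gga) // -(mulrA (ide ga)).
  have -> : jm n.+1 * s n = s n * jm n + 1 by rewrite s_jm subrK.
  by rewrite mulrDr mulr1 mulrDl -!mulrA xde -!scalerAr !mulrA.
have Ay : A * jm n.+1 = io g *: A + ide ga * ide de.
  rewrite /A -(mulrA _ (ide de)) -(gen_jm_comm gde) // mulrA -(mulrA (ide ga)).
  have -> : s n * jm n.+1 = jm n * s n + 1 by rewrite jm_s subrK.
  by rewrite mulrDr mulr1 mulrDl !mulrA xga -!scalerAl.
have E al' a' b' be' : size al' = n.+1 -> size be' = n.+1 ->
    ide (rcons al' a') * (z1 * A * z2) * ide (rcons be' b') =
    ide al' * z1 * (pr a' n.+1 * A * pr b' n.+1) * z2 * ide be'.
  move=> sa' sb'; rewrite !ide_rcons sa' sb'.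
  have -> : ide be' * pr b' n.+1 = pr b' n.+1 * ide be'.
    by rewrite gen_pr //; apply: gen_ide; rewrite sb'.
  rewrite -!mulrA (mulrA (pr a' _) z1) (gen_pr _ g1) (mulrA z2 (pr b' _)) -(gen_pr _ g2).
  by rewrite !mulrA.
have [egd|ngd] := eqVneq g d; last first.
  have ga_de0 : ide ga * ide de = 0.
    apply: ide_orth; rewrite ?sga //; apply: contraNneq ngd.
    by move/rcons_inj => [_ ->].
  rewrite ga_de0 !addr0 in yA Ay.
  have prA a' b' : pr a' n.+1 * A * pr b' n.+1 = (a' == d)%:R *: ((b' == g)%:R *: A).
    by rewrite (pr_eigen _ yA) -scalerAl (pr_eigen_r _ Ay).
  move=> al be; case/lastP: al => [|al a] //; case/lastP: be => [|be b] //.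
  rewrite !size_rcons => -[sa] [sb]; rewrite !E // !prA; split.
    exists 0; rewrite scale0r; have [->|_] := eqVneq a d; last by rewrite scale0r mulr0 !mul0r.
    by rewrite eq_sym (negbTE ngd) !(scale0r, scaler0) mulr0 !mul0r.
  have [->|_] := eqVneq a d; last by rewrite scale0r mulr0 !mul0r eqxx.
  have [->|_] := eqVneq b g; last by rewrite !(scale0r, scaler0) mulr0 !mul0r eqxx.
  rewrite !scale1r => nz.
  have nz1 : ide al * z1 * ide ga != 0.
    by apply: contraNneq nz => e0; rewrite /A !mulrA e0 !mul0r.
  have nz2 : ide de * z2 * ide be != 0.
    by apply: contraNneq nz => e0; rewrite /A -!mulrA (mulrA (ide de)) e0 !mulr0.
  have e1 : eqv n al ga by have [_] := IH _ g1 _ _ sa sga; apply.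
  have e2 : eqv n de be by have [_] := IH _ g2 _ _ sde sb; apply.
  apply: (eqv_trans (eqv_rcons d sa sga e1)).
  apply: eqv_trans (eqv_rcons g sde sb e2).
  have ga0 : ide ga != 0 by apply: contraNneq nz1 => ->; rewrite mulr0.
  have de0 : ide de != 0 by apply: contraNneq nz2 => ->; rewrite !mul0r.
  have /validE[_ hg] := ide_valid ga0; have /validE[_ hd] := ide_valid de0.
  rewrite /ga /de -eep -sg; rewrite -eep in hd; apply: eqv_swap.
    by apply/eqP => e; move: (hop_neighbour hd); rewrite -e hg.
  by apply/eqP => e; move: (hop_neighbour hg); rewrite -e hd.
have eAA : ide ga * ide de = ide ga by rewrite /ga /de eep egd ide_idem.
rewrite eAA -egd in yA Ay.
have gA : ide ga * A = A by rewrite /A !mulrA ide_idem.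
have prA a' : pr a' n.+1 * A = (io a' - io g)^-1 *: (pr a' n.+1 * ide ga).
  have e : (io a' - io g) *: (pr a' n.+1 * A) = pr a' n.+1 * ide ga.
    rewrite scalerBl scalerAl -jm_pr_all -pr_jm -mulrA yA mulrDr -scalerAr.
    by rewrite addrAC subrr add0r.
  have [z0|nz] := eqVneq (io a' - io g) 0; last by rewrite -e scalerA mulVf ?scale1r.
  (* For a' = g the inverse is 0 by convention. This is the right value: then [pr a' n.+1 * ide ga]
     is 0 by [e], and so is its product with A. *)
  rewrite z0 invr0 scale0r; move: e; rewrite z0 scale0r => e.
  by rewrite -gA mulrA -e mul0r.
move=> al be; case/lastP: al => [|al a] //; case/lastP: be => [|be b] //.
move=> sa sb; have [sa' sb'] : size al = n.+1 /\ size be = n.+1.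
  by move: sa sb; rewrite !size_rcons => -[->] [->].
have gz : gen n (z1 * ide ga * z2) by apply: (genM _ g2); exact: genM.
have cz := corner_mono gz (IH _ gz).
have E2 al' a' b' be' : size al' = n.+1 -> size be' = n.+1 ->
    ide (rcons al' a') * (z1 * A * z2) * ide (rcons be' b') =
    ide (rcons al' a') * ((io a' - io g)^-1 *: (z1 * ide ga * z2)) * ide (rcons be' b').
  move=> sal sbe; rewrite E // prA -!(scalerAr, scalerAl); congr (_ *: _).
  rewrite !ide_rcons sal sbe.
  have -> : ide be' * pr b' n.+1 = pr b' n.+1 * ide be'.
    by rewrite gen_pr //; apply: gen_ide; rewrite sbe.
  rewrite -!mulrA (mulrA (pr a' _) z1) (gen_pr _ g1) (mulrA z2 (pr b' _)) -(gen_pr _ g2).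
  by rewrite !mulrA.
by rewrite !E2 //; apply: (corner_scale _ cz).
Qed.

Lemma gen_corner n z : gen n z -> corner n z.
Proof.
elim: n z => [|n IH] z gz.
  case: gz => c -> al be sa sb; rewrite mulr_algr -!scalerAl ide_idem; split.
    by exists c.
  have [<- _|ne] := eqVneq al be; first exact: eqv_refl.
  by rewrite ide_orth ?sa // scaler0 eqxx.
move: z gz; apply: genS_ind.
- exact: corner0.
- by move=> u w; exact: cornerD.
- by move=> y gy; apply: corner_mono => //; exact: IH.
move=> y y' gy gy'; rewrite -[s n]mul1r.
apply: (ide_span (m := n.+1) (K := fun v => corner n.+1 (y * (v * s n) * y')) (z := 1)).
- by rewrite mul0r mulr0 mul0r; exact: corner0.
- by move=> u w hu hw; rewrite mulrDl mulrDr mulrDl; exact: cornerD.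
move=> ga sga; rewrite mulr1 -[ide ga * _]mulr1.
apply: (ide_span (m := n.+1) (K := fun v => corner n.+1 (y * (ide ga * s n * v) * y')) (z := 1)).
- by rewrite mulr0 mulr0 mul0r; exact: corner0.
- by move=> u w hu hw; rewrite !mulrDr mulrDl; exact: cornerD.
by move=> de sde; rewrite mulr1; apply: corner_mid.
Qed.

(** * Simplicity of the quotient *)

Section Simple.
Variable K : Q -> Prop.
Hypotheses (K0 : K 0) (KD : forall u w, K u -> K w -> K (u + w))
  (KM : forall u z w, K z -> K (u * z * w)) (K1 : ~ K 1).

Let KZ (c : k) z : K z -> K (c *: z).
Proof. by move=> Kz; rewrite -mulr_algl -[X in K X]mulr1; exact: KM. Qed.

Let KMl w z : K z -> K (w * z).
Proof. by move=> Kz; rewrite -[_ * _]mulr1; apply: KM. Qed.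

(** As 1 is not in K, neither is the idempotent of some long word. Such a word contains every letter
    often enough to be rearranged so that it begins with [be], and the exchanges, being invertible
    up to scalars, do not lead into K. *)
Lemma weight_notin be : valid be -> exists2 u, wt be u & ~ K u.
Proof.
move=> vbe; pose W al := exists2 u, wt al u & ~ K u.
have W_swap ga c d de : d != c -> c != d + 1 -> d != c + 1 ->
    W (ga ++ d :: c :: de) -> W (ga ++ c :: d :: de).
  move=> dc cd1 dc1 [u hu nu]; exists ((io d - io c) *: (s (size ga) * u) + u).
    exact: wt_swap.
  move=> Kw; apply: nu; have := wt_swap_inv (io d - io c) u (size ga); move=> /= e.
  have nz := io_sqr_neq p_pr pk dc1 cd1.
  rewrite -[u]scale1r -(mulVf nz) -scalerA -e -scaleN1r; apply: KZ.
  by apply: KD => //; apply: KZ; apply: KZ; exact: KMl.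
have W_valid al : W al -> valid al.
  by move=> [u hu nu]; apply: (wt_valid hu); apply: contra_not_neq nu => ->.
(* The length from which [valid_count] yields each letter at least [size be] times, which covers its
   multiplicity in [be]. *)
pose N := (p * (size be + p)).+1.
have [al sal nal] : exists2 al, size al = N & ~ K (ide al).
  apply: contrapT => none; apply: K1; apply: (ide_span (m := N)) => // al sal.
  by rewrite mulr1; apply: contrapT => nK; apply: none; exists al.
have Wal : W al by exists (ide al) => //; exact: ide_id.
have [|de [u hu nu]] := W_prefix p_pr i_bnd W_swap W_valid Wal vbe; last first.
  by exists u => //; apply: wt_catl hu.
move=> c; apply: (leq_trans (count_size _ _)).
by apply: (valid_count p_pr i_bnd _ (W_valid _ Wal)); rewrite sal.
Qed.

(** A non-zero corner of z, multiplied by the equivalence w', is a non-zero multiple of [ide al].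
    Then K contains every vector of weight [al], against [weight_notin]. *)
Lemma ideal_trivial n z : gen n z -> K z -> z = 0.
Proof.
move=> gz Kz; apply: contrapT => z0.
have [al [be [sa sb nz]]] : exists al be,
    [/\ size al = n.+1, size be = n.+1 & ide al * z * ide be != 0].
  apply: contrapT => none; apply: z0.
  apply: (ide_span (m := n.+1) (K := fun v => v = 0)) => //.
    by move=> u w -> ->; rewrite addr0.
  move=> al sa; rewrite -[_ * z]mulr1.
  apply: (ide_span (m := n.+1) (K := fun v => ide al * z * v = 0)); first by rewrite mulr0.
    by move=> u w hu hw; rewrite mulrDr hu hw addr0.
  move=> be sb; rewrite mulr1; apply/eqP; apply: contrapT => /negP nz.
  by apply: none; exists al, be.
have [_ /(_ nz)[w [w' [gw gw' aw bw [cw dw]]]]] := gen_corner gz sa sb.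
have gzw : gen n (z * w') by exact: genM.
have [[c ec] _] := gen_corner gzw sa sa.
have e1 : ide al * z * ide be * w' = c *: ide al by rewrite -ec -!mulrA bw.
have c0 : c != 0.
  apply: contraNneq nz => c0; rewrite c0 scale0r in e1.
  have -> : ide be = ide be * w' * w by rewrite bw -mulrA aw mulrA cw.
  by rewrite !mulrA e1 mul0r.
have Kal : K (ide al).
  rewrite -[ide al]scale1r -(mulVf c0) -scalerA -e1; apply: KZ.
  by rewrite -(mulrA (ide al * z)); apply: KM.
have al0 : ide al != 0.
  apply: contraNneq nz => ->; by rewrite !mul0r.
have [u hu nu] := weight_notin (ide_valid al0).
by apply: nu; rewrite -(ide_wt hu) -[_ * u]mul1r mulrA; apply: KM.
Qed.

End Simple.

End Weights.

(** * Quotient algebras *)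

Section QuotientAlgebra.
Local Open Scope quotient_scope.
Variables (k : fieldType) (B : algType k) (J : set B).
Hypotheses (idJ : two_sided_ideal J) (J1 : ~ J 1).

Definition ideal_mem : {pred B} := fun x => `[< J x >].

Lemma ideal_memP x : reflect (J x) (x \in ideal_mem).
Proof. exact: asboolP. Qed.

Fact ideal_mem_zmod : zmod_closed ideal_mem.
Proof.
case: idJ => J0 JB _; split=> [|x y]; first exact/ideal_memP.
by move=> /ideal_memP hx /ideal_memP hy; apply/ideal_memP/JB.
Qed.

HB.instance Definition _ := GRing.isZmodClosed.Build B ideal_mem ideal_mem_zmod.

Definition quot_alg : Type := {ideal_quot ideal_mem}.
HB.instance Definition _ := GRing.Zmodule.copy quot_alg {ideal_quot ideal_mem}.

Definition quot_pi (x : B) : quot_alg := \pi_({ideal_quot ideal_mem}) x.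
Definition quot_repr (q : quot_alg) : B := repr (q : {ideal_quot ideal_mem}).

Lemma quot_reprK q : quot_pi (quot_repr q) = q. Proof. exact: reprK. Qed.

Lemma quot_piP x y : quot_pi x = quot_pi y <-> J (x - y).
Proof.
split=> [/eqP e|h]; first by apply/ideal_memP; rewrite Quotient.idealrBE.
by apply/eqP; rewrite -[_ == _]Quotient.idealrBE; apply/ideal_memP.
Qed.

Lemma quot_piB : zmod_morphism quot_pi.
Proof. exact: pi_is_zmod_morphism. Qed.

HB.instance Definition _ := GRing.isZmodMorphism.Build B quot_alg quot_pi quot_piB.

Definition quot_mul (q r : quot_alg) := quot_pi (quot_repr q * quot_repr r).
Definition quot_scale (c : k) (q : quot_alg) := quot_pi (c *: quot_repr q).

Lemma quot_repr_pi x : J (quot_repr (quot_pi x) - x).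
Proof. by apply/quot_piP; exact: quot_reprK. Qed.

Lemma quot_piM x y : quot_pi (x * y) = quot_mul (quot_pi x) (quot_pi y).
Proof.
case: idJ => _ _ JM.
transitivity (quot_pi (quot_repr (quot_pi x) * y)); apply/esym/quot_piP.
  by rewrite -mulrBl -[_ - x]mul1r; apply: JM; exact: quot_repr_pi.
rewrite -mulrBr -[_ * _]mulr1; apply: JM; exact: quot_repr_pi.
Qed.

Lemma quot_piZ c x : quot_pi (c *: x) = quot_scale c (quot_pi x).
Proof.
case: idJ => _ _ JM; apply/esym/quot_piP.
rewrite -scalerBr -mulr_algl -[_ * _]mulr1; apply: JM; exact: quot_repr_pi.
Qed.

Lemma quot_mulA : associative quot_mul.
Proof.
move=> x y z; rewrite -[x]quot_reprK -[y]quot_reprK -[z]quot_reprK.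
by rewrite -!quot_piM mulrA.
Qed.

Lemma quot_mul1q : left_id (quot_pi 1) quot_mul.
Proof. by move=> x; rewrite -[x]quot_reprK -quot_piM mul1r. Qed.

Lemma quot_mulq1 : right_id (quot_pi 1) quot_mul.
Proof. by move=> x; rewrite -[x]quot_reprK -quot_piM mulr1. Qed.

Lemma quot_mulDl : left_distributive quot_mul +%R.
Proof.
move=> x y z; rewrite -[x]quot_reprK -[y]quot_reprK -[z]quot_reprK.
by rewrite -raddfD -!quot_piM mulrDl raddfD.
Qed.

Lemma quot_mulDr : right_distributive quot_mul +%R.
Proof.
move=> x y z; rewrite -[x]quot_reprK -[y]quot_reprK -[z]quot_reprK.
by rewrite -raddfD -!quot_piM mulrDr raddfD.
Qed.

Lemma quot_one_neq0 : quot_pi 1 != 0.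
Proof.
by rewrite -(raddf0 quot_pi); apply/eqP => /quot_piP; rewrite subr0.
Qed.

HB.instance Definition _ := GRing.Zmodule_isNzRing.Build quot_alg
  quot_mulA quot_mul1q quot_mulq1 quot_mulDl quot_mulDr quot_one_neq0.

Lemma quot_scaleA a b q : quot_scale a (quot_scale b q) = quot_scale (a * b) q.
Proof. by rewrite -[q]quot_reprK -!quot_piZ scalerA. Qed.

Lemma quot_scale1 : left_id 1 quot_scale.
Proof. by move=> q; rewrite -[q]quot_reprK -quot_piZ scale1r. Qed.

Lemma quot_scaleDr : right_distributive quot_scale +%R.
Proof.
move=> c x y; rewrite -[x]quot_reprK -[y]quot_reprK.
by rewrite -raddfD -!quot_piZ scalerDr raddfD.
Qed.

Lemma quot_scaleDl q : {morph quot_scale^~ q : a b / a + b}.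
Proof.
by move=> a b; rewrite -[q]quot_reprK -!quot_piZ scalerDl raddfD.
Qed.

HB.instance Definition _ := GRing.Zmodule_isLmodule.Build k quot_alg
  quot_scaleA quot_scale1 quot_scaleDr quot_scaleDl.

Lemma quot_scaleAl (c : k) (x y : quot_alg) : c *: (x * y) = c *: x * y.
Proof.
rewrite -[x]quot_reprK -[y]quot_reprK.
have E a b : quot_pi a * quot_pi b = quot_pi (a * b) by rewrite quot_piM.
have Z a : c *: quot_pi a = quot_pi (c *: a) by rewrite quot_piZ.
by rewrite !(E, Z) scalerAl.
Qed.

HB.instance Definition _ := GRing.Lmodule_isLalgebra.Build k quot_alg quot_scaleAl.

Lemma quot_scaleAr (c : k) (x y : quot_alg) : c *: (x * y) = x * (c *: y).
Proof.
rewrite -[x]quot_reprK -[y]quot_reprK.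
have E a b : quot_pi a * quot_pi b = quot_pi (a * b) by rewrite quot_piM.
have Z a : c *: quot_pi a = quot_pi (c *: a) by rewrite quot_piZ.
by rewrite !(E, Z) scalerAr.
Qed.

HB.instance Definition _ := GRing.Lalgebra_isAlgebra.Build k quot_alg quot_scaleAr.

(** Only an abstract algebra with a surjection of kernel J is passed on; the construction is
    forgotten. *)
Lemma quotient_algebra : exists (Q : algType k) (f : B -> Q),
  [/\ forall x y, f (x + y) = f x + f y, forall x y, f (x * y) = f x * f y, f 1 = 1
    & forall c x, f (c *: x) = c *: f x] /\
  [/\ forall q, exists x, f x = q & forall x, f x = 0 <-> J x].
Proof.
exists quot_alg, quot_pi; split; split => //.
- exact: raddfD.
- exact: quot_piM.
- exact: quot_piZ.
- by move=> q; exists (quot_repr q); exact: quot_reprK.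
by move=> x; rewrite -(raddf0 quot_pi) quot_piP subr0.
Qed.

End QuotientAlgebra.

(** * The algebra of the infinite symmetric group *)

Section ShiftWord.
Variables (R : pzRingType) (s : nat -> R).
Hypotheses (ss : forall j, s j * s j = 1)
  (s_braid : forall j, s j * s j.+1 * s j = s j.+1 * s j * s j.+1)
  (s_comm : forall j l, (j.+1 < l)%N -> s j * s l = s l * s j).

Fixpoint shift_word n : R := if n is n'.+1 then shift_word n' * s n' else 1.
Fixpoint shift_word_inv n : R := if n is n'.+1 then s n' * shift_word_inv n' else 1.

Lemma shift_wordK n : shift_word n * shift_word_inv n = 1.
Proof.
elim: n => [|n IH]; first exact: mulr1.
by rewrite /= mulrA -(mulrA (shift_word n)) ss mulr1.
Qed.

Lemma shift_wordKV n : shift_word_inv n * shift_word n = 1.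
Proof.
elim: n => [|n IH]; first exact: mulr1.
by rewrite /= mulrA -(mulrA (s n)) IH mulr1 ss.
Qed.

Lemma shift_word_comm n l : (n < l)%N -> s l * shift_word n = shift_word n * s l.
Proof.
elim: n => [|n IH] nl; first by rewrite mulr1 mul1r.
by rewrite /= mulrA IH ?(ltnW nl) // -!mulrA (s_comm nl).
Qed.

Lemma shift_wordP n j : (j.+1 < n)%N -> s j.+1 * shift_word n = shift_word n * s j.
Proof.
elim: n => // n IH; rewrite ltnS leq_eqVlt => /orP[/eqP <-|jn] /=.
  rewrite !mulrA shift_word_comm // -!mulrA; congr (_ * _).
  by rewrite !mulrA s_braid.
by rewrite mulrA IH // -!mulrA (s_comm jn).
Qed.

(* Conjugating by a shift word moves a block of generators to the origin. *)
Lemma block_vanish (eps : R) r : (forall z, eps * z = z * eps) ->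
  (forall u, (forall j, (j < r)%N -> s j * u = eps * u) -> u = 0) ->
  forall l u, (forall j, (l <= j < l + r)%N -> s j * u = eps * u) -> u = 0.
Proof.
move=> eps_c H0; elim=> [|l IH] u h.
  by apply: H0 => j jr; apply: h.
set w := shift_word (l + r).+2; set w' := shift_word_inv (l + r).+2.
have ww' : w * w' = 1 by exact: shift_wordK.
have w'w : w' * w = 1 by exact: shift_wordKV.
have -> : u = w * (w' * u) by rewrite mulrA ww' mul1r.
rewrite [w' * u]IH ?mulr0 // => j /andP[lj jr].
have e : s j.+1 * u = eps * u by apply: h; rewrite !ltnS lj.
have sw : s j.+1 * w = w * s j by apply: shift_wordP; lia.
clearbody w w'; have -> : s j * (w' * u) = w' * (s j.+1 * u).
  rewrite -[LHS]mul1r -w'w -!mulrA; congr (_ * _).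
  by rewrite !mulrA -sw -(mulrA (s j.+1)) ww' mulr1.
by rewrite e mulrA -eps_c mulrA.
Qed.

End ShiftWord.

Section Generators.

Definition adj j : Sinf := @Sn_incl j.+2 (tperm (inord j) (inord j.+1)).

Definition swapn (j m : nat) : nat :=
  if m == j then j.+1 else if m == j.+1 then j else m.

Lemma adjE j : val (adj j) =1 swapn j.
Proof.
move=> m /=; rewrite /swapn; have [mj|jm] := ltnP m j.+2; last first.
  by rewrite ext_perm_out //; case: eqP => [|_]; [lia | case: eqP => //; lia].
rewrite -[m]/(val (Ordinal mj)) ext_permE permE /=.
rewrite -!val_eqE /= !inordK //.
by case: ifP => _; rewrite ?inordK //; case: ifP => _; rewrite ?inordK.
Qed.

Lemma Sinf_mulE (g h : Sinf) m : val (g * h)%g m = val h (val g m).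
Proof. by []. Qed.

Lemma adj_sqr j : (adj j * adj j = 1)%g.
Proof.
apply: Sinf_eqP => m; rewrite !Sinf_mulE !adjE /swapn.
by do !case: eqP => //; lia.
Qed.

Lemma adj_comm j l : (j.+1 < l)%N -> (adj j * adj l = adj l * adj j)%g.
Proof.
move=> jl; apply: Sinf_eqP => m; rewrite !Sinf_mulE !adjE /swapn.
by do !case: eqP => //; lia.
Qed.

Lemma adj_braid j : (adj j * adj j.+1 * adj j = adj j.+1 * adj j * adj j.+1)%g.
Proof.
apply: Sinf_eqP => m; rewrite !Sinf_mulE !adjE /swapn.
by do !case: eqP => //; lia.
Qed.

Lemma Sn_incl1 n : Sn_incl (1%g : 'S_n) = 1%g.
Proof. by apply: Sinf_eqP => m; rewrite /= ext_perm1. Qed.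

Lemma Sn_incl_adj n (a b : 'I_n) : b = a.+1 :> nat -> Sn_incl (tperm a b) = adj a.
Proof.
move=> e; apply: Sinf_eqP => m; rewrite adjE /swapn /=.
have [mn|nm] := ltnP m n; last first.
  have an := ltn_ord a; have bn := ltn_ord b.
  by rewrite ext_perm_out //; case: eqP => [|_]; [lia | case: eqP => //; lia].
rewrite -[m]/(val (Ordinal mn)) ext_permE permE /=.
by rewrite -!val_eqE /= -e; case: ifP => _ //; case: ifP.
Qed.

(** A transposition (a b) with a < b is reduced to adjacent ones by induction on b - a, as the
    conjugate of (a b-1) by (b-1 b). *)
Lemma perm_adj_ind n (P : 'S_n -> Prop) : P 1%g ->
  (forall (s : 'S_n) (a b : 'I_n), b = a.+1 :> nat -> P s -> P (tperm a b * s)%g) ->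
  forall s, P s.
Proof.
move=> P1 Padj.
have Pt (a b : 'I_n) s : (a < b)%N -> P s -> P (tperm a b * s)%g.
  move e: (b - a)%N => m ab; elim: m b e ab s => [|m IH] b e ab s Ps; first by lia.
  have [e1|ne] := eqVneq (b : nat) a.+1; first exact: Padj.
  have b'n : (b.-1 < n)%N by apply: leq_ltn_trans (ltn_ord b); exact: leq_pred.
  pose b' := Ordinal b'n.
  have -> : tperm a b = (tperm b' b * (tperm a b' * tperm b' b))%g.
    rewrite -[tperm b' b in X in (X * _)%g]tpermV -conjgE tpermJ.
    have ab' : a != b' by rewrite -val_eqE /=; lia.
    have bb' : a != b by rewrite -val_eqE /=; lia.
    by rewrite tpermD 1?eq_sym // tpermL.
  rewrite -!mulgA; apply: (Padj); first by rewrite /=; lia.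
  by apply: IH; rewrite /=; [lia | lia | apply: (Padj) => //=; lia].
move=> s; have [ts -> /allP ts_ok] := prod_tpermP s.
elim: ts ts_ok => [|t ts IH] ts_ok; first by rewrite big_nil.
rewrite big_cons.
have Pts : P (\prod_(t0 <- ts) tperm t0.1 t0.2)%g.
  by apply: IH => u uts; apply: ts_ok; rewrite inE uts orbT.
have := ts_ok t (mem_head _ _); rewrite /dpair /= -val_eqE neq_ltn => /orP[] lt.
  exact: Pt.
by rewrite tpermC; exact: Pt.
Qed.

End Generators.

Section SimpleQuotient.
Variables (k : closedFieldType) (p i : nat).
Hypotheses (pk : p \in [pchar k]) (i_bnd : (1 < i < p - 1)%N).
Local Notation kSinf := (groupalg k Sinf).
Variable J : set kSinf.
Hypotheses (idJ : two_sided_ideal J) (J1 : ~ J 1)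
  (J_skew : J (skew_symmetriser k i.+1)) (J_sym : J (symmetriser k (p + 1 - i))).

Lemma natf_neq0 m : (0 < m < p)%N -> m%:R != 0 :> k.
Proof. by move=> /andP[m0 mp]; rewrite -(dvdn_pcharf pk) gtnNdvd. Qed.

Lemma factf_neq0 m : (m < p)%N -> (m`!)%:R != 0 :> k.
Proof.
elim: m => [|m IH] mp; first by rewrite oner_neq0.
by rewrite factS natrM; apply: mulf_neq0; [exact: natf_neq0 | apply: IH; exact: ltnW].
Qed.

Lemma ideal_maximal (K : set kSinf) : two_sided_ideal K -> (J `<=` K)%classic ->
  ~ K 1 -> (K `<=` J)%classic.
Proof.
move=> [K0 KB KM] JK K1.
have p_pr : prime p by case/andP: pk.
have [Q [f [[fD fM f1 fZ] [fsurj fker]]]] := quotient_algebra idJ J1.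
have f0 : f 0 = 0 by rewrite -(scale0r 0) fZ scale0r.
have fsum I (r : seq I) (P : pred I) F : f (\sum_(x <- r | P x) F x) = \sum_(x <- r | P x) f (F x).
  exact: (big_morph f fD f0).
pose rho (g : Sinf) : Q := f << g >>.
have rhoM g h : rho (g * h)%g = rho g * rho h.
  by rewrite /rho -fM ga_mulU mulr1.
have rho1 : rho 1%g = 1 by exact: f1.
pose s j := rho (adj j).
have ss j : s j * s j = 1 by rewrite /s -rhoM adj_sqr rho1.
have s_braid j : s j * s j.+1 * s j = s j.+1 * s j * s j.+1.
  by rewrite /s -!rhoM adj_braid.
have s_comm j l : (j.+1 < l)%N -> s j * s l = s l * s j.
  by move=> jl; rewrite /s -!rhoM adj_comm.
have rho_fix (eps : k) n u : (forall j, (j < n.-1)%N -> s j * u = eps *: u) ->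
    eps = 1 \/ eps = -1 ->
    forall t : 'S_n, rho (Sn_incl t) * u = (if eps == 1 then 1 else (-1) ^+ t) *: u.
  move=> h eps1; apply: perm_adj_ind.
    by rewrite Sn_incl1 rho1 mul1r odd_perm1 if_same scale1r.
  move=> t a b e IH; rewrite Sn_inclM rhoM -mulrA IH -scalerAr (Sn_incl_adj e).
  have -> : rho (adj a) * u = eps *: u by apply: h; have := ltn_ord b; lia.
  have ab : a != b by rewrite -val_eqE /= e; lia.
  rewrite odd_mul_tperm ab scalerA signr_addb expr1.
  case: eqVneq => [->|ne]; first by rewrite mulr1.
  by case: eps1 ne => ->; rewrite ?eqxx // mulrC.
have fincl n (y : groupalg k 'S_n) : f (kSn_incl y) = \sum_t y@_t *: rho (Sn_incl t).
  rewrite /kSn_incl fsum; apply: eq_bigr => t _.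
  by rewrite /rho -fZ ga_scaleU mulr1.
have coef_sum n (F : 'S_n -> k) t : (\sum_(x : 'S_n) << F x *g x >>)@_t = F t.
  rewrite raddf_sum (bigD1 t) //= mcoeffUU big1 ?addr0 // => x xt.
  by rewrite mcoeffU (negbTE xt).
(* The symmetriser is 0 in Q and acts on u as (p + 1 - i)!, invertible because i > 1. In [alt0] the
   factor is (i + 1)!, invertible because i < p - 1. *)
have sym0 u : (forall j, (j < p - i)%N -> s j * u = 1 * u) -> u = 0.
  move=> h; have /fker := J_sym; rewrite fincl => /(congr1 (fun z => z * u)).
  rewrite mul0r mulr_suml (eq_bigr (fun=> u)) => [|t _].
    rewrite sumr_const card_Sn -scaler_nat => /eqP; rewrite scaler_eq0.
    by rewrite (negbTE (factf_neq0 _)) /=; [move/eqP | lia].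
  rewrite coef_sum scale1r (rho_fix 1) ?eqxx ?scale1r //; last by left.
  by move=> j jl; rewrite h ?mul1r ?scale1r //; lia.
have alt0 u : (forall j, (j < i)%N -> s j * u = (-1) * u) -> u = 0.
  move=> h; have /fker := J_skew; rewrite fincl => /(congr1 (fun z => z * u)).
  rewrite mul0r mulr_suml (eq_bigr (fun=> u)) => [|t _].
    rewrite sumr_const card_Sn -scaler_nat => /eqP; rewrite scaler_eq0.
    by rewrite (negbTE (factf_neq0 _)) /=; [move/eqP | lia].
  rewrite coef_sum -scalerAl (rho_fix (-1)); last by right.
    case: eqP => [e|_]; last by rewrite scalerA -expr2 sqrr_sign scale1r.
    by rewrite e expr1n !scale1r.
  by move=> j jl; rewrite h // mulN1r scaleN1r.
have sym_van := block_vanish ss s_braid s_comm (fun z => etrans (mul1r z) (esym (mulr1 z))) sym0.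
have alt_van := block_vanish ss s_braid s_comm (fun z => etrans (mulN1r z) (esym (mulrN1 z))) alt0.
(* Since [gen s n] is the span of S_(n+1), one level is given away here, which spares the case n =
   0. *)
have gen_rho n (t : 'S_n) : gen s n (rho (Sn_incl t)).
  move: t; apply: perm_adj_ind.
    by rewrite Sn_incl1 rho1; exact: gen1.
  move=> t a b e IH; rewrite Sn_inclM rhoM (Sn_incl_adj e).
  apply: (genM ss s_braid s_comm _ IH); apply: (gen_leq (m := a.+1)); first exact: ltn_ord.
  exact: gen_s.
move=> x Kx; apply/fker; have [n [_ /(_ n (leqnn n))[y yx]]] := kSinf_exhaust x.
have gx : gen s n (f x).
  rewrite -yx fincl; apply: (big_ind (gen s n)); [exact: gen0 | exact: genD|].
  move=> t _; rewrite -mulr_algl; apply: (genM ss s_braid s_comm) => //.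
  exact: gen_scalar.
apply: (ideal_trivial p_pr pk i_bnd ss s_braid s_comm _ _ (K := fun q => exists2 z, K z & f z = q)
  _ _ _ _ gx).
- move=> l u h; apply: (sym_van l) => j jb; rewrite mul1r; exact: h.
- move=> l u h; apply: (alt_van l) => j jb; rewrite mulN1r; exact: h.
- by exists 0.
- move=> _ _ [z Kz <-] [z' Kz' <-]; exists (z + z'); last exact: fD.
  by rewrite -[z']opprK; apply: (KB) => //; rewrite -[- z']sub0r; exact: KB.
- move=> u _ w [z Kz <-]; have [u' <-] := fsurj u; have [w' <-] := fsurj w.
  by exists (u' * z * w'); [exact: KM | rewrite !fM].
- move=> [z Kz e]; apply: K1; have /fker/JK K1z : f (1 - z) = 0.
    by rewrite fD -scaleN1r fZ e f1 scaleN1r subrr.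
  have -> : 1 = (1 - z) - (0 - z) :> kSinf by rewrite sub0r opprK subrK.
  by apply: (KB) => //; exact: KB.
by exists x.
Qed.

End SimpleQuotient.

(** * Restriction along injections and direct summands *)

Section Push.

Fact push_subproof m n (h : 'I_m -> 'I_n) (hI : injective h) (s : 'S_m) :
  injective (fun y => if [pick x | h x == y] is Some x then h (s x) else y).
Proof.
move=> y z; case: pickP => [x /eqP <-|ny]; case: pickP => [x' /eqP <-|nz] //.
- by move/hI/perm_inj ->.
- by move=> e; have := nz (s x); rewrite e eqxx.
by move=> e; have := ny (s x'); rewrite -e eqxx.
Qed.

(** Symmetric groups on arbitrary subsets of the points are all given by injections: the two factors
    of S_m x S_(i+1) as well as the stabiliser of a point. *)
Definition push m n (h : 'I_m -> 'I_n) (hI : injective h) (s : 'S_m) : 'S_n :=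
  perm (push_subproof hI (s := s)).

Section PushTheory.
Variables (m n : nat) (h : 'I_m -> 'I_n) (hI : injective h).
Implicit Types s t : 'S_m.

Lemma push_in s x : push hI s (h x) = h (s x).
Proof.
by rewrite permE; case: pickP => [x' /eqP/hI->|/(_ x)] //; rewrite eqxx.
Qed.

Lemma push_out s y : (forall x, h x != y) -> push hI s y = y.
Proof.
by move=> ny; rewrite permE; case: pickP => [x e|//]; move: (ny x); rewrite e.
Qed.

Lemma push_case y : (exists x, y = h x) \/ (forall x, h x != y).
Proof.
case: (pickP (fun x => h x == y)) => [x /eqP<-|ny]; first by left; exists x.
by right=> x; rewrite ny.
Qed.

Lemma push1 : push hI 1%g = 1%g.
Proof.
apply/permP => y; case: (push_case y) => [[x ->]|ny]; last by rewrite push_out ?perm1.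
by rewrite push_in !perm1.
Qed.

Lemma pushM s t : push hI (s * t)%g = (push hI s * push hI t)%g.
Proof.
apply/permP => y; rewrite permM; case: (push_case y) => [[x ->]|ny].
  by rewrite !push_in permM.
by rewrite !push_out // => x; rewrite push_out.
Qed.

Lemma push_tperm a b : push hI (tperm a b) = tperm (h a) (h b).
Proof.
apply/permP => y; case: (push_case y) => [[x ->]|ny].
  rewrite push_in; case: (tpermP a b x) => [->|->|xa xb]; rewrite ?tpermL ?tpermR //.
  by rewrite tpermD // (inj_eq hI) eq_sym; apply/eqP.
by rewrite push_out // tpermD.
Qed.

Lemma push_ext (h' : 'I_m -> 'I_n) (h'I : injective h') s : h =1 h' ->
  push hI s = push h'I s.
Proof.
move=> e; apply/permP => y; case: (push_case y) => [[x ->]|ny].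
  by rewrite push_in !e; rewrite permE; case: pickP => [x' /eqP/h'I->|/(_ x)] //; rewrite eqxx.
rewrite push_out // permE; case: pickP => // x /eqP exy.
by move: (ny x); rewrite e exy eqxx.
Qed.

Lemma push_conj (t : 'S_n) s :
  push (inj_comp (@perm_inj _ t) hI) s = (push hI s ^ t)%g.
Proof.
apply/permP => y; rewrite -[y](permKV t) permJ permE.
case: pickP => [x /eqP /perm_inj <-|ny]; first by rewrite /= push_in.
rewrite push_out // => x; apply/eqP => e.
by move: (ny x); rewrite /= e eqxx.
Qed.

End PushTheory.

Lemma push_comp m n l (h : 'I_m -> 'I_n) (hI : injective h) (g : 'I_n -> 'I_l)
    (gI : injective g) s :
  push gI (push hI s) = push (inj_comp gI hI) s.
Proof.
apply/permP => y; rewrite [RHS]permE; case: pickP => [x /eqP <-|ny].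
  by rewrite [(g \o h) x]/= !push_in.
case: (push_case g y) => [[z ez]|nz]; last by rewrite push_out.
rewrite ez push_in push_out // => x; apply/eqP => e.
by move: (ny x); rewrite /= e ez eqxx.
Qed.

Lemma push_lift n (s : 'S_n) :
  push (@lift_inj _ ord_max) s = lift_perm ord_max ord_max s.
Proof.
apply/permP => y; case: (unliftP ord_max y) => [x ->|->].
  by rewrite push_in lift_perm_lift.
by rewrite lift_perm_id push_out // => x; rewrite eq_sym neq_lift.
Qed.

Lemma push_disjoint m m' n (h : 'I_m -> 'I_n) (h' : 'I_m' -> 'I_n)
    (hI : injective h) (h'I : injective h') s t : (forall x y, h x != h' y) ->
  commute (push hI s) (push h'I t).
Proof.
move=> d; apply/permP => y; rewrite !permM.
have hn x z : h' z != h x by rewrite eq_sym.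
case: (push_case h y) => [[x ->]|ny].
  by rewrite push_in (push_out h'I _ (y := h x)) // push_in push_out.
rewrite (push_out hI _ ny); case: (push_case h' y) => [[z ->]|nz].
  by rewrite push_in push_out.
by rewrite (push_out h'I _ nz) push_out.
Qed.

Lemma perm_tperm_ind n (P : 'S_n -> Prop) : P 1%g ->
  (forall (s : 'S_n) a b, a != b -> P s -> P (tperm a b * s)%g) -> forall s, P s.
Proof.
by move=> P1 Pt; apply: perm_adj_ind => // s a b e; apply: Pt; rewrite -val_eqE /= e; lia.
Qed.

End Push.

Section Summands.
Variable k : closedFieldType.
Local Notation RepS n := (representation k [set: 'S_n]%G).

Definition equivariant n (M N : RepS n) (f : 'M_(rdegree M, rdegree N)) :=
  forall s, M s *m f = f *m N s.

Lemma rsim_summand n (D N : RepS n) : mx_rsim D N ->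
  exists f g, [/\ @equivariant n D N f, @equivariant n N D g, f *m g = 1%:M & g *m f = 1%:M].
Proof.
case=> B e Bfree hB; have /row_freeP[B' BB'] := Bfree.
have Bfull : row_full B by apply/eqP; rewrite (eqP Bfree).
have /row_fullP[B'' B''B] := Bfull.
have eB : B' = B'' by rewrite -[B'']mulmx1 -BB' mulmxA B''B mul1mx.
exists B, B'; rewrite {3}eB; split=> // s; first by apply: hB; rewrite inE.
rewrite -[LHS]mul1mx -{1}B''B -eB -!mulmxA; congr (_ *m _).
rewrite mulmxA -hB ?inE // -mulmxA BB' mulmx1 //.
Qed.

Lemma summandP n (M N : RepS n) : direct_summand M N <->
  exists f g, [/\ @equivariant n M N f, @equivariant n N M g & f *m g = 1%:M].
Proof.
split=> [[M' /rsim_summand[f [g [hf hg fg _]]]]|[f [g [hf hg fg]]]].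
  exists (usubmx f), (lsubmx g); split.
  - move=> s; have := hf s; rewrite -{1}(vsubmxK f) mul_block_col !mul0mx addr0.
    by move/(congr1 usubmx); rewrite col_mxKu -mul_usub_mx.
  - move=> s; have := hg s; rewrite -{2}(hsubmxK g) mul_row_block !mulmx0 addr0.
    by move/(congr1 lsubmx); rewrite row_mxKl -mulmx_lsub.
  have := fg; rewrite -{1}(vsubmxK f) -{1}(hsubmxK g) mul_col_row.
  by rewrite scalar_mx_block => /eq_block_mx[].
pose f' := row_base (kermx g).
have f'g : f' *m g = 0 by apply/sub_kermxP; rewrite eq_row_base.
have /row_freeP[q f'q] : row_free f' by exact: row_base_free.
have f'K r (z : 'M_(r, _)) : z *m g = 0 -> (z <= f')%MS.
  by move=> /sub_kermxP; rewrite eq_row_base.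
clearbody f'; have f'N s : f' *m N s = f' *m N s *m q *m f'.
  have /submxP[D e] : (f' *m N s <= f')%MS.
    by apply: f'K; rewrite -mulmxA hg mulmxA f'g mul0mx.
  by rewrite e -(mulmxA D) f'q mulmx1.
have M'_repr : mx_repr [set: 'S_n]%G (fun s => f' *m N s *m q).
  split=> [|s t _ _]; first by rewrite repr_mx1 mulmx1.
  by rewrite repr_mxM ?inE // !mulmxA -f'N.
exists (Representation (MxRepresentation M'_repr)).
have eqd : (rdegree M + \rank (kermx g))%N = rdegree N.
  have rg : \rank g = rdegree M.
    apply/eqP; rewrite eqn_leq rank_leq_col /=.
    by rewrite -[leqLHS](mxrank1 k) -fg mxrankM_maxr.
  by rewrite mxrank_ker rg subnKC // -rg rank_leq_row.
exists (col_mx f f') => //.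
  apply/inj_row_free => w; rewrite -[w]hsubmxK mul_row_col => e.
  have l0 : lsubmx w = 0.
    move: (congr1 (mulmx^~ g) e); rewrite mulmxDl -!mulmxA fg f'g mulmx1 mulmx0 addr0.
    by rewrite mul0mx.
  move: e; rewrite l0 mul0mx add0r => /(congr1 (mulmx^~ q)).
  by rewrite -mulmxA f'q mulmx1 mul0mx => ->; rewrite row_mx0.
move=> s _; rewrite mul_block_col !mul0mx addr0 add0r mul_col_mx hf.
by congr (col_mx _ _); rewrite [RHS]f'N.
Qed.

Lemma summand_refl n (M : RepS n) : direct_summand M M.
Proof.
by apply/summandP; exists 1%:M, 1%:M; split=> [s|s|]; rewrite ?mulmx1 ?mul1mx.
Qed.

Lemma summand_trans n (L M N : RepS n) :
  direct_summand L M -> direct_summand M N -> direct_summand L N.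
Proof.
move=> /summandP[f [g [hf hg fg]]] /summandP[f' [g' [hf' hg' fg']]].
apply/summandP; exists (f *m f'), (g' *m g); split=> [s|s|].
- by rewrite mulmxA hf -mulmxA hf' mulmxA.
- by rewrite mulmxA hg' -mulmxA hg mulmxA.
by rewrite mulmxA -(mulmxA f) fg' mulmx1.
Qed.

Lemma summand_dadd n (M N M' N' : RepS n) : direct_summand M M' -> direct_summand N N' ->
  direct_summand (dadd_grepr M N) (dadd_grepr M' N').
Proof.
move=> /summandP[f [g [hf hg fg]]] /summandP[f' [g' [hf' hg' fg']]].
apply/summandP; exists (block_mx f 0 0 f'), (block_mx g 0 0 g').
by split=> [s|s|]; rewrite !mulmx_block !(mulmx0, mul0mx, addr0, add0r)
  ?hf ?hf' ?hg ?hg' // fg fg' -scalar_mx_block.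
Qed.

Lemma split_idempotent n (N : RepS n) e : e *m e = e -> @equivariant n N N e ->
  exists (M : RepS n) f g, [/\ @equivariant n M N f, @equivariant n N M g,
    f *m g = 1%:M & g *m f = e].
Proof.
move=> ee he; pose f := row_base e; pose g := col_base e.
have gf : g *m f = e by exact: mulmx_base.
have fg : f *m g = 1%:M.
  apply: (row_free_inj (row_base_free e)); apply: (row_full_inj (col_base_full e)).
  by rewrite -/f -/g mul1mx gf -(mulmxA f) gf mulmxA gf ee.
clearbody f g; have fe : f *m e = f by rewrite -[X in f *m X]gf mulmxA fg mul1mx.
have eg : e *m g = g by rewrite -[X in X *m g]gf -mulmxA fg mulmx1.
have M_repr : mx_repr [set: 'S_n]%G (fun s => f *m N s *m g).
  split=> [|s t _ _]; first by rewrite repr_mx1 mulmx1.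
  rewrite repr_mxM ?inE // !mulmxA -(mulmxA _ g) gf -!mulmxA; congr (_ *m _).
  by rewrite (mulmxA e) -he -(mulmxA (N t)) eg.
exists (Representation (MxRepresentation M_repr)), f, g; split=> // s /=.
  by rewrite -!mulmxA gf he mulmxA fe.
by rewrite !mulmxA gf -he -mulmxA eg.
Qed.

Section Semisimple.
Variables (n : nat) (M : RepS n).
Hypothesis ssM : semisimple M.

Lemma semisimple_complement d (U : 'M_(d, rdegree M)) :
  (forall s, U *m M s <= U)%MS ->
  exists d' (W : 'M_(d', rdegree M)) a b, [/\ forall s, (W *m M s <= W)%MS,
    a *m U + b *m W = 1%:M &
    forall r (z : 'M_(r, rdegree M)), (z <= U)%MS -> (z <= W)%MS -> z = 0].
Proof.
case: ssM => /mxsemisimple_reducible red hU.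
have modU : mxmodule M <<U>>%MS.
  by rewrite (eqmx_module M (genmxE U)); apply/mxmoduleP => s _; exact: hU.
have [W modW eUW /mxdirect_addsP dUW] := red <<U>>%MS modU (submx1 _).
have /sub_addsmxP[[a b] /= e] : (1%:M <= U + W)%MS.
  by rewrite -(adds_eqmx (genmxE U) (eqmx_refl W)) eUW.
exists _, W, a, b; split=> [s||r z zU zW]; last 1 first.
- by apply/eqP; rewrite -submx0 -dUW sub_capmx genmxE zU.
- by move/mxmoduleP: modW; apply; rewrite inE.
by rewrite -e.
Qed.

(** The retraction is the coordinate a along an invariant vector u in 1 = a u + b W. The defects of
    equivariance and of normalisation lie both in the line of u and in the invariant complement W,
    so they vanish. *)
Lemma fixed_triv_summand r (v : 'M_(r, rdegree M)) : (forall s, v *m M s = v) -> v != 0 ->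
  direct_summand (triv k n) M.
Proof.
move=> hv v0; have [i vi0] : exists i, row i v != 0.
  apply: contrapT => none; case/eqP: v0; apply/row_matrixP => i.
  by rewrite row0; apply/eqP; apply: contrapT => /negP nz; apply: none; exists i.
pose u := row i v; have hu s : u *m M s = u by rewrite -row_mul hv.
have [|d' [W [a [b [hW e dUW]]]]] := semisimple_complement (U := u).
  by move=> s; rewrite hu.
have u_inj d (c : 'M_(d, 1)) : c *m u = 0 -> c = 0.
  move=> cu; apply/matrixP => j l; rewrite ord1 mxE.
  have /rV0Pn[l' ul'] := vi0.
  move/matrixP/(_ j l'): cu; rewrite !mxE big_ord1 => /eqP.
  by rewrite mulf_eq0 (negbTE ul') orbF => /eqP.
apply/summandP; exists u, a; split=> [s|s|].
- by rewrite mul1mx hu.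
- rewrite mulmx1; apply/eqP; rewrite -subr_eq0; apply/eqP/u_inj.
  apply: dUW; first exact: submxMl.
  have -> : (M s *m a - a) *m u = b *m (W *m M s) - M s *m b *m W.
    have e1 : M s = M s *m (a *m u + b *m W) by rewrite e mulmx1.
    have e2 : M s = (a *m u + b *m W) *m M s by rewrite e mul1mx.
    have := e1; rewrite {1}e2 mulmxDl mulmxDr -!mulmxA hu => e3.
    rewrite mulmxBl -!mulmxA; apply/eqP; rewrite subr_eq addrAC -subr_eq opprK.
    by rewrite -e3 addrC.
  by rewrite addmx_sub ?eqmx_opp ?submxMl // (submx_trans (submxMl _ _)).
apply/eqP; rewrite -subr_eq0; apply/eqP/u_inj; apply: dUW; first exact: submxMl.
have -> : (u *m a - 1%:M) *m u = - (u *m b *m W).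
  have e1 : u = u *m a *m u + u *m b *m W by rewrite -!mulmxA -mulmxDr e mulmx1.
  by rewrite mulmxBl mul1mx [X in _ - X]e1 opprD addrA subrr add0r.
by rewrite eqmx_opp submxMl.
Qed.

(** The kernel of T is a submodule, and T preserves an invariant complement of it; the vector v T
    lies in both. *)
Lemma central_nilpotent r (v : 'M_(r, rdegree M)) (T : 'M_(rdegree M)) :
  (forall d (W : 'M_(d, rdegree M)), (forall s, W *m M s <= W)%MS -> (W *m T <= W)%MS) ->
  (forall s, T *m M s = M s *m T) -> v *m T *m T = 0 -> v *m T = 0.
Proof.
move=> stT hT vTT.
have [s|d' [W [a [b [hW e dUW]]]]] := semisimple_complement (U := kermx T).
  by apply/sub_kermxP; rewrite -mulmxA -hT mulmxA mulmx_ker mul0mx.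
have WT : (W *m T <= W)%MS by exact: stT.
have vT : v *m T = v *m b *m (W *m T).
  have e1 : v = v *m a *m kermx T + v *m b *m W by rewrite -!mulmxA -mulmxDr e mulmx1.
  by rewrite [X in X *m T]e1 mulmxDl -mulmxA mulmx_ker mulmx0 add0r -!mulmxA.
rewrite vT; apply: dUW; last by rewrite (submx_trans (submxMl _ _)).
by apply/sub_kermxP; rewrite -vT.
Qed.

End Semisimple.

End Summands.

(** * Inductive systems *)

Section Systems.
Variable k : closedFieldType.
Local Notation RepS n := (representation k [set: 'S_n]%G).

Fact res_along_repr m n (h : 'I_m -> 'I_n) (hI : injective h) (N : RepS n) :
  mx_repr [set: 'S_m]%G (fun s => N (push hI s)).
Proof.
by split=> [|s t _ _]; rewrite ?push1 ?repr_mx1 // pushM repr_mxM ?inE.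
Qed.

Definition res_along m n (h : 'I_m -> 'I_n) (hI : injective h) (N : RepS n) : RepS m :=
  Representation (MxRepresentation (res_along_repr hI N)).

(** Restriction commutes with direct sums, so one layer of summands of restrictions is already
    pseudo-abelian. *)
Lemma smallest_Res n (C : set (RepS n.+1)) : C grepr0 ->
  (forall M N, C M -> C N -> C (dadd_grepr M N)) ->
  smallest (@pseudo_abelian k n) (@Res k n @` C) =
    [set M | exists2 N, C N & direct_summand M (Res N)].
Proof.
move=> C0 CD; apply/seteqP; split=> [M|M [N CN MN]].
  apply: smallest_sub; last by move=> _ [N CN <-]; exists N => //; exact: summand_refl.
  split=> [|M1 M2 [N1 C1 h1] [N2 C2 h2]|M1 M2 h12 [N2 C2 h2]].
  - exists grepr0 => //; apply/summandP; exists 0, 0.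
    by split=> [s|s|]; apply/matrixP; case.
  - exists (dadd_grepr N1 N2); first exact: CD.
    have /summandP[f [g [hf hg fg]]] := summand_dadd h1 h2.
    by apply/summandP; exists f, g.
  - by exists N2 => //; exact: summand_trans h12 h2.
move=> P [[P0 PD PS] PC]; apply: (PS _ _ MN); apply: PC; by exists N.
Qed.

Section OneSystem.
Variable A : Rep_family k.
Arguments A : clear implicits.
Hypothesis indA : inductive_system A.

Lemma system0 n : (0 < n)%N -> A n grepr0.
Proof. by move=> n0; have [[]] := indA n0. Qed.

Lemma systemD n M N : (0 < n)%N -> A n M -> A n N -> A n (dadd_grepr M N).
Proof. by move=> n0; have [[_ AD _] _] := indA n0; exact: AD. Qed.

Lemma system_summand n M N : (0 < n)%N -> direct_summand M N -> A n N -> A n M.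
Proof. by move=> n0; have [[_ _ AS] _] := indA n0; exact: AS. Qed.

Lemma systemE n M : (0 < n)%N ->
  A n M <-> exists2 N, A n.+1 N & direct_summand M (Res N).
Proof.
move=> n0; have [_ eA] := indA n0; rewrite [in X in X <-> _]eA smallest_Res //.
  exact: system0.
by move=> M1 M2; exact: systemD.
Qed.

Lemma system_Res n N : (0 < n)%N -> A n.+1 N -> A n (Res N).
Proof. by move=> n0 AN; apply/systemE => //; exists N => //; exact: summand_refl. Qed.

(** Following h by a permutation gives an isomorphic module. So h may be taken to be the identity,
    or to miss the last point and factor through [Res]. *)
Lemma system_res_along m n (h : 'I_m -> 'I_n) (hI : injective h) (N : RepS n) :
  (0 < m)%N -> A n N -> A m (res_along hI N).
Proof.
move=> m0; elim: n h hI N => [|n IH] h hI N AN.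
  by have := leq_card h hI; rewrite !card_ord leqNgt m0.
have conj_summand (t : 'S_n.+1) :
    direct_summand (res_along hI N) (res_along (inj_comp (@perm_inj _ t) hI) N).
  apply/summandP; exists (N t), (N t^-1%g); split=> [s|s|] /=.
  - by rewrite push_conj -!repr_mxM ?inE // conjgC.
  - by rewrite push_conj -!repr_mxM ?inE // conjgE -!mulgA mulgV mulg1.
  - by rewrite -repr_mxM ?inE // mulgV repr_mx1.
have [e|ne] := eqVneq m n.+1.
  subst m.
  pose t := perm hI; have ht : (t^-1)%g \o h =1 id by move=> x; rewrite /= -[h x](permE hI) permK.
  apply: system_summand (conj_summand t^-1%g) _ => //.
  apply: system_summand AN => //; apply/summandP; exists 1%:M, 1%:M.
  have e s : push (inj_comp (@perm_inj _ (t^-1)%g) hI) s = s.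
    by apply/permP => y; rewrite -{1}[y]ht push_in; exact: ht.
  by split=> [s|s|] /=; rewrite ?e ?mulmx1 ?mul1mx.
have [y hy] : exists y, forall x, h x != y.
  apply: contrapT => none; case/negP: ne; rewrite eqn_leq; apply/andP; split.
    by have := leq_card h hI; rewrite !card_ord.
  have sur y : exists x, h x = y.
    apply: contrapT => ny; apply: none; exists y => x; apply/eqP => e; apply: ny; by exists x.
  rewrite -[leqLHS]card_ord -[leqRHS]card_ord -(card_codom hI).
  apply/subset_leq_card/fintype.subsetP => z _; have [x <-] := sur z; exact: codom_f.
pose t := tperm y ord_max; pose h' := t \o h.
have h'max x : h' x != ord_max.
  rewrite /h' /= -[ord_max](tpermL y) (inj_eq perm_inj); exact: hy.
have h'E x : exists z, lift ord_max z = h' x.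
  by case: (unliftP ord_max (h' x)) (h'max x) => [z -> _|->]; [exists z | rewrite eqxx].
have [h2 h2E] := boolp.choice h'E.
have h2I : injective h2.
  move=> x x' e; apply: (hI); apply: (@perm_inj _ t).
  by rewrite -[LHS]/(h' x) -[RHS]/(h' x') -!h2E e.
apply: system_summand (conj_summand t) _ => //.
have n0 : (0 < n)%N by have := leq_card _ h2I; rewrite !card_ord; exact: leq_trans.
apply: system_summand (IH _ h2I _ (system_Res n0 AN)) => //.
apply/summandP; exists 1%:M, 1%:M.
have e s : push (inj_comp (@perm_inj _ t) hI) s = lift_perm ord_max ord_max (push h2I s).
  by rewrite -push_lift push_comp; apply: push_ext => x; rewrite /= h2E.
by split=> [s|s|] /=; rewrite ?e ?mulmx1 ?mul1mx.
Qed.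

Section FixedFamily.
Variable m : nat.
Hypotheses (m0 : (0 < m)%N) (mfact : (m`!)%:R != 0 :> k).

Fact shift_ord_subproof n (x : 'I_n) : (x + m < n + m)%N.
Proof. by rewrite ltn_add2r. Qed.

Definition shift_ord n (x : 'I_n) : 'I_(n + m) := Ordinal (shift_ord_subproof x).

Lemma shift_ord_inj n : injective (@shift_ord n).
Proof. by move=> x y /(congr1 val) /= /addIn e; apply: val_inj. Qed.

Definition first_ord n : 'I_m -> 'I_(n + m) := widen_ord (leq_addl n m).

Lemma first_ord_inj n : injective (@first_ord n).
Proof. by move=> x y /(congr1 val) /= e; apply: val_inj. Qed.

Lemma first_shift n x y : first_ord n x != shift_ord y.
Proof. by rewrite -val_eqE /= neq_ltn (leq_trans (ltn_ord x)) ?leq_addl. Qed.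

Lemma lift_shift n (s : 'S_n) :
  lift_perm ord_max ord_max (push (@shift_ord_inj n) s) =
  push (@shift_ord_inj n.+1) (lift_perm ord_max ord_max s).
Proof.
rewrite -!push_lift !push_comp; apply: push_ext => x; apply: ord_inj.
rewrite [in LHS]/comp lift_max [in RHS]/comp.
transitivity (x + m)%N; first by [].
by congr (_ + _)%N; rewrite lift_max.
Qed.

Lemma lift_first n (t : 'S_m) :
  lift_perm ord_max ord_max (push (@first_ord_inj n) t) = push (@first_ord_inj n.+1) t.
Proof.
rewrite -!push_lift push_comp; apply: push_ext => x; apply: ord_inj.
by rewrite [in LHS]/comp lift_max.
Qed.

(* The multiplicity spaces of the trivial S_m-module in the systems A (n + m). *)
Definition fixed_family : Rep_family k := fun n => [set M : RepS n |
  exists (N : RepS (n + m)) (f : 'M_(rdegree M, rdegree N)) g,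
    [/\ A (n + m) N, equivariant (N := res_along (@shift_ord_inj n) N) f,
        equivariant (M := res_along (@shift_ord_inj n) N) g, f *m g = 1%:M
      & forall t : 'S_m, f *m N (push (@first_ord_inj n) t) = f]].

Arguments fixed_family : clear implicits.

Lemma fixed_pseudo_abelian n : (0 < n)%N -> pseudo_abelian (fixed_family n).
Proof.
move=> n0; have nm0 : (0 < n + m)%N by rewrite addn_gt0 n0.
split.
- exists grepr0, 0, 0; split; first exact: system0.
  + by move=> s; apply/matrixP; case.
  + by move=> s; apply/matrixP; case.
  + by apply/matrixP; case.
  + by move=> t; apply/matrixP; case.
- move=> M1 M2 [N1 [f1 [g1 [A1 hf1 hg1 e1 t1]]]] [N2 [f2 [g2 [A2 hf2 hg2 e2 t2]]]].
  exists (dadd_grepr N1 N2), (block_mx f1 0 0 f2), (block_mx g1 0 0 g2); split.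
  + exact: systemD.
  + by move=> s; rewrite !mulmx_block !(mulmx0, mul0mx, addr0, add0r) hf1 hf2.
  + by move=> s; rewrite !mulmx_block !(mulmx0, mul0mx, addr0, add0r) hg1 hg2.
  + by rewrite mulmx_block !(mulmx0, mul0mx, addr0, add0r) e1 e2 -scalar_mx_block.
  + by move=> t; rewrite mulmx_block !(mulmx0, mul0mx, addr0, add0r) t1 t2.
move=> M M1 /summandP[f [g [hf hg fg]]] [N1 [f1 [g1 [A1 hf1 hg1 e1 t1]]]].
exists N1, (f *m f1), (g1 *m g); split=> //.
- by move=> s; rewrite mulmxA hf -mulmxA hf1 mulmxA.
- by move=> s; rewrite mulmxA hg1 -mulmxA hg mulmxA.
- by rewrite mulmxA -(mulmxA f) e1 mulmx1.
- by move=> t; rewrite -mulmxA t1.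
Qed.

(** Averaging over S_m, possible as m! is invertible, is a projection onto the invariants that
    commutes with S_n on the other points. The last clause says that all the invariants are split
    off. *)
Lemma fixed_split n (N : RepS (n + m)) : exists (M : RepS n) f g,
  [/\ equivariant (M := M) (N := res_along (@shift_ord_inj n) N) f,
      equivariant (M := res_along (@shift_ord_inj n) N) (N := M) g, f *m g = 1%:M,
      forall t : 'S_m, f *m N (push (@first_ord_inj n) t) = f
    & forall r (v : 'M_(r, rdegree N)),
        (forall t : 'S_m, v *m N (push (@first_ord_inj n) t) = v) -> v *m g *m f = v].
Proof.
pose e := (m`!)%:R^-1 *: \sum_(t : 'S_m) N (push (@first_ord_inj n) t).
have eN t : e *m N (push (@first_ord_inj n) t) = e.
  rewrite /e -scalemxAl mulmx_suml; congr (_ *: _).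
  rewrite [RHS](reindex_inj (mulIg t)) /=; apply: eq_bigr => u _.
  by rewrite pushM repr_mxM ?inE.
have ve r (v : 'M_(r, rdegree N)) :
    (forall t : 'S_m, v *m N (push (@first_ord_inj n) t) = v) -> v *m e = v.
  move=> hv; rewrite /e -scalemxAr mulmx_sumr (eq_bigr (fun=> v)) //.
  by rewrite sumr_const card_Sn -scaler_nat scalerA mulVf ?scale1r.
have ee : e *m e = e by exact: ve.
have he : equivariant (M := res_along (@shift_ord_inj n) N)
    (N := res_along (@shift_ord_inj n) N) e.
  move=> s /=; rewrite /e -scalemxAl -scalemxAr mulmx_suml mulmx_sumr; congr (_ *: _).
  apply: eq_bigr => t _; rewrite -!repr_mxM ?inE //; congr (N _).
  by apply: push_disjoint => x y; rewrite eq_sym first_shift.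
have [M [f [g [hf hg fg gf]]]]  :=
  split_idempotent (N := res_along (@shift_ord_inj n) N) ee he.
exists M, f, g; split=> // [t|r v hv]; last by rewrite -mulmxA gf ve.
have fe : f = f *m e by rewrite -gf mulmxA fg mul1mx.
by rewrite [in LHS]fe -mulmxA eN -fe.
Qed.

Lemma fixed_inductive : inductive_system fixed_family.
Proof.
move=> n n0; have pa j : (0 < j)%N -> pseudo_abelian (fixed_family j).
  exact: fixed_pseudo_abelian.
split; first exact: pa.
have [C0 CD _] := pa n.+1 isT; rewrite smallest_Res //.
have nm0 : (0 < n + m)%N by rewrite addn_gt0 n0.
apply/seteqP; split=> [M [N [f [g [AN hf hg fg ft]]]]|M [M' [N [f [g [AN hf hg fg ft]]]] MM']].
  have [N' AN' /summandP[u [v [hu hv uv]]]] := (systemE N nm0).1 AN.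
  have [M' [f' [g' [hf' hg' fg' ft' vgf]]]] := fixed_split (n := n.+1) N'.
  exists M'.
    by exists N', f', g'; split.
  apply/summandP; exists (f *m u *m g'), (f' *m v *m g).
  (* The image of f in N' is S_m-invariant, so nothing is lost by passing through the invariants M'
     of N'. *)
  have fu : f *m u *m g' *m f' = f *m u.
    apply: vgf => t; rewrite -lift_first -mulmxA.
    by rewrite -[u *m _](hu (push (@first_ord_inj n) t)) mulmxA ft.
  split=> [s|s|].
  - rewrite !mulmxA hf -!mulmxA; congr (_ *m _).
    rewrite mulmxA hu -!mulmxA; congr (_ *m _).
    by rewrite /= lift_shift; exact: hg'.
  - rewrite !mulmxA [X in X *m _ *m _](hf' (lift_perm ord_max ord_max s)) -!mulmxA.
    congr (_ *m _); rewrite /= -lift_shift mulmxA.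
    by rewrite [X in X *m _](hv (push (@shift_ord_inj n) s)) -!mulmxA hg.
  - by rewrite !mulmxA fu -(mulmxA f) uv mulmx1.
have [_ _ CS] := pa n n0; apply: (CS _ _ MM').
exists (Res N), f, g; split=> //; first exact: system_Res.
- by move=> s; rewrite /= lift_shift; exact: hf.
- by move=> s; rewrite /= lift_shift; exact: hg.
- by move=> t; rewrite /= lift_first; exact: ft.
Qed.

Lemma fixed_sub n : (0 < n)%N -> fixed_family n `<=` A n.
Proof.
move=> n0 M [N [f [g [AN hf hg fg _]]]].
apply: system_summand (system_res_along (@shift_ord_inj n) n0 AN) => //.
by apply/summandP; exists f, g.
Qed.

(** The family is meaningful from n = 1 on, so the trivial S_m-module is found in the restriction of
    some N in A (m + 1). *)
Lemma fixed_nonzero : A m (triv k m) -> nonzero_family fixed_family.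
Proof.
move=> At; have [N AN /summandP[u [v [hu hv uv]]]] := (systemE (triv k m) m0).1 At.
have [M [f [g [hf hg fg ft vgf]]]] := fixed_split (n := 1) N.
exists 1%N, M; split=> //; first by exists N, f, g.
rewrite lt0n; apply/eqP => M0.
have uu : u *m g *m f = u.
  apply: vgf => t; have -> : push (@first_ord_inj 1) t = lift_perm ord_max ord_max t.
    by rewrite -push_lift; apply: push_ext => x; apply: ord_inj; rewrite lift_max.
  by rewrite -[LHS](hu t) mul1mx.
have ug0 : u *m g = 0 by apply/matrixP => x [j jM]; exfalso; move: jM; rewrite M0.
move: uu; rewrite ug0 mul0mx => u0; move: uv; rewrite -u0 mul0mx => /matrixP/(_ 0 0).
by rewrite !mxE eqxx => /eqP; rewrite eq_sym oner_eq0.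
Qed.

End FixedFamily.

End OneSystem.
End Systems.

(** * Exclusion of hooks *)

Section Hook.
Variables (k : closedFieldType) (p i m : nat).
Hypotheses (pk : p \in [pchar k]) (p2 : (2 < p)%N) (eim : (m + i)%N = p) (ip : (i.+1 < p)%N)
  (m0 : (0 < m)%N).
Local Notation RepS n := (representation k [set: 'S_n]%G).
Variable A : Rep_family k.
Arguments A : clear implicits.
Hypotheses (indA : inductive_system A)
  (ssA : forall n (M : RepS n), (0 < n)%N -> A n M -> semisimple M)
  (notriv : ~ A m.+1 (triv k m.+1)).
Local Notation fo := (first_ord i.+1).
Local Notation sh := (@shift_ord m i.+1).

Lemma sum_first_shift (V : zmodType) (F : 'I_(i.+1 + m) -> V) :
  \sum_z F z = \sum_c F (fo c) + \sum_a F (sh a).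
Proof.
rewrite (bigID (fun z : 'I__ => z < m)%N) /=; congr (_ + _).
  by rewrite (big_ord_narrow (leq_addl i.+1 m)).
rewrite (reindex_onto sh (fun z => inord (z - m))) /=.
  apply: eq_bigl => a; rewrite -leqNgt leq_addl /=; apply/eqP.
  by apply: ord_inj; rewrite addnK inord_val.
move=> z; rewrite -leqNgt => mz; apply: val_inj; rewrite /= inordK ?subnK //.
by have := ltn_ord z; lia.
Qed.

(** The p + 1 points are m first ones, on which v has trivial type, and i + 1 shifted ones, on which
    it has sign type. The r rows treat several vectors at once. *)
Variables (N : RepS (i.+1 + m)) (r : nat) (v : 'M[k]_(r, rdegree N)).
Hypotheses (AN : A (i.+1 + m) N)
  (v_first : forall t : 'S_m, v *m N (push (@first_ord_inj m i.+1) t) = v)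
  (v_shift : forall a b, a != b -> v *m N (tperm (sh a) (sh b)) = - v).
Local Notation tau x y := (N (tperm x y)).

Lemma tau_xx x : tau x x = 1%:M.
Proof. by rewrite tperm1 repr_mx1. Qed.

Lemma tauC x y : tau x y = tau y x.
Proof. by rewrite tpermC. Qed.

Lemma tau_sqr x y : tau x y *m tau x y = 1%:M.
Proof. by rewrite -repr_mxM ?inE // tperm2 repr_mx1. Qed.

Lemma tau_conj x y s : tau x y *m N s = N s *m tau (s x) (s y).
Proof. by rewrite -!repr_mxM ?inE // -tpermJ conjgC. Qed.

Lemma tau_conj3 x y z : x != y -> x != z -> y != z ->
  tau x y *m tau x z = tau x z *m tau z y.
Proof. by move=> xy xz yz; rewrite tau_conj tpermL tpermD // eq_sym. Qed.

Lemma v_fo c d : v *m tau (fo c) (fo d) = v.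
Proof. by rewrite -(push_tperm (@first_ord_inj m i.+1)) v_first. Qed.

Lemma fo_sh c a : fo c != sh a. Proof. exact: first_shift. Qed.

(** Together with v, the sum symmetrises v over the first points and [sh a]. It is then invariant
    under an S_(m+1), and a non-zero invariant would split off a trivial module at level m + 1. *)
Lemma v_sum_fo a : \sum_c v *m tau (fo c) (sh a) = - v.
Proof.
pose h (c : 'I_m.+1) := if unlift ord_max c is Some c' then fo c' else sh a.
have h_lift c : h (lift ord_max c) = fo c by rewrite /h liftK.
have h_max : h ord_max = sh a by rewrite /h unlift_none.
have hI : injective h.
  move=> c d; case: (unliftP ord_max c) => [c' ->|->]; case: (unliftP ord_max d) => [d' ->|->] //.
  - by rewrite !h_lift => /first_ord_inj ->.
  - by rewrite h_lift h_max => e; have := fo_sh c' a; rewrite e eqxx.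
  - by rewrite h_lift h_max => e; have := fo_sh d' a; rewrite e eqxx.
pose w := \sum_c v *m tau (h c) (sh a).
(* A transposition of the m + 1 points permutes the terms of w; the term at [ord_max] is v
   itself. *)
have key b c d : b != ord_max -> c != b -> v *m tau (h d) (sh a) *m tau (h b) (h c) =
    v *m tau (h (tperm b c d)) (sh a).
  case: (unliftP ord_max b) => [b' ->|->]; last by rewrite eqxx.
  move=> _ cb; rewrite h_lift.
  case: (unliftP ord_max c) cb => [c' ->|->] cb.
    rewrite h_lift -mulmxA tau_conj mulmxA v_fo -!h_lift -(push_tperm hI) push_in.
    by rewrite (push_tperm hI) !h_lift [tperm (fo b') _ _]tpermD ?fo_sh.
  rewrite h_max; case: (tpermP (lift ord_max b') ord_max d) => [->|->|].
  - by rewrite h_lift h_max -mulmxA tau_sqr tau_xx.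
  - by rewrite h_lift h_max tau_xx mulmx1.
  case: (unliftP ord_max d) => [d' ->|->] // db _; rewrite h_lift.
  have db' : d' != b' by apply/eqP => e; apply: db; rewrite e.
  have nfo : fo d' != fo b' by rewrite (inj_eq (@first_ord_inj _ _)).
  have fs c' : sh a != fo c' by rewrite eq_sym fo_sh.
  rewrite -mulmxA (tauC (fo d')) (tauC (fo b')) tau_conj3 // tau_conj mulmxA v_fo.
  by rewrite tpermL tpermD // eq_sym.
have w_fixed s : w *m N (push hI s) = w.
  elim/perm_tperm_ind: s => [|s b c bc IH]; first by rewrite push1 repr_mx1 mulmx1.
  rewrite pushM repr_mxM ?inE // mulmxA; suff -> : w *m N (push hI (tperm b c)) = w by [].
  wlog bmax : b c bc / b != ord_max.
    move=> H; have [eb|nb] := eqVneq b ord_max; last exact: H.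
    by rewrite tpermC; apply: H; rewrite 1?eq_sym // -eb.
  rewrite push_tperm mulmx_suml [RHS](reindex_inj (@perm_inj _ (tperm b c))) /=.
  by apply: eq_bigr => d _; apply: key; rewrite // eq_sym.
have w0 : w = 0.
  apply: contrapT => /eqP w0; apply: notriv.
  have AM := system_res_along indA hI (ltn0Sn m) AN.
  apply: (system_summand indA _ _ AM) => //.
  by apply: (fixed_triv_summand (ssA _ AM) _ w0).
move: w0; rewrite /w (bigD1_ord ord_max) //= h_max tau_xx mulmx1.
under eq_bigr do rewrite h_lift.
by move=> /eqP; rewrite addrC addr_eq0 => /eqP.
Qed.

Let i1_neq0 : i.+1%:R != 0 :> k.
Proof. by rewrite -(dvdn_pcharf pk) gtnNdvd. Qed.

Let m_eq : m%:R = - i%:R :> k.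
Proof. by apply/eqP; rewrite -addr_eq0 -natrD eim (pcharf0 pk). Qed.

Let two_ne0 : 2%:R != 0 :> k.
Proof. by rewrite -(dvdn_pcharf pk) gtnNdvd. Qed.

(** The term z' = z is the identity, so [tau_all] is twice the class sum of the transpositions plus
    the number of points. *)
Definition tau_sum z := \sum_z' tau z z'.
Definition tau_all := \sum_z tau_sum z.

Lemma v_tau_sum_fo c : v *m tau_sum (fo c) =
  m%:R *: v + \sum_a v *m tau (fo c) (sh a).
Proof.
rewrite mulmx_sumr sum_first_shift; congr (_ + _).
by rewrite (eq_bigr (fun=> v)) ?sumr_const ?card_ord ?scaler_nat // => d _; exact: v_fo.
Qed.

Lemma v_tau_sum_sh a : v *m tau_sum (sh a) = - (i%:R *: v).
Proof.
rewrite mulmx_sumr sum_first_shift.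
under eq_bigr do rewrite tauC; rewrite v_sum_fo (bigD1_ord a) //= tau_xx mulmx1.
rewrite addrA addNr add0r (eq_bigr (fun=> - v)) => [|b _].
  by rewrite sumr_const card_ord mulNrn scaler_nat.
by rewrite v_shift // neq_lift.
Qed.

Lemma v_sum_all : \sum_c \sum_a v *m tau (fo c) (sh a) = - (i.+1%:R *: v).
Proof.
rewrite exchange_big /= (eq_bigr (fun=> - v)) => [|a _]; last exact: v_sum_fo.
by rewrite sumr_const card_ord mulNrn scaler_nat.
Qed.

Lemma v_tau_all : v *m tau_all = - ((i%:R + i.+1%:R) *: v).
Proof.
rewrite mulmx_sumr sum_first_shift.
under eq_bigr do rewrite v_tau_sum_fo.
rewrite big_split /= v_sum_all sumr_const card_ord -scaler_nat scalerA.
under eq_bigr do rewrite v_tau_sum_sh.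
rewrite sumr_const card_ord -scaler_nat scalerN scalerA -!scaleNr -!scalerDl m_eq.
by congr (_ *: _); rewrite -natr1; ring.
Qed.

Lemma tau_all_central s : tau_all *m N s = N s *m tau_all.
Proof.
rewrite mulmx_suml mulmx_sumr [RHS](reindex_inj (@perm_inj _ s)) /=.
apply: eq_bigr => z _; rewrite mulmx_suml mulmx_sumr [RHS](reindex_inj (@perm_inj _ s)) /=.
by apply: eq_bigr => z' _; exact: tau_conj.
Qed.

Section Point.
Variable c0 : 'I_m.
Local Notation x1 := (fo c0).

Definition hook_q := \sum_a v *m tau x1 (sh a).

Lemma q_fo c : hook_q *m tau x1 (fo c) = \sum_a v *m tau (fo c) (sh a).
Proof.
rewrite mulmx_suml; apply: eq_bigr => a _; rewrite -mulmxA.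
have [->|ne] := eqVneq c c0; first by rewrite tau_xx mulmx1.
rewrite tau_conj3 ?fo_sh //; first by rewrite mulmxA v_fo.
  by rewrite (inj_eq (@first_ord_inj _ _)) eq_sym.
by rewrite eq_sym fo_sh.
Qed.

Lemma q_sh a : hook_q *m tau x1 (sh a) = v - hook_q + v *m tau x1 (sh a).
Proof.
rewrite /hook_q (bigD1_ord a) //= mulmxDl -mulmxA tau_sqr mulmx1 opprD addrA addrAC subrK.
congr (_ + _); rewrite mulmx_suml -sumrN; apply: eq_bigr => b _.
have ba : sh (lift a b) != sh a.
  by rewrite (inj_eq (@shift_ord_inj m i.+1)) eq_sym neq_lift.
rewrite -mulmxA tau_conj3 ?fo_sh ?ba // tau_conj mulmxA v_shift ?neq_lift // mulNmx.
by rewrite tpermL tpermD // eq_sym fo_sh.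
Qed.

Lemma q_tau_sum : hook_q *m tau_sum x1 = - (i%:R *: hook_q).
Proof.
rewrite mulmx_sumr sum_first_shift; under eq_bigr do rewrite q_fo.
rewrite v_sum_all; under eq_bigr do rewrite q_sh.
rewrite big_split /= -/hook_q sumr_const card_ord -scaler_nat scalerBr.
by rewrite addrA addrA addNr add0r -[i.+1%:R]natr1 scalerDl scale1r opprD -addrA addNr addr0.
Qed.

Lemma q_tau_all : hook_q *m tau_all = - ((i%:R + i.+1%:R) *: hook_q).
Proof.
rewrite mulmx_suml scaler_sumr -sumrN; apply: eq_bigr => a _.
by rewrite -mulmxA -tau_all_central mulmxA v_tau_all mulNmx -scalemxAl.
Qed.

(** Since m = -i in k, the coefficients cancel and T takes v to -2 [hook_q] and [hook_q] to 0.
    Semisimplicity at level p gives [hook_q] = 0. Then each transposition of x1 with a shifted point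
    acts on v by -1, so [hook_q] is also -(i + 1) v, and i + 1 is invertible. *)
Lemma hook_vanish_at : v = 0.
Proof.
(* On the p points other than x1 the diagonal terms add up to p = 0, so T is twice the class sum of
   transpositions of their symmetric group. *)
pose T := \sum_a \sum_b tau (lift x1 a) (lift x1 b).
have TE : T = tau_all - tau_sum x1 - tau_sum x1 + 1%:M.
  pose P := \sum_b tau x1 (lift x1 b).
  have e1 : tau_all = tau_sum x1 + \sum_a tau_sum (lift x1 a).
    by rewrite {1}/tau_all (bigD1_ord x1).
  have e2 : tau_sum x1 = 1%:M + P by rewrite {1}/tau_sum (bigD1_ord x1) //= tau_xx.
  have e3 : \sum_a tau_sum (lift x1 a) = P + T.
    rewrite -big_split; apply: eq_bigr => a _.
    by rewrite /tau_sum (bigD1_ord x1) //= tauC.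
  rewrite e1 e3 [tau_sum x1 + _]addrC addrK e2 opprD [- 1%:M - P]addrC addrA.
  by rewrite [P + T]addrC addrK subrK.
have vT : v *m T = - (2%:R *: hook_q).
  rewrite TE mulmxDr !mulmxBr mulmx1 v_tau_all v_tau_sum_fo -/hook_q m_eq -natr1.
  by move: hook_q => q; apply/matrixP => x y; rewrite !mxE; ring.
have qT : hook_q *m T = 0.
  rewrite TE mulmxDr !mulmxBr mulmx1 q_tau_all q_tau_sum -natr1.
  by move: hook_q => q; apply/matrixP => x y; rewrite !mxE; ring.
have AM : A (i + m) (res_along (@lift_inj _ x1) N).
  by apply: system_res_along; rewrite ?addn_gt0 ?m0 ?orbT.
have {}vT0 : v *m T = 0.
  have im0 : (0 < i + m)%N by rewrite addn_gt0 m0 orbT.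
  apply: (central_nilpotent (ssA im0 AM)) => [d W hW|s|].
  - rewrite mulmx_sumr summx_sub // => a _; rewrite mulmx_sumr summx_sub // => b _.
    by have := hW (tperm a b); rewrite /= push_tperm.
  - rewrite /= mulmx_suml mulmx_sumr [RHS](reindex_inj (@perm_inj _ s)) /=.
    apply: eq_bigr => a _; rewrite mulmx_suml mulmx_sumr [RHS](reindex_inj (@perm_inj _ s)) /=.
    by apply: eq_bigr => b _; rewrite tau_conj !push_in.
  - by rewrite vT mulNmx -scalemxAl qT scaler0 oppr0.
have q0 : hook_q = 0.
  move: vT0; rewrite vT => /eqP; rewrite oppr_eq0 scaler_eq0 (negbTE two_ne0) /=.
  exact: eqP.
have va a : v *m tau x1 (sh a) = - v.
  have := q_sh a; rewrite q0 mul0mx subr0 => /esym/eqP.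
  by rewrite addr_eq0 eq_sym eqr_oppLR => /eqP.
move: q0; rewrite /hook_q (eq_bigr (fun=> - v)) // sumr_const card_ord mulNrn -scaler_nat.
by move=> /eqP; rewrite oppr_eq0 scaler_eq0 (negbTE i1_neq0) /= => /eqP.
Qed.

End Point.

Lemma hook_vanish : v = 0.
Proof. exact: (hook_vanish_at (Ordinal m0)). Qed.

End Hook.

(** * Generators of the maximal ideal *)

Section Main.
Variable k : closedFieldType.
Local Notation kSinf := (groupalg k Sinf).

Lemma ideal_generated_two_sided (R : nzRingType) (X : set R) :
  two_sided_ideal (ideal_generated X).
Proof.
split=> [|x y Xx Xy|a x b Xx] I hI; have [[I0 IB IM] _] := hI; first exact: I0.
  by apply: IB; [exact: Xx hI | exact: Xy hI].
by apply: IM; exact: Xx hI.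
Qed.

Lemma kS_act_sum n (M : representation k [set: 'S_n]%G) (c : 'S_n -> k) :
  kS_act M (\sum_s << c s *g s >>) = \sum_s c s *: M s.
Proof.
rewrite (big_morph _ (@kS_actD _ _ M) (kS_act0 M)).
by apply: eq_bigr => s _; rewrite kS_actU.
Qed.

Lemma one_notin_ideal (A : Rep_family k) : inductive_system A -> nonzero_family A ->
  ~ ideal_of A 1.
Proof.
move=> indA [n [M [n0 AM dM]]] I1.
have e1 : 1 = kSn_incl (<< 1%g >> : groupalg k 'S_n) :> kSinf by rewrite kSn_inclU Sn_incl1.
move: I1; rewrite e1 => /(ideal_ofP _ indA n0)/(_ M AM); rewrite /Ann /= kS_actU.
rewrite scale1r repr_mx1 => /matrixP/(_ (Ordinal dM) (Ordinal dM)).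
by rewrite !mxE eqxx => /eqP; rewrite oner_eq0.
Qed.

Lemma symmetriser_in_ideal (A : Rep_family k) n : semisimple_system A -> (0 < n)%N ->
  ~ A n (triv k n) -> ideal_of A (symmetriser k n).
Proof.
move=> [indA ssA] n0 notriv; apply/(ideal_ofP _ indA n0) => M AM.
rewrite /Ann /= kS_act_sum; apply: contrapT => /eqP S0; apply: notriv.
apply: (system_summand indA n0 _ AM).
apply: (fixed_triv_summand (ssA _ _ n0 AM) _ S0) => s.
rewrite mulmx_suml [RHS](reindex_inj (mulIg s)) /=; apply: eq_bigr => t _.
by rewrite -scalemxAl repr_mxM ?inE.
Qed.

Lemma skew_in_ideal (A : Rep_family k) p i : p \in [pchar k] -> (2 < p)%N ->
  (0 < i)%N -> (i < p.-1)%N -> minimal_semisimple_system A ->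
  A (p - i)%N (triv k (p - i)) -> ~ A (p - i).+1 (triv k (p - i).+1) ->
  ideal_of A (skew_symmetriser k i.+1).
Proof.
move=> pk p2 i0 ip [[indA ssA] nzA minA]; set m := (p - i)%N => At notriv.
have m0 : (0 < m)%N by lia.
have mfact : (m`!)%:R != 0 :> k by apply: (factf_neq0 pk); lia.
have AB : sub_family A (fixed_family A m).
  apply: minA.
  - split; first exact: fixed_inductive.
    by move=> n M n0 /(fixed_sub indA n0); exact: ssA.
  - exact: fixed_nonzero.
  - by move=> n n0; exact: fixed_sub.
apply/(ideal_ofP _ indA (ltn0Sn i)) => M AM; rewrite /Ann /= kS_act_sum.
(* By minimality M embeds into the S_m-invariants of some N at level p + 1. There the image of the
   skew symmetriser S has the type that [hook_vanish] excludes. *)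
have [N [f [g [AN hf hg fg ft]]]] := AB _ (ltn0Sn i) _ AM.
set S := \sum_s _.
have ST a b : a != b -> S *m M (tperm a b) = - S.
  move=> ab; rewrite mulmx_suml -sumrN [RHS](reindex_inj (mulIg (tperm a b))) /=.
  apply: eq_bigr => t _; rewrite -scalemxAl repr_mxM ?inE // odd_permM odd_tperm ab.
  by rewrite signr_addb expr1 mulrN1 scaleNr opprK.
have Sf : S *m f = 0.
  apply: (@hook_vanish k p i m pk p2 _ _ m0 A indA ssA notriv N _ (S *m f) AN).
  - by lia.
  - by lia.
  - by move=> t; rewrite -mulmxA ft.
  - move=> a b ab; rewrite -(push_tperm (@shift_ord_inj m i.+1)) -mulmxA.
    by rewrite -[f *m _](hf (tperm a b)) mulmxA ST // mulNmx.
by rewrite -[S]mulmx1 -fg mulmxA Sf mul0mx.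
Qed.

End Main.
Theorem proposition6p2p2 (k : closedFieldType) (p : nat)
    (hp : p \in [pchar k]%R) (hp2 : (2 < p)%N)
    (i : nat) (hi : (1 < i < p - 1)%N)
    (A : Rep_family k) (hA : is_CS p i A) :
  ideal_of A =
    ideal_generated [set skew_symmetriser k i.+1; symmetriser k (p + 1 - i)].
Proof.
have [i1 ip] := andP hi; have [_ minA] := hA; rewrite gtn_eqF // => label.
have [[indA ssA] nzA _] := minA.
have eqa : (p + 1 - i)%N = (p - i).+1 by lia.
(* The label says that p - i is the last level containing the trivial module. *)
have At : A (p - i)%N (triv k (p - i)) by apply/label; lia.
have notriv : ~ A (p - i).+1 (triv k (p - i).+1) by move/label; lia.
have I1 := one_notin_ideal indA nzA.
have genI : ideal_generated [set skew_symmetriser k i.+1; symmetriser k (p + 1 - i)]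
    `<=` ideal_of A.
  apply: smallest_sub; first exact: ideal_of_two_sided.
  move=> _ [->|->]; first by apply: (skew_in_ideal hp) => //; lia.
  by rewrite eqa; apply: symmetriser_in_ideal.
apply/seteqP; split=> //.
apply: (ideal_maximal hp hi) => //.
- exact: ideal_generated_two_sided.
(* The inclusion already proved makes the generated ideal proper, so that its quotient is a non-zero
   ring. *)
- by move/genI.
- by apply: sub_gen_smallest; left.
- by apply: sub_gen_smallest; right.
- exact: ideal_of_two_sided.
Qed.
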